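(* Let $d>1$ be an integer, let $\mathbb{M}^d$ be $d$-dimensional Euclidean, hyperbolic, or spherical space (of constant sectional curvature $\kappa=0,-1,1$, respectively), and let $r\in\mathbf{R}_+$. Let $A\subseteq\mathbb{M}^d$ be a compact set of volume $V_{\mathbb{M}^d}(A)>0$. If $B\subseteq\mathbb{M}^d$ is a ball with $V_{\mathbb{M}^d}(A)=V_{\mathbb{M}^d}(B)$, then $V_{\mathbb{M}^d}(A^r)\leq V_{\mathbb{M}^d}(B^r)$.
   Context: $\mathbb{M}^d$ ($d>1$) denotes one of the simply connected complete Riemannian manifolds of constant sectional curvature $\kappa\in\{0,-1,1\}$, i.e. Euclidean space $\mathbb{E}^d$, hyperbolic space $\mathbb{H}^d$, or the unit sphere $\mathbb{S}^d$. $\mathbf{R}_+$ denotes the set of positive real numbers if $\kappa\le 0$, and the half-open interval $(0,\frac{\pi}{2}]$ if $\kappa=1$. $\mathrm{dist}_{\mathbb{M}^d}$ is the geodesic distance and $V_{\mathbb{M}^d}$ is the Lebesgue (Riemannian volume) measure. For $\mathbf{x}\in\mathbb{M}^d$ and $r\in\mathbf{R}_+$, $\mathbf{B}_{\mathbb{M}^d}[\mathbf{x},r]:=\{\mathbf{y}\in\mathbb{M}^d : \mathrm{dist}_{\mathbb{M}^d}(\mathbf{x},\mathbf{y})\le r\}$ is the closed ball with center $\mathbf{x}$ and radius $r$. For $X\subseteq\mathbb{M}^d$ and $r\in\mathbf{R}_+$ the $r$-dual set of $X$ is $X^r:=\bigcap_{\mathbf{x}\in X}\mathbf{B}_{\mathbb{M}^d}[\mathbf{x},r]$.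 *)

(* Defs.v *)
From HB Require Import structures.
From mathcomp Require Import all_boot all_order all_algebra.
From mathcomp Require Import all_classical all_reals all_analysis.

Set Implicit Arguments.
Unset Strict Implicit.
Unset Printing Implicit Defensive.

Import Order.TTheory GRing.Theory Num.Theory.
Import numFieldNormedType.Exports.

Local Open Scope classical_set_scope.
Local Open Scope ring_scope.

(* Lebesgue measure on R^n, carried by [n.-tuple R] with its product
   sigma-algebra: the pushforward of [lebesgue_measure \x lebesgue_measure_n]
   under (x, t) |-> x :: t, starting from the Dirac mass on R^0. *)
Section product_with_tuple.
Context {R : realType} (n : nat).
Local Notation T := (measurableTypeR R).

Definition cons_pair (p : T * n.-tuple T) : n.+1.-tuple T :=
  [the n.+1.-tuple T of p.1 :: p.2].

Lemma measurable_cons_pair : measurable_fun [set: _] cons_pair.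
Proof. by apply: measurable_cons; [exact: measurable_fst|exact: measurable_snd]. Qed.

Lemma behead_cons_pair p : [tuple of behead (cons_pair p)] = p.2.
Proof. exact/val_inj. Qed.

Variable mu : {sigma_finite_measure set (n.-tuple T) -> \bar R}.

Definition cons_measure : set (n.+1.-tuple T) -> \bar R :=
  pushforward (lebesgue_measure \x mu)%E cons_pair.

Let cons_measure0 : cons_measure set0 = 0%E.
Proof. by rewrite /cons_measure /pushforward preimage_set0 measure0. Qed.

Let cons_measure_ge0 A : (0 <= cons_measure A)%E.
Proof. by rewrite /cons_measure /pushforward measure_ge0. Qed.

Let cons_measure_sigma_additive : semi_sigma_additive cons_measure.
Proof.
move=> F mF tF mUF; rewrite /cons_measure /pushforward preimage_bigcup.
apply: measure_semi_sigma_additive.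
- by move=> k; rewrite -[X in measurable X]setTI; exact: measurable_cons_pair.
- apply/trivIsetP => /= i j _ _ ij; rewrite -preimage_setI.
  by move/trivIsetP : tF => /(_ _ _ _ _ ij) ->//; rewrite preimage_set0.
- rewrite -preimage_bigcup -[X in measurable X]setTI.
  exact: measurable_cons_pair.
Qed.

HB.instance Definition _ := isMeasure.Build _ _ _ cons_measure
  cons_measure0 cons_measure_ge0 cons_measure_sigma_additive.

Lemma cons_measure_sigma_finite : sigma_finite [set: _] cons_measure.
Proof.
have /sigma_finiteP[F [FT ndF Foo]] := sigma_finiteT (@lebesgue_measure R).
have /sigma_finiteP[G [GT ndG Goo]] := sigma_finiteT mu.
exists (fun k => [set t : n.+1.-tuple T | F k (thead t) /\
                    G k [tuple of behead t]]).
  apply/seteqP; split => // t _.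
  have : [set: T] (thead t) by []; rewrite FT => -[i _ Fi].
  have : [set: n.-tuple T] [tuple of behead t] by []; rewrite GT => -[j _ Gj].
  exists (maxn i j) => //; split.
    by have /subsetPset := ndF _ _ (leq_maxl i j); apply.
  by have /subsetPset := ndG _ _ (leq_maxr i j); apply.
move=> k; have [mF Fk] := Foo k; have [mG Gk] := Goo k; split.
  rewrite (_ : [set t | _] =
    ((fun t : n.+1.-tuple T => tnth t ord0) @^-1` F k) `&`
    ((fun t : n.+1.-tuple T => [tuple of behead t]) @^-1` G k)) //.
  apply: measurableI.
    by rewrite -[X in measurable X]setTI; exact: measurable_tnth.
  by rewrite -[X in measurable X]setTI; exact: measurable_behead.
rewrite /cons_measure /pushforward (_ : _ @^-1` _ = F k `*` G k); last first.
  apply/seteqP; split => p /=.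
    by rewrite theadE behead_cons_pair => -[].
  by rewrite theadE behead_cons_pair => -[].
by rewrite product_measure1E// lte_mul_pinfty// ge0_fin_numE.
Qed.

HB.instance Definition _ :=
  @Measure_isSigmaFinite.Build _ _ _ cons_measure cons_measure_sigma_finite.

End product_with_tuple.

Fixpoint lebesgue_tuple (R : realType) (n : nat) :
    {sigma_finite_measure set (n.-tuple (measurableTypeR R)) -> \bar R} :=
  match n with
  | 0 => [the sigma_finite_measure _ _ of \d_([tuple])]
  | m.+1 => [the sigma_finite_measure _ _ of cons_measure (lebesgue_tuple R m)]
  end.

Inductive geometry := Euclidean | Hyperbolic | Spherical.

Section space_form.
Context {R : realType}.
Variables (g : geometry) (d : nat).

Definition curvature : R :=
  match g with Euclidean => 0 | Hyperbolic => -1 | Spherical => 1 end.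

Local Notation kappa := curvature.

Definition admissible_radius (r : R) : Prop :=
  match g with
  | Spherical => 0 < r <= pi / 2
  | _ => 0 < r
  end.

Definition dot (u v : 'rV[R]_d) : R := \sum_i u 0 i * v 0 i.

(* All three spaces are hypersurfaces of R^(1+d) whose Riemannian metric is
   induced by the form kappa x_0 y_0 + x_1 y_1 + ... + x_d y_d:
   the affine hyperplane x_0 = 1, the upper sheet x_0 > 0 of the hyperboloid
   form x x = -1, and the unit sphere. *)
Definition ambient : Type := (R * 'rV[R]_d)%type.

HB.instance Definition _ := NormedModule.on ambient.

Definition form (x y : ambient) : R := kappa * (x.1 * y.1) + dot x.2 y.2.

Definition space_form : set ambient :=
  match g with
  | Euclidean => [set x | x.1 = 1]
  | Hyperbolic => [set x | form x x = -1 /\ 0 < x.1]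
  | Spherical => [set x | form x x = 1]
  end.

Definition arcosh (t : R) : R := ln (t + Num.sqrt (t ^+ 2 - 1)).

Definition dist (x y : ambient) : R :=
  match g with
  | Euclidean => Num.sqrt (form (x - y) (x - y))
  | Hyperbolic => arcosh (- form x y)
  | Spherical => acos (form x y)
  end.

Definition cball (x : ambient) (r : R) : set ambient :=
  [set y | space_form y /\ dist x y <= r].

(* The intersection is taken inside the space, so that the dual of the empty
   set is the whole space. *)
Definition dual_set (X : set ambient) (r : R) : set ambient :=
  space_form `&` \bigcap_(x in X) cball x r.

(* u |-> (+- sqrt (1 - kappa |u|^2), u) parametrizes the part of the space with
   x_0 > 0 (b = false) or x_0 < 0 (b = true). *)
Definition chart_domain : set 'rV[R]_d := [set u | 0 < 1 - kappa * dot u u].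

Definition chart (b : bool) (u : 'rV[R]_d) : ambient :=
  ((-1) ^+ b * Num.sqrt (1 - kappa * dot u u), u).

Definition metric_tensor (b : bool) (u : 'rV[R]_d) : 'M[R]_d :=
  \matrix_(i, j) form ('D_(delta_mx 0 i) (chart b) u)
                      ('D_(delta_mx 0 j) (chart b) u).

Definition row_of_tuple (t : d.-tuple R) : 'rV[R]_d := \row_i tnth t i.

(* Riemannian volume: the integral of sqrt (det (g_ij)) in the two charts.
   The Euclidean and hyperbolic spaces do not meet the chart b = true; the
   charts miss only the equator x_0 = 0 of the sphere, which is a null set. *)
Definition volume (A : set ambient) : \bar R :=
  (\sum_(b : bool)
     \int[lebesgue_tuple R d]_(t in
         [set t | chart_domain (row_of_tuple t) /\
                  (space_form `&` A) (chart b (row_of_tuple t))])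
       (Num.sqrt (\det (metric_tensor b (row_of_tuple t))))%:E)%E.

End space_form.

Arguments space_form {R} g d.
Arguments volume {R} g {d} A.

(* Main.v *)
(** A reflection of the space that exchanges two points [x] and [y] defines a
    two-point rearrangement (polarization) of sets and functions. It preserves
    volumes, and the polarization of a dual set lies in the dual set of the
    polarization. Fix a point [p], the centre of the ball, and consider the
    functions [f] with values in [0,1] that share a modulus of continuity and a
    bounded support, and satisfy [V {f >= 1} >= V A] and
    [V (dual {f > 0}) >= V (dual A)], where the second dual is taken for a
    slightly larger radius. By compactness some such [f] minimises the moment
    [\int f(z) |z - p|^2 dz]. Polarizing towards [p] stays in the class and
    strictly decreases the moment unless [f y <= f x] whenever [x] is closer to
    [p] than [y]; hence the minimiser is radially decreasing. Since
    [V {f >= 1} >= V B], it is at least 1 on the interior of [B], which gives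
    [V (dual A) <= V (dual (int B))] for the larger radius, and the radius
    tends to the given one.

    Distances enter only through [sqdist x y = form (x - y) (x - y)], a
    polynomial that is an increasing function of the geodesic distance. Volumes
    are compared with the Lebesgue measure of the cone
    [{c x | x in the set, 0 < c <= 1}] in the ambient space, on which the
    reflections act by linear maps. *)

From HB Require Import structures.
From mathcomp Require Import all_boot all_order all_algebra.
From mathcomp Require Import all_classical all_reals all_analysis.
From mathcomp Require Import measurable_realfun simple_functions measurable_fun_approximation ring lra.
Require Import Defs.
Set Implicit Arguments.
Unset Strict Implicit.
Unset Printing Implicit Defensive.
Import Order.TTheory GRing.Theory Num.Theory.
Import numFieldNormedType.Exports.
Local Open Scope classical_set_scope.
Local Open Scope ring_scope.

(** Symmetrization by polarization usually iterates reflections until a set converges to a ball. A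
    minimiser avoids this: a single pair of points in the wrong order contradicts minimality. Sets
    make poor competitors, since Hausdorff limits can gain volume and the moment is then not
    continuous; a common modulus of continuity, which polarization preserves, gives uniform limits,
    along which the moment converges. The constraints use the closed level [1 <= f] and the open
    level [0 < f], because the superlevel set of the first and the dual set of the second are
    decreasing intersections of those for nearby levels, so that continuity from above carries the
    volume bounds to the limit. The larger radius leaves room for an initial competitor, a
    continuous ramp equal to 1 on [A] whose positivity set stays within the new radius of every
    point of the dual of [A]. The closed ball is recovered from the open one because each of its
    boundary points is a limit of points closer to [p]. *)

(** * General lemmas on measures and filters *)

Lemma measurable_set_bool d (T : measurableType d) (f : T -> bool) :
  measurable_fun [set: T] f -> measurable [set x | f x].
Proof. by move=> /(_ measurableT [set true]); rewrite setTI; exact. Qed.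

Lemma ge0_integral_invariant (R : realType) d (X : measurableType d)
    (mu : {measure set X -> \bar R}) (s : X -> X) (f : X -> \bar R) :
  measurable_fun setT s -> (forall A, measurable A -> mu (s @^-1` A) = mu A) ->
  measurable_fun setT f -> (forall z, 0 <= f z)%E ->
  (\int[mu]_z f (s z) = \int[mu]_z f z)%E.
Proof.
move=> ms smu mf f0.
rewrite -[LHS](ge0_integral_pushforward ms mu (D := setT))//.
by apply: eq_measure_integral => A mA _; exact: smu.
Qed.

(** Continuity from above. It carries the volume bounds to a limit of competitors and brings the
    enlarged radius back to the given one. *)
Lemma measure_bigcap_ge (R : realType) (disp : measure_display) (X : measurableType disp)
    (mu : {measure set X -> \bar R}) (F : nat -> set X) (a : \bar R) :
  (mu (F 0%N) < +oo)%E -> (forall n, measurable (F n)) ->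
  (forall n m, (n <= m)%N -> F m `<=` F n) -> (forall n, a <= mu (F n))%E ->
  (a <= mu (\bigcap_n F n))%E.
Proof.
move=> F0 mF dF aF; have mI : measurable (\bigcap_n F n) by exact: bigcapT_measurable.
have dF' : nonincreasing_seq F by move=> n m nm; apply/subsetPset; exact: dF.
apply: (cvge_to_ge (nonincreasing_cvg_mu F0 mF mI dF')).
by apply: nearW => n; exact: aF.
Qed.

(** If the preimage of a set of a finer filter were not in [U], the complement of the set would
    belong to the image of [U], hence to the finer filter. *)
Lemma ultra_fmap (I J : Type) (f : I -> J) (U : set_system I) :
  UltraFilter U -> UltraFilter (f @ U).
Proof.
move=> UU; apply: Build_UltraFilter => G GG UG.
apply/seteqP; split => A; last exact: UG.
move=> GA; have [//|UC] := in_ultra_setVsetC (f @^-1` A) UU.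
have GC : G (~` A) by apply: UG.
have : G set0 by rewrite -(classical_sets.setICr A); exact: filterI.
by move=> /(@filter_not_empty _ G GG).
Qed.

(** * Lebesgue measure on tuples *)

Section OneDim.
Context {R : realType}.
Local Notation T := (measurableTypeR R).
Local Notation leb := (@lebesgue_measure R).

Lemma integral_lebesgue_oppr (f : R -> \bar R) :
  measurable_fun [set: R] f -> (forall x, 0 <= f x)%E ->
  (\int[leb]_x f (- x)%R = \int[leb]_x f x)%E.
Proof.
move=> mf f0.
have mN : measurable_fun [set: T] (-%R : T -> T) by exact: oppr_measurable.
rewrite -[LHS](ge0_integral_pushforward mN leb (D := setT))//.
by apply: eq_measure_integral => A mA _; exact: lebesgue_measureN.
Qed.

Lemma integral_lebesgue_affine (a b : R) (f : R -> \bar R) : 0 < a ->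
  measurable_fun [set: R] f -> (forall x, 0 <= f x)%E ->
  (a%:E * \int[leb]_x f (a * x + b)%R = \int[leb]_x f x)%E.
Proof.
move=> a0 mf f0.
pose phi := (fun x => a * x + b) : T -> T.
have mphi : measurable_fun [set: T] phi.
  by apply: measurable_funD => //; apply: measurable_funM.
rewrite -(ge0_integral_pushforward mphi leb (D := setT))//.
have a0' : 0 <= a by exact: ltW.
rewrite -(@ge0_integral_mscale _ _ _ (pushforward leb phi) _ measurableT (NngNum a0'))//.
apply: eq_measure_integral => A mA _; apply/esym/lebesgue_measure_unique => //.
move=> _ [[u v]] _ <-.
change (leb `]u, v]%classic = a%:E * leb (phi @^-1` `]u, v]%classic))%E.
have -> : phi @^-1` `]u, v] = `](u - b) / a, (v - b) / a]%classic.
  apply/seteqP; split=> x /=; rewrite !in_itv/= ltr_pdivrMr// ler_pdivlMr//.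
    by rewrite /phi mulrC => /andP[? ?]; apply/andP; split; lra.
  by rewrite /phi mulrC => /andP[? ?]; apply/andP; split; lra.
rewrite !lebesgue_measure_itv/= !lte_fin ltr_pM2r ?invr_gt0// ltrD2r.
case: ifPn => _; last by rewrite mule0.
rewrite -!EFinB -EFinM; congr EFin; field.
by rewrite gt_eqF.
Qed.

(** The derivative of the square root, hence the density of the substitution [y = x^2]. *)
Let w (y : R) : R := (2 * Num.sqrt y)^-1.

Lemma measurable_sqrt : measurable_fun [set: R] (@Num.sqrt R).
Proof. by apply: continuous_measurable_fun; exact: sqrt_continuous. Qed.

Lemma measurable_inv : measurable_fun [set: R] (@GRing.inv R).
Proof.
have mset1 : measurable [set~ (0 : R)] by apply: measurableC.
suff: measurable_fun ([set (0:R)] `|` [set~ 0]) (@GRing.inv R).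
  by rewrite setUv.
apply/measurable_funU => //; split; first exact: measurable_fun_set1.
apply: open_continuous_measurable_fun; last first.
  by move=> x /set_mem/= /eqP x0; exact: inv_continuous.
by apply: closed_openC; apply: accessible_closed_set1; exact: hausdorff_accessible.
Qed.

Let measurable_w : measurable_fun [set: R] w.
Proof.
apply: (measurableT_comp measurable_inv).
by apply: measurable_funM => //; exact: measurable_sqrt.
Qed.

Let G : set (T * T) := [set p | [&& 0 < p.1, 0 < p.2 & p.2 < w p.1]].

Let measurable_G : measurable G.
Proof.
have m1 : measurable_fun [set: T * T] (fun p : T * T => 0 < (p.1 : R)).
  by apply: measurable_fun_ltr => //; exact: measurable_fst.
have m2 : measurable_fun [set: T * T] (fun p : T * T => 0 < (p.2 : R)).
  by apply: measurable_fun_ltr => //; exact: measurable_snd.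
have m3 : measurable_fun [set: T * T] (fun p : T * T => (p.2 : R) < w p.1).
  by apply: measurable_fun_ltr => //; exact: (measurableT_comp measurable_w).
exact: (measurable_set_bool (measurable_and m1 (measurable_and m2 m3))).
Qed.

Let phi (p : T * T) : T := Num.sqrt p.1.

Let measurable_phi : measurable_fun setT phi.
Proof. by apply: (measurableT_comp measurable_sqrt); exact: measurable_fst. Qed.

(* [N] is the pushforward of the area under the graph of [w] by
   [(y, z) |-> sqrt y]; on intervals it is Lebesgue measure on the positive reals. *)
Let N : {measure set T -> \bar R} :=
  measure_function_pushforward__canonical__measure_function_Measure
    (mrestr (leb \x leb)%E measurable_G) measurable_phi.

Let NE (S : set R) : measurable S ->
  N S = (\int[leb]_y (if (0 < y)%R && `[< S (Num.sqrt y) >] then (w y)%:E else 0))%E.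
Proof.
move=> mS; rewrite /N/= /pushforward/= /mrestr.
rewrite /product_measure1/=; apply: eq_integral => y _ /=.
have [y0|y0] := ltP 0 y => /=; last first.
  rewrite (_ : xsection _ _ = set0) ?measure0//.
  by apply/seteqP; split => // z; rewrite /xsection/= inE /= /G/= => -[_ /andP[]]; lra.
case: asboolP => Sy; last first.
  rewrite (_ : xsection _ _ = set0) ?measure0//.
  by apply/seteqP; split => // z; rewrite /xsection/= inE /= /G/= => -[].
rewrite (_ : xsection _ _ = `]0, w y[%classic).
  rewrite lebesgue_measure_itv/= lte_fin ifT ?oppr0 ?sube0 ?adde0//.
  by rewrite /w invr_gt0 mulr_gt0// sqrtr_gt0.
apply/seteqP; split => z; rewrite /xsection/= inE /= /G/= in_itv/=.
  by move=> [_ /andP[]].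
by move=> zw; split; [exact: Sy|rewrite y0].
Qed.

Let N_itv_gt0 (a b : R) : 0 < a -> a < b -> N `]a, b]%classic = (b - a)%:E.
Proof.
move=> a0 ab; rewrite NE//.
have b0 : 0 < b by exact: lt_trans ab.
transitivity (\int[leb]_(y in `](a ^+ 2)%R, (b ^+ 2)%R]%classic) (w y)%:E)%E.
  rewrite [RHS]integral_mkcond/=; apply: eq_integral => y _.
  rewrite patchE; congr (if _ then _ else _).
  apply/andP/idP => [[y0]|].
    move=> /asboolP/=; rewrite in_itv/= => /andP[ay yb].
    rewrite inE/= in_itv/= -[y in _ < y](sqr_sqrtr (ltW y0)).
    by rewrite -[y in y <= _](sqr_sqrtr (ltW y0)) ltr_pXn2r ?ler_pXn2r ?nnegrE ?sqrtr_ge0 ?ay// ltW.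
  rewrite inE/= in_itv/= => /andP[ay yb].
  have y0 : 0 < y by apply: lt_trans ay; rewrite exprn_gt0.
  split=> //; apply/asboolP => /=; rewrite in_itv/=.
  rewrite -[X in X < _](gtr0_norm a0) -sqrtr_sqr ltr_sqrt// ay/=.
  by rewrite -[X in _ <= X](gtr0_norm b0) -sqrtr_sqr ler_sqrt ?exprn_ge0// ltW.
have ab2 : a ^+ 2 < b ^+ 2 by rewrite ltr_pXn2r ?nnegrE ?ltW.
rewrite integral_itv_obnd_cbnd; last first.
  by apply/measurable_EFinP; apply: measurable_funTS; exact: measurable_w.
have pos y : a ^+ 2 < y -> 0 < y by apply: lt_trans; rewrite exprn_gt0.
rewrite (@continuous_FTC2 _ w (@Num.sqrt R))//.
- by rewrite !sqrtr_sqr !gtr0_norm.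
- apply: continuous_in_subspaceT => y /set_mem/=; rewrite in_itv/= => /andP[ay _].
  have y0 : 0 < y by apply: lt_le_trans ay; rewrite exprn_gt0.
  rewrite /w; apply: (@continuousV _ _ (fun y => 2 * Num.sqrt y)); first by rewrite mulf_neq0// gt_eqF// sqrtr_gt0.
  by apply: (@continuousM _ _ (fun=> 2)); [exact: cvg_cst|exact: sqrt_continuous].
- split.
  + by move=> y; rewrite in_itv/= => /andP[/pos y0 _]; apply: ex_derive; exact: is_derive1_sqrt.
  + by apply: cvg_at_right_filter; exact: sqrt_continuous.
  + by apply: cvg_at_left_filter; exact: sqrt_continuous.
- by move=> y; rewrite in_itv/= => /andP[/pos y0 _]; rewrite derive1E derive_sqrt.
Qed.

Let N_itv (a b : R) : a < b -> N `]a, b]%classic = leb (`]a, b]%classic `&` `]0, +oo[%classic).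
Proof.
move=> ab.
have Npos (S : set R) : measurable S -> N S = N (S `&` `]0, +oo[%classic).
  move=> mS; rewrite !NE//; last exact: measurableI.
  apply: eq_integral => y _; case: ltP => //= y0.
  congr (if _ then _ else _); apply/asboolP/asboolP => [Sy|[]//]; split=> //.
  by rewrite /= in_itv/= andbT sqrtr_gt0.
have [b0|b0] := leP b 0.
  rewrite Npos// (_ : _ `&` _ = set0) ?measure0//.
  by apply/seteqP; split => // y []/=; rewrite !in_itv/= => /andP[_ ?]; rewrite andbT; lra.
have [a0|a0] := ltP 0 a.
  rewrite N_itv_gt0//.
  rewrite (_ : _ `&` _ = `]a, b]%classic); last first.
    apply/seteqP; split => [y []//|y]/=; rewrite !in_itv/= andbT => /andP[ay yb].
    by rewrite ay yb (lt_trans a0).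
  by rewrite lebesgue_measure_itv/= lte_fin ab.
rewrite Npos// (_ : _ `&` _ = `]0, b]%classic); last first.
  apply/seteqP; split => y /=; rewrite !in_itv/= andbT; first by move=> [/andP[_ ->] ->].
  by move=> /andP[y0 ->]; rewrite y0 (le_lt_trans a0).
(* The density is unbounded near 0, so []0, b]] is exhausted by intervals away from 0; [n.+2] makes
   each of them nonempty, including the one for [n = 0]. *)
pose F n := `]b / n.+2%:R, b]%classic : set R.
have FE : `]0, b]%classic = \bigcup_n F n.
  apply/seteqP; split => y /=; rewrite ?in_itv/=.
    move=> /andP[y0 yb]; exists (Num.truncn (b / y)) => //.
    rewrite /F/= in_itv/= yb andbT ltr_pdivrMr// mulrC -ltr_pdivrMr//.
    by apply: lt_trans (truncnS_gt _) _; rewrite ltr_nat.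
  by move=> [n _]; rewrite /F/= in_itv/= => /andP[y0 ->]; rewrite andbT; apply: lt_trans y0; rewrite divr_gt0.
have ndF : {homo F : n m / (n <= m)%N >-> (n <= m)%O}.
  move=> n m nm; apply/subsetPset => y; rewrite /F/= !in_itv/= => /andP[ny ->].
  by rewrite andbT; apply: le_lt_trans ny; rewrite ler_pM2l// lef_pV2 ?posrE// ler_nat !ltnS.
have mF n : measurable (F n) by exact: measurable_itv.
have mU : measurable (\bigcup_n F n) by exact: bigcupT_measurable.
have cN := @nondecreasing_cvg_mu _ _ _ N F mF mU ndF.
have cl := @nondecreasing_cvg_mu _ _ _ leb F mF mU ndF.
rewrite FE; apply: (cvg_unique _ cN) => //.
rewrite (_ : N \o F = leb \o F)//; apply/funext => n /=.
have bn : b / n.+2%:R < b by rewrite ltr_pdivrMr// ltr_pMr// ltr1n.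
rewrite N_itv_gt0// ?divr_gt0//.
by rewrite lebesgue_measure_itv/= lte_fin bn.
Qed.

(** Lebesgue measure equals its restriction to the nonpositive half-line plus [N], because both
    agree on half-open intervals; [N] of the set is the integral on the right. This converts slices
    of the cone in the first coordinate into slices in the height. *)
Lemma lebesgue_measure_preimage_sqr (S : set R) : measurable S ->
  (leb [set x | (0 < x) && `[< S (x ^+ 2) >]]%R =
   \int[leb]_y (if (0 < y)%R && `[< S y >] then ((2 * Num.sqrt y)^-1)%:E else 0))%E.
Proof.
move=> mS.
have mneg : measurable (`]-oo, (0 : R)]%classic : set T) by exact: measurable_itv.
pose nu := measure_add (mrestr leb mneg) N.
have nuE A : nu A = (leb (A `&` `]-oo, 0%R]%classic) + N A)%E by exact: measure_addE.
have lebE : forall A, measurable A -> leb A = nu A.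
  apply: lebesgue_measure_unique => _ [[a b]] _ <-/=.
  apply/esym; rewrite [LHS]nuE; apply/esym.
  have [ab|ba] := ltP a b; last first.
    by rewrite set_itv_ge ?set0I ?measure0 ?adde0// bnd_simp -leNgt.
  rewrite N_itv//= -measureU//; first last.
  - by apply/seteqP; split => // y [] /= [_]; rewrite in_itv/= => ? [_]; rewrite in_itv/= andbT; lra.
  - by apply: measurableI.
  - by apply: measurableI.
  rewrite -setIUr (_ : _ `|` _ = setT) ?setIT//.
  by apply/seteqP; split => // y _; have [y0|y0] := leP y 0; [left|right]; rewrite /= in_itv/= ?y0.
have mS' : measurable [set x : R | (0 < x) && `[< S (x ^+ 2) >]].
  apply: measurable_set_bool; apply: measurable_and.
    exact: measurable_fun_ltr.
  have := @exprn_measurable R setT 2 => /(_ measurableT S mS).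
  rewrite setTI => m2; apply: (measurable_fun_bool true); rewrite setTI.
  by rewrite (_ : _ @^-1` _ = (fun x : R => x ^+ 2) @^-1` S)//; apply/seteqP; split => x /= /asboolP.
rewrite lebE// [LHS]nuE (_ : _ `&` _ = set0) ?measure0 ?add0e; last first.
  by apply/seteqP; split => // y []/= /andP[? _]; rewrite in_itv/=; lra.
rewrite [LHS]NE//; apply: eq_integral => y _; case: ltP => //= y0.
congr (if _ then _ else _); apply/asboolP/asboolP => /=.
  by move=> /andP[_ /asboolP]; rewrite sqr_sqrtr// ltW.
by move=> Sy; rewrite sqrtr_gt0 y0/=; apply/asboolP; rewrite sqr_sqrtr// ltW.
Qed.

End OneDim.

Section Tuples.
Context {R : realType}.
Local Notation T := (measurableTypeR R).
Local Notation leb := (@lebesgue_measure R).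
Local Notation lam := (lebesgue_tuple R).

Lemma integral_lebesgue_tupleS n (f : n.+1.-tuple T -> \bar R) :
  measurable_fun setT f -> (forall t, 0 <= f t)%E ->
  (\int[lam n.+1]_t f t = \int[leb]_x \int[lam n]_t f (cons_pair (x, t)))%E.
Proof.
move=> mf f0.
rewrite -[LHS]/(\int[pushforward (leb \x lam n)%E (@cons_pair R n)]_t f t)%E.
rewrite (ge0_integral_pushforward (@measurable_cons_pair R n) _ (D := setT))//.
rewrite preimage_setT fubini_tonelli1//.
  by apply: measurableT_comp => //; exact: measurable_cons_pair.
by move=> p; exact: f0.
Qed.

Lemma integral_lebesgue_tupleS_swap n (f : n.+1.-tuple T -> \bar R) :
  measurable_fun setT f -> (forall t, 0 <= f t)%E ->
  (\int[lam n.+1]_t f t = \int[lam n]_t \int[leb]_x f (cons_pair (x, t)))%E.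
Proof.
move=> mf f0.
rewrite -[LHS]/(\int[pushforward (leb \x lam n)%E (@cons_pair R n)]_t f t)%E.
rewrite (ge0_integral_pushforward (@measurable_cons_pair R n) _ (D := setT))//.
rewrite preimage_setT fubini_tonelli2//.
  by apply: measurableT_comp => //; exact: measurable_cons_pair.
by move=> p; exact: f0.
Qed.

Lemma measurable_cons_pairl n (x : T) :
  measurable_fun setT (fun t : n.-tuple T => cons_pair (x, t)).
Proof.
apply: (measurableT_comp (@measurable_cons_pair R n)).
by apply: measurable_fun_pair.
Qed.

Lemma measurable_cons_pairr n (t : n.-tuple T) :
  measurable_fun setT (fun x : T => cons_pair (x, t)).
Proof.
apply: (measurableT_comp (@measurable_cons_pair R n)).
by apply: measurable_fun_pair.
Qed.

Definition upd n (k : 'I_n) (a : T) (t : n.-tuple T) : n.-tuple T :=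
  [tuple if i == k then a else tnth t i | i < n].

Lemma measurable_upd d (X : measurableType d) n (k : 'I_n) (a : X -> T) (t : X -> n.-tuple T) :
  measurable_fun setT a -> measurable_fun setT t ->
  measurable_fun setT (fun x => upd k (a x) (t x)).
Proof.
move=> ma mt; apply/measurable_fun_tnthP => i.
rewrite [X in measurable_fun _ X](_ : _ = fun x => if i == k then a x else tnth (t x) i).
  by case: eqP => // _; exact: (measurableT_comp (measurable_tnth i) mt).
by apply/funext => x /=; rewrite tnth_mktuple.
Qed.

Lemma upd0_cons n (a x : T) (t : n.-tuple T) :
  upd ord0 a (cons_pair (x, t)) = cons_pair (a, t).
Proof.
apply: eq_from_tnth => i; rewrite tnth_mktuple; case: eqP => [->//|].
by case: (unliftP ord0 i) => [j ->|->//] _; rewrite !tnthS.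
Qed.

Lemma updS_cons n (k : 'I_n) (a x : T) (t : n.-tuple T) :
  upd (lift ord0 k) a (cons_pair (x, t)) = cons_pair (x, upd k a t).
Proof.
apply: eq_from_tnth => i; rewrite tnth_mktuple.
case: (unliftP ord0 i) => [j ->|->//]; last first.
by rewrite !tnthS tnth_mktuple (inj_eq (@lift_inj _ _)).
Qed.

(** Fubini isolates the coordinate [k], on which the map is a translation, preceded by a sign change
    if [b] holds. Shears and reflections are built from such maps. *)
Lemma integral_lebesgue_tuple_upd n (k : 'I_n) (b : bool) (psi : n.-tuple T -> R)
    (f : n.-tuple T -> \bar R) :
  measurable_fun setT psi -> (forall a t, psi (upd k a t) = psi t) ->
  measurable_fun setT f -> (forall t, 0 <= f t)%E ->
  (\int[lam n]_t f (upd k ((-1) ^+ b * tnth t k + psi t)%R t) = \int[lam n]_t f t)%E.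
Proof.
elim: n k b psi f => [[]//|n IHn] k b psi f mpsi psik mf f0.
have mU : measurable_fun setT (fun t : n.+1.-tuple T =>
    f (upd k ((-1) ^+ b * tnth t k + psi t) t)).
  apply: (measurableT_comp mf); apply: measurable_upd => //.
  apply: measurable_funD => //; apply: measurable_funM => //.
  exact: measurable_tnth.
case: (unliftP ord0 k) => [j|] kE; last first.
  rewrite !integral_lebesgue_tupleS_swap//.
  apply: eq_integral => t _; rewrite kE.
  under eq_integral => x _.
    rewrite upd0_cons (_ : psi _ = psi (cons_pair (0, t))); last first.
      by rewrite -(psik 0) kE upd0_cons.
    over.
  rewrite /=.
  have mft : measurable_fun [set: R] (fun x => f (cons_pair (x, t))).
    by apply: (measurableT_comp mf); exact: measurable_cons_pairr.
  pose c := psi (cons_pair (0, t)).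
  rewrite -(@integral_lebesgue_affine R 1 c (fun x => f (cons_pair (x, t))))// mul1e.
  have mfc : measurable_fun [set: R] (fun x => f (cons_pair ((1 * x + c)%R, t))).
    apply: (measurableT_comp mft).
    by apply: measurable_funD => //; apply: measurable_funM.
  case: b {mU}; last by apply: eq_integral => x _; rewrite expr0.
  rewrite -(@integral_lebesgue_oppr R (fun x => f (cons_pair ((1 * x + c)%R, t))))//.
  by apply: eq_integral => x _; rewrite expr1 mulN1r mul1r.
rewrite !integral_lebesgue_tupleS//.
apply: eq_integral => x _; rewrite kE.
under eq_integral do rewrite updS_cons tnthS.
apply: (IHn j b (fun t => psi (cons_pair (x, t))) (fun t => f (cons_pair (x, t)))) => //.
- by apply: (measurableT_comp mpsi); exact: measurable_cons_pairl.
- by move=> a t; rewrite -updS_cons -kE.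
- by apply: (measurableT_comp mf); exact: measurable_cons_pairl.
Qed.

Definition scale_tuple n (c : R) (t : n.-tuple T) : n.-tuple T :=
  [tuple c * tnth t i | i < n].

Lemma measurable_scale_tuple n c : measurable_fun setT (@scale_tuple n c).
Proof.
apply/measurable_fun_tnthP => i.
rewrite [X in measurable_fun _ X](_ : _ = fun t : n.-tuple T => c * tnth t i).
  by apply: measurable_funM => //; exact: measurable_tnth.
by apply/funext => t /=; rewrite tnth_mktuple.
Qed.

Lemma scale_tuple_cons n c (x : T) (t : n.-tuple T) :
  scale_tuple c (cons_pair (x, t)) = cons_pair (c * x, scale_tuple c t).
Proof.
apply: eq_from_tnth => i; rewrite tnth_mktuple.
by case: (unliftP ord0 i) => [j ->|->//]; rewrite !tnthS tnth_mktuple.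
Qed.

Lemma integral_lebesgue_tuple_scale n (c : R) (f : n.-tuple T -> \bar R) : 0 < c ->
  measurable_fun setT f -> (forall t, 0 <= f t)%E ->
  ((c ^+ n)%:E * \int[lam n]_t f (scale_tuple c t) = \int[lam n]_t f t)%E.
Proof.
move=> c0; elim: n f => [|n IHn] f mf f0.
  rewrite expr0 mul1e; apply: eq_integral => t _.
  by congr f; rewrite (tuple0 (scale_tuple _ _)) (tuple0 t).
have mfc := measurableT_comp mf (@measurable_scale_tuple n.+1 c).
rewrite !integral_lebesgue_tupleS//.
under eq_integral do under eq_integral do rewrite scale_tuple_cons.
have mx x : measurable_fun setT (fun t : n.-tuple T => f (cons_pair (x, t))).
  by apply: (measurableT_comp mf); exact: measurable_cons_pairl.
pose h x := (\int[lam n]_t f (cons_pair (x, t)))%E.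
have mh : measurable_fun [set: R] h.
  apply: (@measurable_fun_fubini_tonelli_F _ _ _ _ _ (lam n) (f \o @cons_pair R n)).
    by apply: measurableT_comp => //; exact: measurable_cons_pair.
  by move=> p; exact: f0.
have h0 x : (0 <= h x)%E by apply: integral_ge0.
have mg : measurable_fun [set: R]
    (fun x => \int[lam n]_t f (cons_pair ((c * x)%R, scale_tuple c t)))%E.
  apply: (@measurable_fun_fubini_tonelli_F _ _ _ _ _ (lam n)
    (fun p : T * n.-tuple T => f (cons_pair (c * p.1, scale_tuple c p.2)))).
    apply: (measurableT_comp mf).
    apply: (measurableT_comp (@measurable_cons_pair R n)).
    apply: measurable_fun_pair; first by apply: measurable_funM => //; exact: measurable_fst.
    by apply: (measurableT_comp (@measurable_scale_tuple n c)); exact: measurable_snd.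
  by move=> p; exact: f0.
have g0 x : (0 <= \int[lam n]_t f (cons_pair ((c * x)%R, scale_tuple c t)))%E.
  by apply: integral_ge0 => t _; exact: f0.
rewrite exprS EFinM -muleA -(ge0_integralZl leb measurableT mg)//; last first.
  by rewrite lee_fin exprn_ge0// ltW.
transitivity (\int[leb]_x h x)%E => //.
rewrite -(@integral_lebesgue_affine R c 0 h)//; congr (_ * _)%E.
apply: eq_integral => x _; rewrite addr0 /h.
exact: (IHn (fun t => f (cons_pair ((c * x)%R, t))) (mx (c * x)%R) (fun=> f0 _)).
Qed.

End Tuples.

Section LinearReflection.
Context {R : realType}.
Local Notation T := (measurableTypeR R).
Local Notation leb := (@lebesgue_measure R).
Local Notation lam := (lebesgue_tuple R).

Lemma measurable_dist_lt d (X : measurableType d) (f : X -> R) (a e : R) :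
  measurable_fun setT f -> measurable_fun setT (fun x => `|f x - a| < e).
Proof.
move=> mf; apply: measurable_fun_ltr => //.
apply: (@measurableT_comp _ _ _ _ _ _ (@Num.norm _ R) _ (fun x => f x - a)) => //.
exact: measurable_funB.
Qed.

Lemma lebesgue_tuple_cube n (c : n.-tuple R) (e : R) : 0 < e ->
  lam n [set t | forall i, `|tnth t i - tnth c i| < e] = ((e + e) ^+ n)%:E.
Proof.
move=> e0; elim: n c => [|n IHn] c.
  by rewrite /= /dirac indicE mem_set// => -[].
rewrite -[LHS]/((leb \x lam n)%E (@cons_pair R n @^-1` _)).
pose D : n.-tuple R := [tuple of behead c].
have mD : measurable [set t : n.-tuple T | forall i, `|tnth t i - tnth D i| < e].
  rewrite (_ : [set t | _] = \bigcap_(i in [set: 'I_n]) [set t | `|tnth t i - tnth D i| < e]).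
    apply: fin_bigcap_measurable => // i _; apply: measurable_set_bool.
    apply: measurable_dist_lt; exact: measurable_tnth.
  by apply/seteqP; split => t /= H i; [move=> _|]; exact: H.
rewrite (_ : _ @^-1` _ = [set x : T | `|x - thead c| < e] `*`
    [set t | forall i, `|tnth t i - tnth D i| < e]).
  rewrite product_measure1E//; last first.
    by apply: measurable_set_bool; exact: measurable_dist_lt.
  rewrite IHn exprS EFinM; congr (_ * _)%E.
  rewrite -[LHS]/(leb [set x : T | `|x - thead c| < e]).
  rewrite (_ : [set x : T | _] = `](thead c - e), (thead c + e)[%classic).
    rewrite lebesgue_measure_itv/= lte_fin ltrD2l gtrN// -EFinB.
    by congr (_%:E); lra.
  by apply/seteqP; split => x /=; rewrite in_itv/= ltr_distl.
have DE i : tnth D i = tnth c (lift ord0 i) by rewrite [in RHS](tuple_eta c) tnthS.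
apply/seteqP; split => -[x t] /=.
  move=> H; split; first exact: (H ord0).
  by move=> i; have := H (lift ord0 i); rewrite DE tnthS.
move=> [H1 H2] i; case: (unliftP ord0 i) => [j ->|->]; last exact: H1.
by rewrite tnthS -DE.
Qed.

Definition shear n (k : 'I_n) (d : 'I_n -> R) (t : n.-tuple T) : n.-tuple T :=
  [tuple tnth t i + (if i == k then 0 else d i) * tnth t k | i < n].

Lemma measurable_linear n (c : 'I_n -> R) :
  measurable_fun [set: n.-tuple T] (fun t => \sum_i c i * tnth t i).
Proof.
apply: measurable_sum => i; apply: measurable_funM => //; exact: measurable_tnth.
Qed.

Lemma measurable_shear n k d : measurable_fun setT (@shear n k d).
Proof.
apply/measurable_fun_tnthP => i.
rewrite [X in measurable_fun _ X](_ : _ =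
    fun t : n.-tuple T => tnth t i + (if i == k then 0 else d i) * tnth t k).
  apply: measurable_funD; first exact: measurable_tnth.
  by apply: measurable_funM => //; exact: measurable_tnth.
by apply/funext => t /=; rewrite tnth_mktuple.
Qed.

Lemma integral_lebesgue_tuple_shear n (k : 'I_n) (d : 'I_n -> R) (f : n.-tuple T -> \bar R) :
  measurable_fun setT f -> (forall t, 0 <= f t)%E ->
  (\int[lam n]_t f (shear k d t) = \int[lam n]_t f t)%E.
Proof.
move=> mf f0.
(* [ds s] shears only the coordinates listed in [s]; each induction step adds one coordinate, which
   is a translation of it by a multiple of the [k]-th. *)
pose ds (s : seq 'I_n) i := if i \in s then d i else 0.
suff: forall s, uniq s -> (\int[lam n]_t f (shear k (ds s) t) = \int[lam n]_t f t)%E.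
  move=> /(_ (enum 'I_n) (enum_uniq _)) <-; apply: eq_integral => t _.
  congr f; apply: eq_from_tnth => i; rewrite !tnth_mktuple /ds.
  by rewrite mem_enum.
elim=> [_|j s IHs /= /andP[js us]].
  apply: eq_integral => t _; congr f; apply: eq_from_tnth => i.
  by rewrite tnth_mktuple /ds in_nil; case: ifP; rewrite mul0r addr0.
pose c := if j == k then 0 else d j.
rewrite -IHs//.
have [jk|jk] := eqVneq j k.
  apply: eq_integral => t _; congr f; apply: eq_from_tnth => i.
  rewrite !tnth_mktuple; case: eqP => // ik; rewrite /ds in_cons.
  by case: eqP => // ij; move: ik; rewrite ij jk.
have psiP a (t : n.-tuple T) : d j * tnth (upd j a t) k = d j * tnth t k.
  by rewrite tnth_mktuple eq_sym (negbTE jk).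
rewrite -(@integral_lebesgue_tuple_upd R n j false (fun t => d j * tnth t k)
   (fun t => f (shear k (ds s) t)))//.
- apply: eq_integral => t _; congr f; apply: eq_from_tnth => i.
  rewrite !tnth_mktuple (eq_sym k) (negbTE jk) /ds in_cons expr0 mul1r.
  have [->|ij] := eqVneq i j; rewrite ?(negbTE jk)//.
  by rewrite (negbTE js) mul0r addr0.
- by apply: measurable_funM => //; exact: measurable_tnth.
- by apply: (measurableT_comp mf); exact: measurable_shear.
Qed.

(* With [k] such that [w k != 0], the map is the conjugate by a shear of a map that
   changes only the [k]-th coordinate. *)
Lemma integral_lebesgue_tuple_reflection n (w c : 'I_n -> R) (f : n.-tuple T -> \bar R) :
  \sum_i c i * w i = 2 ->
  measurable_fun setT f -> (forall t, 0 <= f t)%E ->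
  (\int[lam n]_t f [tuple tnth t i - (\sum_j c j * tnth t j) * w i | i < n]%R
   = \int[lam n]_t f t)%E.
Proof.
move=> cw mf f0.
have [k wk] : exists k, w k != 0.
  apply/existsP; rewrite -negb_forall; apply/negP => /forallP w0.
  move: cw; rewrite big1 => [|i _]; last by rewrite (eqP (w0 i)) mulr0.
  by move/esym/eqP; rewrite pnatr_eq0.
pose d i := w i / w k.
pose psi (t : n.-tuple T) := - w k * \sum_(i | i != k) c i * tnth t i.
pose F (t : n.-tuple T) := upd k ((-1) ^+ true * tnth t k + psi t) t.
have mpsi : measurable_fun [set: n.-tuple T] psi.
  apply: measurable_funM => //.
  rewrite [X in measurable_fun _ X](_ : _ = fun t : n.-tuple T => \sum_i (if i != k then c i else 0) * tnth t i).
    exact: measurable_linear.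
  by apply/funext => t; rewrite big_mkcond; apply: eq_bigr => i _; case: ifP; rewrite ?mul0r.
have mfd : measurable_fun setT (fun t => f (shear k d t)).
  by apply: (measurableT_comp mf); exact: measurable_shear.
have mF : measurable_fun setT F.
  apply: measurable_upd => //; apply: measurable_funD => //.
  by apply: measurable_funM => //; exact: measurable_tnth.
rewrite -(integral_lebesgue_tuple_shear k d mf f0).
rewrite -(@integral_lebesgue_tuple_upd R n k true psi _ mpsi _ mfd)//; last first.
  move=> a t; rewrite /psi; congr (_ * _); apply: eq_bigr => i ik.
  by rewrite tnth_mktuple (negbTE ik).
rewrite -/F.
rewrite -(@integral_lebesgue_tuple_shear n k (fun i => - d i) (fun t => f (shear k d (F t))))//; last first.
  exact: (measurableT_comp mfd mF).
apply: eq_integral => t _; congr f; apply: eq_from_tnth => i.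
have skk (e : 'I_n -> R) (s : n.-tuple T) : tnth (shear k e s) k = tnth s k.
  by rewrite tnth_mktuple eqxx mul0r addr0.
set t' := shear k _ t.
have t'k : tnth t' k = tnth t k by rewrite /t' skk.
have Fk : tnth (F t') k = tnth t k - (\sum_j c j * tnth t j) * w k.
  rewrite tnth_mktuple eqxx expr1 mulN1r t'k /psi.
  (* The shear has replaced [t_j] by [t_j - (w_j / w_k) t_k]. With [\sum c w = 2] the correction
     contributes [2 t_k] after multiplication by [- w_k], which undoes the flip [- t_k]. *)
  have -> : \sum_(j < n | j != k) c j * tnth t' j =
      \sum_(j < n) c j * tnth t j - (\sum_(j < n) c j * w j) * tnth t k / w k.
    rewrite [\sum_(j < n) c j * tnth t j](bigD1 k)//=.
    rewrite [\sum_(j < n) c j * w j](bigD1 k)//=.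
    rewrite (eq_bigr (fun j => c j * tnth t j - c j * w j * (tnth t k / w k))).
      rewrite sumrB -mulr_suml; field; exact: wk.
    by move=> j jk; rewrite tnth_mktuple (negbTE jk) /d; field; exact: wk.
  by rewrite cw; field; exact: wk.
rewrite [LHS]tnth_mktuple [RHS]tnth_mktuple Fk.
have [->|ik] := eqVneq i k.
  by rewrite mul0r addr0 Fk.
rewrite [tnth (F t') i]tnth_mktuple (negbTE ik) tnth_mktuple (negbTE ik) /d.
by field; exact: wk.
Qed.

End LinearReflection.

(** * Reflections of the space forms *)

Section Dot.
Context {R : realType} {d : nat}.
Implicit Types u v w : 'rV[R]_d.

Lemma dotC u v : dot u v = dot v u.
Proof. by apply: eq_bigr => i _; rewrite mulrC. Qed.

Lemma dotDl u v w : dot (u + v) w = dot u w + dot v w.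
Proof. by rewrite -big_split; apply: eq_bigr => i _; rewrite mxE mulrDl. Qed.

Lemma dotZl a u v : dot (a *: u) v = a * dot u v.
Proof. by rewrite /dot mulr_sumr; apply: eq_bigr => i _; rewrite mxE mulrA. Qed.

Lemma dotNl u v : dot (- u) v = - dot u v.
Proof. by rewrite -scaleN1r dotZl mulN1r. Qed.

Lemma dotDr u v w : dot w (u + v) = dot w u + dot w v.
Proof. by rewrite dotC dotDl !(dotC w). Qed.

Lemma dotZr a u v : dot v (a *: u) = a * dot v u.
Proof. by rewrite dotC dotZl dotC. Qed.

Lemma dotNr u v : dot v (- u) = - dot v u.
Proof. by rewrite dotC dotNl dotC. Qed.

Lemma dot_ge0 u : 0 <= dot u u.
Proof. by apply: sumr_ge0 => i _; exact: sqr_ge0. Qed.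

Lemma dot_eq0 u : dot u u = 0 -> u = 0.
Proof.
move=> /eqP; rewrite psumr_eq0 => [/allP u0|i _]; last exact: sqr_ge0.
apply/rowP => i; have := u0 i; rewrite mem_index_enum => /(_ isT)/=.
by rewrite -expr2 sqrf_eq0 mxE => /eqP.
Qed.

(** Cauchy-Schwarz, from the squared norm of the component of [u] orthogonal to [v], scaled by
    [dot v v] to avoid a division. *)
Lemma dot_sqr_le u v : dot u v ^+ 2 <= dot u u * dot v v.
Proof.
have [/dot_eq0 ->|v0] := eqVneq (dot v v) 0.
  by rewrite -(scale0r 0) dotZr mul0r expr0n/= dotZr mul0r mulr0.
have v1 : 0 < dot v v by rewrite lt_neqAle eq_sym v0 dot_ge0.
have := dot_ge0 (dot v v *: u - dot u v *: v).
rewrite !(dotDl, dotDr, dotNl, dotNr, dotZl, dotZr) (dotC v u).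
set a := dot u u; set b := dot v v; set c := dot u v => H.
have : 0 <= b * (a * b - c ^+ 2) by rewrite expr2; lra.
by rewrite pmulr_rge0// subr_ge0.
Qed.

End Dot.

Section SpaceFormAlgebra.
Context {R : realType}.
Variables (g : geometry) (d : nat).
Local Notation E := (@ambient R d).
Local Notation M := (@space_form R g d).
Local Notation kappa := (@curvature R g).
Implicit Types x y z : E.

Lemma geometryP : [\/ g = Euclidean, g = Hyperbolic | g = Spherical].
Proof. by case: g; [constructor 1|constructor 2|constructor 3]. Qed.

Lemma formC x y : form g x y = form g y x.
Proof. by rewrite /form dotC (mulrC x.1). Qed.

Lemma formDl x y z : form g (x + y) z = form g x z + form g y z.
Proof. by rewrite /form dotDl/=; ring. Qed.

Lemma formZl a x z : form g (a *: x) z = a * form g x z.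
Proof. by rewrite /form dotZl/= mulrDr; congr (_ + _); rewrite /GRing.scale/=; ring. Qed.

Lemma formNl x z : form g (- x) z = - form g x z.
Proof. by rewrite -scaleN1r formZl mulN1r. Qed.

Lemma formDr x y z : form g z (x + y) = form g z x + form g z y.
Proof. by rewrite formC formDl !(formC z). Qed.

Lemma formZr a x z : form g z (a *: x) = a * form g z x.
Proof. by rewrite formC formZl formC. Qed.

Lemma formNr x z : form g z (- x) = - form g z x.
Proof. by rewrite formC formNl formC. Qed.

Definition formE := (formDl, formDr, formNl, formNr, formZl, formZr).

Lemma form_add_scale k (u w : E) : form g (u + k *: w) (u + k *: w) =
  form g u u + k * (2 * form g u w) + k ^+ 2 * form g w w.
Proof. by rewrite formDl !formDr !formZl !formZr (formC w u); ring. Qed.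

Definition sqdist x y : R := form g (x - y) (x - y).

Lemma sqdistC x y : sqdist x y = sqdist y x.
Proof. by rewrite /sqdist -(opprB y x) formNl formNr opprK. Qed.

Lemma sqdistxx x : sqdist x x = 0.
Proof. by rewrite /sqdist subrr -(scale0r 0) formZl mul0r. Qed.

Lemma sqdistE x y : sqdist x y = form g x x + form g y y - 2 * form g x y.
Proof. by rewrite /sqdist !formE (formC y x); ring. Qed.

(* Unlike [form z z], constant (equal to 1) on all three spaces. *)
Definition height z : R := z.1 ^+ 2 + kappa * dot z.2 z.2.

Lemma space_formP z :
  M z <-> height z = 1 /\ (g <> Spherical -> 0 < z.1).
Proof.
rewrite /space_form /height /form /curvature; case: g => /=.
- rewrite mul0r addr0; split => [->|[/eqP + /(_ _)]]; first by rewrite expr1n.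
  by rewrite sqrf_eq1 => /orP[/eqP//|/eqP e] z0; have : 0 < z.1 by [exact: z0|]; lra.
- split=> [[zz z0]|[zz]]; first by split => //; rewrite expr2; lra.
  by move=> z0; split; [move: zz; rewrite expr2; lra|exact: z0].
- by split => [zz|[zz _]]; [split => //|]; move: zz; rewrite expr2; lra.
Qed.

Lemma form_const x y z : M x -> M y -> M z ->
  (form g x x - form g y y) * z.1 = form g x x - form g y y.
Proof.
rewrite /space_form; case: g => /=.
- by move=> _ _ ->; rewrite mulr1.
- by move=> [-> _] [-> _] _; rewrite subrr mul0r.
- by move=> -> -> _; rewrite subrr mul0r.
Qed.

Lemma form_const0 x y z : M x -> M y ->
  (form g x x - form g y y) * (x - y).1 = 0.
Proof.
rewrite /space_form; case: g => /=.
- by move=> -> ->; rewrite subrr mulr0.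
- by move=> [-> _] [-> _]; rewrite subrr mul0r.
- by move=> -> ->; rewrite subrr mul0r.
Qed.

(** The reversed Cauchy-Schwarz inequality of the Lorentz form: [(s^2 - 1)(t^2 - 1) <= (s t - 1)^2]
    for the first coordinates [s, t >= 1]. *)
Lemma hyperbolic_form_le x y : g = Hyperbolic -> M x -> M y -> form g x y <= -1.
Proof.
move=> ->; rewrite /space_form/= => -[xx x0] [yy y0].
have := dot_sqr_le x.2 y.2; move: xx yy; rewrite /form /curvature/=.
set a := dot _ _; set b := dot _ _; set c := dot _ _ => xx yy.
have -> : a = x.1 ^+ 2 - 1 by rewrite expr2; lra.
have -> : b = y.1 ^+ 2 - 1 by rewrite expr2; lra.
move=> H.
have x1 : 1 <= x.1.
  have : 0 <= a by exact: dot_ge0.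
  by move=> ?; nra.
have y1 : 1 <= y.1.
  have : 0 <= b by exact: dot_ge0.
  by move=> ?; nra.
have xy : 0 <= x.1 * y.1 - 1 by nra.
suff : c <= x.1 * y.1 - 1 by lra.
rewrite (le_trans (ler_norm _))// -(@ler_pXn2r _ 2)// ?nnegrE// real_normK ?num_real//.
by apply: le_trans H _; have := sqr_ge0 (x.1 - y.1); rewrite !expr2; lra.
Qed.

Lemma sqdist_ge0 x y : M x -> M y -> 0 <= sqdist x y.
Proof.
move=> Mx My; have [gE|gE|gE] := geometryP.
- by rewrite /sqdist /form /curvature gE mul0r add0r dot_ge0.
- have := hyperbolic_form_le gE Mx My; rewrite sqdistE.
  move: Mx My; rewrite /space_form gE => -[-> _] [-> _]; lra.
- rewrite /sqdist /form /curvature gE mul1r addr_ge0 ?dot_ge0//.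
  exact: sqr_ge0.
Qed.

(** Once the first coordinates agree, [sqdist] is the squared norm of the remaining difference. In
    the hyperbolic case they agree by the equality case of the reversed Cauchy-Schwarz
    inequality. *)
Lemma sqdist_eq0 x y : M x -> M y -> sqdist x y = 0 -> x = y.
Proof.
move=> Mx My xy0.
suff e1 : x.1 = y.1.
  move: xy0; rewrite /sqdist /form/= e1 subrr mulr0 mulr0 add0r => /dot_eq0/eqP.
  rewrite subr_eq0 => /eqP e2.
  by rewrite (surjective_pairing x) e1 e2 -surjective_pairing.
have [gE|gE|gE] := geometryP.
- by move: Mx My; rewrite /space_form gE => -> ->.
- have := hyperbolic_form_le gE Mx My.
  move: Mx My xy0; rewrite sqdistE /space_form gE => -[xx x0] [yy y0].
  rewrite xx yy => xy0 _.
  have := dot_sqr_le x.2 y.2; move: xx yy xy0; rewrite /form /curvature/=.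
  set a := dot _ _; set b := dot _ _; set c := dot _ _ => xx yy xy0.
  have -> : a = x.1 ^+ 2 - 1 by rewrite expr2; lra.
  have -> : b = y.1 ^+ 2 - 1 by rewrite expr2; lra.
  have -> : c = x.1 * y.1 - 1 by lra.
  move=> H; apply/eqP; rewrite -subr_eq0 -sqrf_eq0; apply/eqP/le_anti.
  by rewrite sqr_ge0 andbT; move: H; rewrite !expr2; lra.
- move: xy0; rewrite /sqdist /form /curvature gE mul1r => /eqP.
  rewrite paddr_eq0 ?dot_ge0//; last exact: sqr_ge0.
  by rewrite -expr2 sqrf_eq0 subr_eq0 => /andP[/eqP].
Qed.

Lemma sqdist_gt0 x y : M x -> M y -> x <> y -> 0 < sqdist x y.
Proof.
move=> Mx My xy; rewrite lt_neqAle sqdist_ge0// andbT eq_sym.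
by apply/eqP => /(sqdist_eq0 Mx My).
Qed.

Section Reflection.
Variables (x y : E).
Hypotheses (Mx : M x) (My : M y) (xy : x <> y).

(* The factor [z.1], which is 1 on the Euclidean space, makes [side] linear; in the
   curved cases the correction term vanishes. *)
Definition side z := 2 * form g z (x - y) - (form g x x - form g y y) * z.1.

Definition refl z : E := z - (side z / sqdist x y) *: (x - y).

Lemma sideD z z' : side (z + z') = side z + side z'.
Proof. by rewrite /side formDl/=; ring. Qed.

Lemma sideZ a z : side (a *: z) = a * side z.
Proof. by rewrite /side formZl/= /GRing.scale/=; ring. Qed.

Lemma reflZ a z : refl (a *: z) = a *: refl z.
Proof. by rewrite /refl sideZ [RHS]scalerBr scalerA mulrA. Qed.

Lemma sideE z : M z -> side z = sqdist z y - sqdist z x.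
Proof. by move=> Mz; rewrite /side form_const// !sqdistE !formE; ring. Qed.

Let W0 : sqdist x y != 0.
Proof. by rewrite gt_eqF// sqdist_gt0. Qed.

Lemma side_diff : side (x - y) = 2 * sqdist x y.
Proof. by rewrite /side form_const0// subr0. Qed.

Lemma side_refl z : side (refl z) = - side z.
Proof. by rewrite /refl -scaleNr sideD sideZ side_diff; field. Qed.

Lemma reflK z : refl (refl z) = z.
Proof.
rewrite {1}/refl side_refl mulNr scaleNr opprK /refl.
by rewrite -addrA addNr addr0.
Qed.

Lemma refl_l : refl x = y.
Proof.
by rewrite /refl sideE// sqdistxx subr0 divff// scale1r opprB addrC subrK.
Qed.

(** In the curved cases [height z] is [form z z] up to sign, which the reflection preserves; in the
    Euclidean case it depends on [z.1] only, and [x - y] has first coordinate 0. *)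
Lemma height_refl z : height (refl z) = height z.
Proof.
have [gE|gE|gE] := geometryP.
- rewrite /height /curvature gE !mul0r !addr0.
  have w0 : (x - y).1 = 0 by move: Mx My; rewrite /space_form gE /= => -> ->; rewrite subrr.
  rewrite (_ : (refl z).1 = z.1 - side z / sqdist x y * (x - y).1)//.
  by rewrite w0 mulr0 subr0.
- have hE u : height u = - form g u u.
    by rewrite /height /form /curvature gE; ring.
  have xx : form g x x = -1 by move: Mx; rewrite /space_form gE => -[].
  have yy : form g y y = -1 by move: My; rewrite /space_form gE => -[].
  have sE : side z = 2 * form g z (x - y) by rewrite /side xx yy; ring.
  rewrite !hE /refl -scaleNr formDl !formDr !formZl !formZr (formC (x - y) z) sE.
  by rewrite -/(sqdist x y); field.
- have hE u : height u = form g u u.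
    by rewrite /height /form /curvature gE; ring.
  have xx : form g x x = 1 by move: Mx; rewrite /space_form gE.
  have yy : form g y y = 1 by move: My; rewrite /space_form gE.
  have sE : side z = 2 * form g z (x - y) by rewrite /side xx yy; ring.
  rewrite !hE /refl -scaleNr formDl !formDr !formZl !formZr (formC (x - y) z) sE.
  by rewrite -/(sqdist x y); field.
Qed.

(** The identity behind every polarization inequality: reflecting one of two points does not bring
    it closer to the other exactly when [side z * side z'] is nonnegative. *)
Lemma sqdist_refl_r z z' : M z -> M z' ->
  sqdist z (refl z') = sqdist z z' + side z * side z' / sqdist x y.
Proof.
move=> Mz Mz'.
have H : 2 * form g (z - z') (x - y) = side z - side z'.
  rewrite /side formDl formNl.
  have := form_const Mx My Mz; have := form_const Mx My Mz'.
  set a := form g x x - _; set b := form g _ (x - y); set c := form g _ (x - y).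
  by move=> -> ->; ring.
rewrite {1}/sqdist /refl opprB addrA addrAC.
set k := side z' / sqdist x y.
rewrite form_add_scale -/(sqdist z z') -/(sqdist x y) H /k; field; exact: W0.
Qed.

Lemma space_form_refl z : M z -> M (refl z).
Proof.
move=> Mz; apply/space_formP; rewrite height_refl; split; first by move/space_formP: Mz => -[].
have [gE|gE|gE] := geometryP => // _.
  have w0 : (x - y).1 = 0 by move: Mx My; rewrite /space_form gE /= => -> ->; rewrite subrr.
  rewrite (_ : (refl z).1 = z.1 - side z / sqdist x y * (x - y).1)//.
  by rewrite w0 mulr0 subr0; move: Mz; rewrite /space_form gE => /= ->.
have xx : form g x x = -1 by move: Mx; rewrite /space_form gE => -[].
have yy : form g y y = -1 by move: My; rewrite /space_form gE => -[].
(* [form (refl z) y = form z x < 0], which excludes the lower sheet *)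
have H : form g (refl z) y = form g z x.
  have -> : form g (refl z) y = form g z y - side z / sqdist x y * form g (x - y) y.
    by rewrite /refl formDl formNl formZl.
  have := W0; rewrite sqdistE xx yy => W1.
  rewrite /side xx yy !formE yy; field.
  by move: W1; congr (_ != 0); ring.
have zz := hyperbolic_form_le gE Mz Mx; rewrite -H in zz.
have hz : form g (refl z) (refl z) = -1.
  have := height_refl z; have /space_formP[-> _] := Mz.
  by rewrite /height /form /curvature gE !expr2; lra.
rewrite ltNge; apply/negP => r0.
have y0 : 0 < y.1 by move: My; rewrite /space_form gE => -[].
have := dot_sqr_le (refl z).2 y.2.
move: zz hz yy; rewrite /form /curvature gE.
set a := dot _ _; set b := dot (refl z).2 _; set c := dot y.2 _ => zz hz yy.
have -> : b = (refl z).1 ^+ 2 - 1 by rewrite expr2; lra.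
have -> : c = y.1 ^+ 2 - 1 by rewrite expr2; lra.
have c0 : 0 <= c by exact: dot_ge0.
have b0 : 0 <= b by exact: dot_ge0.
have s0 : 0 <= - (refl z).1 * y.1 by rewrite mulr_ge0 ?oppr_ge0// ltW.
have aa : 1 + - (refl z).1 * y.1 <= - a by lra.
have : (1 + - (refl z).1 * y.1) ^+ 2 <= a ^+ 2.
  by rewrite -[a ^+ 2]sqrrN ler_pXn2r// nnegrE; lra.
have u1 : 1 <= (refl z).1 * (refl z).1 by lra.
have u2 : 1 <= y.1 * y.1 by lra.
by rewrite !expr2; lra.
Qed.

Lemma sqdist_refl z z' : M z -> M z' -> sqdist (refl z) (refl z') = sqdist z z'.
Proof.
move=> Mz Mz'; have Mr := space_form_refl Mz.
rewrite sqdist_refl_r// (sqdistC (refl z)) sqdist_refl_r// side_refl sqdistC.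
by field.
Qed.

End Reflection.

End SpaceFormAlgebra.
(** * Topology of the space forms *)

Section Thresholds.
Context {R : realType}.
Variables (g : geometry) (d : nat).
Local Notation M := (@space_form R g d).

Lemma spherical_sqdist_le4 x y : g = Spherical -> M x -> M y -> sqdist g x y <= 4.
Proof.
move=> gE; rewrite /space_form gE/= => xx yy.
have := dot_ge0 (x.2 + y.2); have := sqr_ge0 (x.1 + y.1).
rewrite !(dotDl, dotDr) (dotC y.2 x.2) sqdistE.
by move: xx yy; rewrite /form /curvature !expr2 !mul1r => xx yy; lra.
Qed.

(** The thresholds are [r^2], [2 cosh r - 2] and, for [r < pi], [2 - 2 cos r]. The value 4, attained
    only by antipodes, is avoided because [sqdist_dense] moves a point towards [p] along the segment
    joining them. *)
Lemma dist_le_sqdist (r : R) : 0 < r -> exists rho, [/\ 0 < rho,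
  (g = Spherical -> rho <> 4) &
  forall x y, M x -> M y -> (dist g x y <= r) = (sqdist g x y <= rho)].
Proof.
move=> r0; have [gE|gE|gE] := geometryP g.
- exists (r ^+ 2); split; [by rewrite exprn_gt0|by rewrite gE|move=> x y Mx My].
  rewrite /dist gE -/(sqdist Euclidean x y) -[r in LHS](gtr0_norm r0) -sqrtr_sqr.
  by rewrite ler_sqrt// sqr_ge0.
- exists (expR r + (expR r)^-1 - 2).
  have e1 : 1 < expR r by rewrite expR_gt1.
  have e0 : 0 < expR r by exact: expR_gt0.
  split; [|by rewrite gE|move=> x y Mx My].
    have : 0 < (expR r - 1) ^+ 2 / expR r by rewrite divr_gt0// exprn_gt0// subr_gt0.
    rewrite (_ : _ / _ = expR r + (expR r)^-1 - 2)//.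
    by field; rewrite gt_eqF.
  have := hyperbolic_form_le gE Mx My.
  rewrite sqdistE; move: Mx My; rewrite /space_form gE/= => -[-> _] [-> _].
  rewrite /dist /arcosh; set t := - form _ _ _ => t1.
  have {}t1 : 1 <= t by rewrite /t; lra.
  have -> : -1 + -1 - 2 * form Hyperbolic x y = 2 * t - 2 by rewrite /t; ring.
  set s := Num.sqrt _; have s0 : 0 <= s by exact: sqrtr_ge0.
  have s2 : s ^+ 2 = t ^+ 2 - 1 by rewrite sqr_sqrtr// subr_ge0 -[1](expr1n _ 2) ler_pXn2r ?nnegrE//; lra.
  rewrite -[r in LHS](expRK r) ler_ln ?posrE//; last by lra.
  set e := expR r in e0 e1 *.
  have ee : e * e^-1 = 1 by rewrite divff// gt_eqF.
  have i0 : 0 < e^-1 by rewrite invr_gt0.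
  apply/idP/idP => H.
    have : 0 <= (e - t) ^+ 2 - s ^+ 2.
      by rewrite subr_ge0 ler_pXn2r ?nnegrE//; lra.
    rewrite s2 !expr2 => K.
    have : 0 <= e^-1 * (e * (e - 2 * t) + 1) by apply: mulr_ge0; lra.
    rewrite mulrDr mulrA (mulrC e^-1 e) ee; lra.
  (* Here [t <= cosh r], so [sqrt (t^2 - 1) <= sinh r], and [cosh r + sinh r = expR r]. *)
  have h1 : s <= (e - e^-1) / 2.
    rewrite -(@ler_pXn2r _ 2)// ?nnegrE//; last first.
      have : e^-1 < 1 by rewrite invf_lt1.
      by lra.
    rewrite s2.
    have : t ^+ 2 <= ((e + e^-1) / 2) ^+ 2 by rewrite ler_pXn2r// ?nnegrE; lra.
    rewrite !expr2; nra.
  by lra.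
- have fE x y : M x -> M y -> sqdist g x y = 2 - 2 * form g x y.
    move=> Mx My; rewrite sqdistE; move: Mx My; rewrite /space_form gE/= => -> ->.
    by ring.
  have bd x y : M x -> M y -> -1 <= form g x y <= 1.
    move=> Mx My; have := spherical_sqdist_le4 gE Mx My; have := sqdist_ge0 Mx My.
    by rewrite fE// => ? ?; apply/andP; split; lra.
  have [rpi|rpi] := leP pi r.
    (* For [r >= pi] the ball is the whole sphere, and any threshold above 4 serves. *)
    exists 5; split; [by []|by move=> _ /eqP; rewrite eqr_nat|move=> x y Mx My].
    have := bd _ _ Mx My; rewrite fE// /dist gE => b.
    rewrite (le_trans (acos_lepi b) rpi); apply/esym; case/andP: b => ? ?; lra.
  exists (2 - 2 * cos r).
  have rI : r \in `[0, pi] by rewrite in_itv/= !ltW.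
  split.
  + have : cos r < cos 0 by rewrite ltr_cos// in_itv/= lexx pi_ge0.
    by rewrite cos0; lra.
  + have : cos pi < cos r by rewrite ltr_cos// in_itv/= lexx pi_ge0.
    by rewrite cospi; lra.
  + move=> x y Mx My; rewrite fE//; have b := bd _ _ Mx My.
    rewrite /dist gE -gE.
    have [a1 a2] := acos_def b.
    transitivity (cos r <= form g x y); last by apply/idP/idP; lra.
    by rewrite -[in RHS]a2 !leNgt ltr_cos// in_itv/= a1.
Qed.

End Thresholds.

Section Topology.
Context {R : realType}.
Variables (g : geometry) (d : nat).
Local Notation E := (@ambient R d).
Local Notation M := (@space_form R g d).
Local Notation kappa := (@curvature R g).

Lemma cvg_ambient_fst (T : Type) (F : set_system T) {FF : Filter F} (u : T -> E) (a : E) :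
  u @ F --> a -> (fun t => (u t).1) @ F --> a.1.
Proof. by move=> ua; apply: cvg_comp ua _; exact: cvg_fst. Qed.

Lemma cvg_ambient_snd (T : Type) (F : set_system T) {FF : Filter F} (u : T -> E) (a : E) i :
  u @ F --> a -> (fun t => (u t).2 0 i) @ F --> a.2 0 i.
Proof.
move=> ua; apply: (@cvg_comp _ _ _ (fun t => (u t).2) (fun v : 'rV[R]_d => v 0 i) _ (nbhs a.2)).
  by apply: cvg_comp ua _; exact: cvg_snd.
exact: coord_continuous.
Qed.

Lemma cvg_dot (T : Type) (F : set_system T) {FF : Filter F} (u v : T -> E) (a b : E) :
  u @ F --> a -> v @ F --> b -> (fun t => dot (u t).2 (v t).2) @ F --> dot a.2 b.2.
Proof.
move=> ua vb; rewrite /dot; apply: cvg_big => [|i _].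
  by move=> p; apply: cvgD; [exact: cvg_fst|exact: cvg_snd].
by apply: cvgM; exact: cvg_ambient_snd.
Qed.

Lemma cvg_form (T : Type) (F : set_system T) {FF : Filter F} (u v : T -> E) (a b : E) :
  u @ F --> a -> v @ F --> b -> (fun t => form g (u t) (v t)) @ F --> form g a b.
Proof.
move=> ua vb; apply: cvgD; last exact: cvg_dot.
by apply: cvgM; [exact: cvg_cst|apply: cvgM; exact: cvg_ambient_fst].
Qed.

Lemma cvg_sqdist (T : Type) (F : set_system T) {FF : Filter F} (u v : T -> E) (a b : E) :
  u @ F --> a -> v @ F --> b -> (fun t => sqdist g (u t) (v t)) @ F --> sqdist g a b.
Proof. by move=> ua vb; apply: cvg_form; exact: cvgB. Qed.

Lemma cvg_height (T : Type) (F : set_system T) {FF : Filter F} (u : T -> E) (a : E) :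
  u @ F --> a -> (fun t => height g (u t)) @ F --> height g a.
Proof.
move=> ua; apply: cvgD; first by apply: cvgM; exact: cvg_ambient_fst.
by apply: cvgM; [exact: cvg_cst|exact: cvg_dot].
Qed.

Lemma continuous_sqdist (p : E) : continuous (sqdist g p).
Proof. by move=> x; apply: cvg_sqdist; [exact: cvg_cst|exact: cvg_id]. Qed.

Lemma continuous_height : continuous (@height R g d).
Proof. by move=> x; apply: cvg_height; exact: cvg_id. Qed.

Lemma closed_space_form : closed M.
Proof.
(* Off the sphere the open condition [0 < z.1] may be weakened to a closed one: at [z.1 = 0] the
   height is at most 0, not 1. *)
pose s := if g is Spherical then [set: E] else [set z : E | 0 <= z.1].
rewrite (_ : M = [set z | height g z = 1] `&` s).
  apply: closedI.
    apply: (@preimage_closed _ _ (@height R g d) [set 1]).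
      by move=> x _; exact: continuous_height.
    by apply: accessible_closed_set1; exact: hausdorff_accessible.
  rewrite /s; case: g; last exact: closedT;
  by apply: (@preimage_closed _ _ (fun z : E => z.1) [set r | 0 <= r]);
    [move=> x _; exact: cvg_fst|exact: closed_ge].
apply/seteqP; split => z /=.
  move=> /space_formP[h1 z0]; split => //; rewrite /s.
  by have [gE|gE|gE] := geometryP g; rewrite gE//=; apply/ltW/z0; rewrite gE.
move=> [h1 sz]; apply/space_formP; split=> // gS.
have z0 : 0 <= z.1 by move: sz gS; rewrite /s; case: g.
rewrite lt_neqAle z0 andbT; apply/eqP => z1.
move: h1; rewrite /height -z1 expr0n/= add0r.
have := dot_ge0 z.2; have [gE|gE|gE] := geometryP g; rewrite /curvature gE; [lra|lra|].
by case: gS.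
Qed.

Lemma compact_box (c : R) :
  compact [set x : E | `|x.1| <= c /\ forall i, `|x.2 0 i| <= c].
Proof.
rewrite (_ : [set x : E | _] =
    `[- c, c]%classic `*` [set v : 'rV[R]_d | forall i, `[- c, c]%classic (v ord0 i)]).
  apply: compact_setX; first exact: segment_compact.
  by apply: (@rV_compact _ _ (fun=> `[- c, c]%classic)) => i; exact: segment_compact.
apply/seteqP; split => x /= [x1 x2]; move: x1; rewrite in_itv/= -ler_norml => x1.
  by split => // i; rewrite in_itv/= -ler_norml.
by split => // i; have := x2 i; rewrite in_itv/= -ler_norml.
Qed.

Lemma compact_ambient (A : set E) (c : R) : closed A ->
  (forall x, A x -> `|x.1| <= c /\ forall i, `|x.2 0 i| <= c) -> compact A.
Proof. by move=> cA Ac; exact: subclosed_compact cA (@compact_box c) Ac. Qed.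

Lemma coord_sqr_le_dot (u : 'rV[R]_d) i : u 0 i ^+ 2 <= dot u u.
Proof.
rewrite /dot (bigD1 i)//= expr2 lerDl; apply: sumr_ge0 => j _; exact: sqr_ge0.
Qed.

Lemma sqr_le_norm_le (a b : R) : a ^+ 2 <= b -> `|a| <= 1 + b.
Proof.
move=> ab; have := sqr_ge0 a; rewrite -real_normK ?num_real// => ?.
by move: ab; rewrite -real_normK ?num_real// !expr2; have := normr_ge0 a; nra.
Qed.

Lemma dual_bounded (T b : R) (x y : E) : M x -> M y ->
  `|x.1| <= b -> dot x.2 x.2 <= b -> sqdist g x y <= T ->
  y.1 ^+ 2 <= 1 + (2 * (1 + `|T|) * b) ^+ 2 /\
  dot y.2 y.2 <= 1 + (2 * (1 + `|T|) * b) ^+ 2 + 2 * b + 2 * `|T|.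
Proof.
move=> Mx My xb db DT.
have b0 : 0 <= b by apply: le_trans db; exact: dot_ge0.
have T0 : 0 <= `|T| by [].
have TT : T <= `|T| by exact: ler_norm.
set C := (2 * _ * b) ^+ 2; have C0 : 0 <= C by exact: sqr_ge0.
have [gE|gE|gE] := geometryP g.
- move: Mx My DT; rewrite /space_form gE /sqdist /form /curvature /= => x1 y1.
  rewrite y1 expr1n mul0r add0r => DT; split; first by lra.
  (* The identity used is [|y|^2 = 2 |x - y|^2 + 2 |x|^2 - |2 x - y|^2]. *)
  have := dot_ge0 (x.2 + x.2 - y.2).
  by move: DT; rewrite !(dotDl, dotDr, dotNl, dotNr) (dotC y.2 x.2) => ? ?; lra.
- move: DT; rewrite sqdistE.
  have [xx x0] : form g x x = -1 /\ 0 < x.1 by move: Mx; rewrite /space_form gE.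
  have [yy y0] : form g y y = -1 /\ 0 < y.1 by move: My; rewrite /space_form gE.
  have := dot_sqr_le x.2 y.2; rewrite xx yy; move: xx yy.
  rewrite /form /curvature gE.
  have u0 := dot_ge0 x.2; have v0 := dot_ge0 y.2.
  set u := dot _ _; set v := dot _ _; set w := dot _ _ => xx yy.
  have -> : u = x.1 ^+ 2 - 1 by rewrite expr2; lra.
  have vE : v = y.1 ^+ 2 - 1 by rewrite expr2; lra.
  rewrite vE => H DT.
  have x1 : 1 <= x.1 by move: u0; rewrite -/u; nra.
  have y1 : 1 <= y.1 by move: v0; rewrite -/v; nra.
  set c := 1 + `|T|; have c1 : 1 <= c by rewrite /c; lra.
  have wc : x.1 * y.1 - c <= w by rewrite /c; lra.
  (* Otherwise [x.1 * y.1 - c] is nonnegative, and squaring [wc] together with Cauchy-Schwarz gives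
     [y.1 ^+ 2 <= 2 * c * x.1 * y.1], a contradiction. *)
  have yb : y.1 <= 2 * c * x.1.
    rewrite leNgt; apply/negP => lt.
    have pos : 0 <= x.1 * y.1 - c by nra.
    have : (x.1 * y.1 - c) ^+ 2 <= w ^+ 2 by rewrite ler_pXn2r ?nnegrE//; lra.
    rewrite !expr2 in H * => K.
    have : y.1 * y.1 <= (2 * c * x.1) * y.1 by nra.
    by nra.
  have yc : y.1 ^+ 2 <= C.
    rewrite /C ler_pXn2r ?nnegrE//; [|lra|by rewrite !mulr_ge0//; lra].
    apply: le_trans yb _; rewrite ler_pM2l; last by lra.
    by rewrite (le_trans (ler_norm _)).
  by split; lra.
- move: My; rewrite /space_form gE /form /curvature /= mul1r -expr2 => yy.
  have := dot_ge0 y.2; have := sqr_ge0 y.1; split; lra.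
Qed.

Lemma dual_bounded_compact (K : set E) (T : R) : compact K -> K `<=` M ->
  exists c, forall x y, K x -> M y -> sqdist g x y <= T ->
    `|y.1| <= c /\ forall i, `|y.2 0 i| <= c.
Proof.
move=> cK KM.
pose f (x : E) := `|x.1| + dot x.2 x.2.
have cf : continuous f.
  move=> x; apply: cvgD; last by apply: cvg_dot; exact: cvg_id.
  by apply: cvg_norm; apply: cvg_ambient_fst; exact: cvg_id.
have [b [_ fb]] := compact_bounded (continuous_compact (continuous_subspaceT cf) cK).
have {}fb x : K x -> f x <= b + 1.
  move=> Kx; apply: le_trans (ler_norm _) _; apply: (fb (b + 1)); first by rewrite ltrDl.
  by exists x.
set B := b + 1 in fb.
set C1 := 1 + (2 * (1 + `|T|) * B) ^+ 2.
exists (1 + (C1 + 2 * `|B| + 2 * `|T|)) => x y Kx My DT.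
have fx := fb x Kx; have d0 := dot_ge0 x.2.
have x1 : `|x.1| <= B by move: fx; rewrite /f; lra.
have x2 : dot x.2 x.2 <= B by move: fx; rewrite /f; have := normr_ge0 x.1; lra.
have [y1 y2] := dual_bounded (KM x Kx) My x1 x2 DT.
have B0 : `|B| = B by rewrite ger0_norm//; apply: le_trans x2.
have T0 := normr_ge0 T.
have C0 : 0 <= (2 * (1 + `|T|) * B) ^+ 2 by exact: sqr_ge0.
split; first by apply: sqr_le_norm_le; rewrite -/C1 in y1; lra.
move=> i; apply: sqr_le_norm_le; apply: le_trans (coord_sqr_le_dot _ _) _.
by rewrite B0 /C1.
Qed.

Lemma compact_sqdist_le (p : E) (T : R) : M p -> compact [set y | M y /\ sqdist g p y <= T].
Proof.
move=> Mp; have [||c Hc] := @dual_bounded_compact [set p] T.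
- exact: compact_set1.
- by move=> _ ->.
apply: (@compact_ambient _ c) => [|y [My Dy]]; last exact: (Hc p).
rewrite (_ : [set y | _] = M `&` (sqdist g p) @^-1` [set t | t <= T])//.
apply: closedI; first exact: closed_space_form.
by apply: preimage_closed; [move=> x _; exact: continuous_sqdist|exact: closed_le].
Qed.

Lemma sqdist_ball_nbhs z e : M z -> 0 < e -> nbhs z [set z' | sqdist g z z' < e].
Proof.
move=> Mz e0; have cz : (fun z' => sqdist g z z') @ z --> sqdist g z z by exact: continuous_sqdist.
by apply: (cvgr_lt _ cz); rewrite sqdistxx.
Qed.

Definition dual_of (rho : R) (S : set E) : set E := M `&` [set z | forall u, S u -> sqdist g u z <= rho].

Lemma closed_dual_of rho (S : set E) : closed (dual_of rho S).
Proof.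
apply: closedI; first exact: closed_space_form.
rewrite (_ : [set z | _] = \bigcap_(u in S) (sqdist g u @^-1` [set t | t <= rho])).
  apply: closed_bigI => u _; apply: preimage_closed; last exact: closed_le.
  by move=> z _; exact: continuous_sqdist.
by apply/seteqP; split.
Qed.

(** Central projection to the space: [height] is homogeneous of degree 2 and equals 1 there. *)
Definition normalize (z : E) : E := (Num.sqrt (height g z))^-1 *: z.

Lemma cvg_normalize (T : Type) (F : set_system T) {FF : Filter F} (u : T -> E) (a : E) :
  0 < height g a -> u @ F --> a -> (fun t => normalize (u t)) @ F --> normalize a.
Proof.
move=> a0 ua; apply: cvgZ => //.
apply: cvgV; first by rewrite gt_eqF// sqrtr_gt0.
by apply: (cvg_comp _ _ (cvg_height ua)); exact: sqrt_continuous.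
Qed.

Lemma heightZ a (z : E) : height g (a *: z) = a ^+ 2 * height g z.
Proof. by rewrite /height dotZl dotZr /= /GRing.scale/=; ring. Qed.

Lemma height_normalize z : 0 < height g z -> height g (normalize z) = 1.
Proof.
by move=> z0; rewrite heightZ exprVn sqr_sqrtr ?ltW// mulVf// gt_eqF.
Qed.

Lemma space_form_normalize z : 0 < height g z -> (g <> Spherical -> 0 < z.1) ->
  M (normalize z).
Proof.
move=> z0 z1; apply/space_formP; rewrite height_normalize//; split=> // gS.
by rewrite /normalize/= /GRing.scale/= mulr_gt0 ?invr_gt0 ?sqrtr_gt0 ?z1.
Qed.

Lemma normalize_id z : M z -> normalize z = z.
Proof. by move=> /space_formP[z1 _]; rewrite /normalize z1 sqrtr1 invr1 scale1r. Qed.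

Lemma height_addZ (x p : E) e : M x -> M p ->
  height g (x + e *: p) = (1 + e) ^+ 2 - kappa * (e * sqdist g p x).
Proof.
rewrite sqdistE /space_form /height /form /curvature.
rewrite !(dotDl, dotDr, dotZl, dotZr) (dotC p.2 x.2) /= /GRing.scale /=.
case: g => /=.
- by move=> -> ->; ring.
- move=> [xx _] [pp _].
  have -> : dot x.2 x.2 = x.1 * x.1 - 1 by lra.
  have -> : dot p.2 p.2 = p.1 * p.1 - 1 by lra.
  by ring.
- move=> xx pp.
  have -> : dot x.2 x.2 = 1 - x.1 * x.1 by lra.
  have -> : dot p.2 p.2 = 1 - p.1 * p.1 by lra.
  by ring.
Qed.

(** The normalized point of the segment [x + e *: p] lies closer to [p] than [x] for small [e > 0].
    At the antipode of [p] this fails, as [x + e *: p] is a multiple of [x]. *)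
Lemma sqdist_dense (p x : E) (U : set E) : M p -> M x -> p <> x ->
  (g = Spherical -> sqdist g p x <> 4) -> nbhs x U ->
  exists z, [/\ M z, U z & sqdist g p z < sqdist g p x].
Proof.
move=> Mp Mx px x4 Ux.
have D0 := sqdist_gt0 Mp Mx px.
pose c := kappa * form g p x.
(* On the sphere with [form p x < 0], the bound [e < - form p x] keeps [form p x + e] negative, so
   that both sides of the final inequality can be squared after a change of sign. *)
pose K := if c < 0 then - c else 1.
have K0 : 0 < K by rewrite /K; case: ifP; rewrite ?oppr_gt0.
have xe : (fun e : R => x + e *: p) @ 0^'+ --> x.
  rewrite -[X in _ --> X]addr0 -(scale0r p); apply: cvgD; first exact: cvg_cst.
  by apply: cvgZr_tmp; apply: cvg_at_right_filter; exact: cvg_id.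
have hx : 0 < height g x by have /space_formP[-> _] := Mx.
have := cvg_normalize hx xe; rewrite normalize_id// => /(_ _ U Ux) Ue.
have : \forall e \near 0^'+, U (normalize (x + e *: p)) /\ 0 < e < K.
  near=> e; split; first by near: e; exact: Ue.
  by apply/andP; split; near: e; [exact: nbhs_right_gt|exact: nbhs_right_lt].
move=> /filter_ex[e [Uz /andP[e0 eK]]].
have hE := height_addZ e Mx Mp.
have h0 : 0 < height g (x + e *: p).
  rewrite hE /curvature; have [gE|gE|gE] := geometryP g; rewrite gE.
  - by rewrite mul0r subr0 exprn_gt0// addr_gt0.
  - by rewrite mulN1r opprK -gE; apply: addr_gt0; [apply: exprn_gt0; exact: addr_gt0|exact: mulr_gt0].
  - have D4 := spherical_sqdist_le4 gE Mp Mx.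
    have {}D4 : sqdist g p x < 4 by rewrite lt_neqAle D4 andbT; apply/eqP; exact: x4.
    have := sqr_ge0 (1 - e); rewrite gE in D4 *; rewrite !expr2; nra.
have Mz : M (normalize (x + e *: p)).
  apply: space_form_normalize => // gS; rewrite /= /GRing.scale/=.
  have /space_formP[_ /(_ gS) x1] := Mx; have /space_formP[_ /(_ gS) p1] := Mp.
  by rewrite addr_gt0// mulr_gt0.
exists (normalize (x + e *: p)); split=> //.
set t := Num.sqrt (height g (x + e *: p)).
have t0 : 0 < t by rewrite sqrtr_gt0.
have tt : t ^+ 2 = (1 + e) ^+ 2 - kappa * (e * sqdist g p x).
  by rewrite sqr_sqrtr ?ltW.
have fpz : form g p (normalize (x + e *: p)) = (form g p x + e * form g p p) / t.
  by rewrite /normalize -/t !formE mulrC.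
have [gE|gE|gE] := geometryP g.
- have t1 : t = 1 + e.
    apply/eqP; rewrite -(@eqrXn2 _ 2)// ?ltW ?addr_gt0// tt.
    by rewrite /curvature gE mul0r subr0.
  rewrite sqdistE fpz /normalize -/t t1 !formE (formC g x p).
  rewrite [X in X < _](_ : _ = sqdist g p x / (1 + e) ^+ 2); last first.
    by rewrite sqdistE; field; rewrite gt_eqF// addr_gt0.
  by rewrite ltr_pdivrMr ?exprn_gt0 ?addr_gt0// ltr_pMr// expr2; nra.
- have zz : form g (normalize (x + e *: p)) (normalize (x + e *: p)) = -1.
    by move: Mz; rewrite /space_form gE => -[].
  have pp : form g p p = -1 by move: Mp; rewrite /space_form gE => -[].
  have xx : form g x x = -1 by move: Mx; rewrite /space_form gE => -[].
  move: D0 tt; rewrite !sqdistE zz fpz pp xx /curvature gE; set f := form _ p x => D0 tt.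
  suff : - f + e < - f * t.
    rewrite -ltr_pdivrMr//.
    have -> : (f + e * -1) / t = - ((- f + e) / t) by field; rewrite gt_eqF.
    by lra.
  rewrite -(@ltr_pXn2r _ 2)// ?nnegrE; [|lra|by apply: mulr_ge0; lra].
  rewrite exprMn tt !expr2 -subr_gt0.
  have -> : - f * - f * ((1 + e) * (1 + e) - -1 * (e * (-1 + -1 - 2 * f))) -
     (- f + e) * (- f + e) = (f * f - 1) * (e * (2 * (- f) + e)) by ring.
  apply: mulr_gt0; first by nra.
  by apply: mulr_gt0; lra.
- have zz : form g (normalize (x + e *: p)) (normalize (x + e *: p)) = 1.
    by move: Mz; rewrite /space_form gE.
  have pp : form g p p = 1 by move: Mp; rewrite /space_form gE.
  have xx : form g x x = 1 by move: Mx; rewrite /space_form gE.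
  have D4 := spherical_sqdist_le4 gE Mp Mx.
  have {}D4 : sqdist g p x < 4 by rewrite lt_neqAle D4 andbT; apply/eqP; exact: x4.
  move: D0 D4 tt eK; rewrite !sqdistE zz fpz pp xx /K /c /curvature gE mul1r.
  set f := form _ p x => D0 D4 tt eK.
  suff : f * t < f + e by rewrite -ltr_pdivlMr// mulr1; lra.
  have f1 : f < 1 by lra. have f2 : -1 < f by lra.
  have [f0|f0] := ltP f 0.
    rewrite mul1r f0 in eK; rewrite -ltrN2 -mulNr.
    rewrite -(@ltr_pXn2r _ 2)// ?nnegrE; [|lra|by apply: mulr_ge0; lra].
    rewrite exprMn tt !expr2 -subr_gt0.
    have -> : - f * - f * ((1 + e) * (1 + e) - e * (1 + 1 - 2 * f)) -
     - (f + e) * - (f + e) = (1 - f * f) * (e * (- (2 * f) - e)) by ring.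
    apply: mulr_gt0; first by nra.
    by apply: mulr_gt0; lra.
  rewrite -(@ltr_pXn2r _ 2)// ?nnegrE; [|by apply: mulr_ge0; lra|lra].
  rewrite exprMn tt !expr2 -subr_gt0.
  have -> : (f + e) * (f + e) - f * f * ((1 + e) * (1 + e) - e * (1 + 1 - 2 * f)) =
    (1 - f * f) * (e * (2 * f + e)) by ring.
  apply: mulr_gt0; first by nra.
  by apply: mulr_gt0; lra.
Unshelve. all: by end_near. Qed.

End Topology.

(** * The cone measure *)

Section BorelAmbient.
Context {R : realType}.
Variable (d : nat).
Local Notation E := (@ambient R d).
Local Notation T := (measurableTypeR R).

Lemma nbhs_ambient_box (x : E) (U : set E) : nbhs x U -> exists2 e : R, 0 < e &
  forall y : E, `|y.1 - x.1| < e -> (forall i, `|y.2 0 i - x.2 0 i| < e) -> U y.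
Proof.
move=> /nbhs_ballP[e /= e0 eU]; exists e => // y y1 y2; apply: eU; split.
  by rewrite /= -ball_normE/= distrC.
split=> // i j; rewrite (ord1 i).
by rewrite -ball_normE/= distrC.
Qed.

(** An open set is the union of the countably many rational boxes that it contains, so measurability
    of the coordinates suffices. *)
Lemma measurable_preimage_open d0 (X : measurableType d0) (F : X -> E) (U : set E) :
  measurable_fun setT (fun x => (F x).1 : R) ->
  (forall i, measurable_fun setT (fun x => (F x).2 0 i : R)) ->
  open U -> measurable (F @^-1` U).
Proof.
move=> m1 m2 oU.
pose box (k : rat * 'rV[rat]_d * nat) : set E :=
  [set y : E | `|y.1 - ratr k.1.1| < k.2.+1%:R^-1 /\
     forall i, `|y.2 0 i - ratr (k.1.2 0 i)| < k.2.+1%:R^-1].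
rewrite (_ : F @^-1` U = \bigcup_(k : rat * 'rV[rat]_d * nat)
    (if `[< box k `<=` U >] then F @^-1` (box k) else set0)).
  apply: countable_bigcupT_measurable; first exact: countableP.
  move=> k; case: ifP => // _.
  rewrite (_ : F @^-1` _ = [set x | `|(F x).1 - ratr k.1.1| < k.2.+1%:R^-1] `&`
     \bigcap_(i in [set: 'I_d]) [set x | `|(F x).2 0 i - ratr (k.1.2 0 i)| < k.2.+1%:R^-1]).
    apply: measurableI.
      by apply: measurable_set_bool; exact: measurable_dist_lt.
    apply: fin_bigcap_measurable => // i _; apply: measurable_set_bool.
    exact: measurable_dist_lt.
  apply/seteqP; split => x /= [x1 x2]; split => // i; first by move=> _; exact: x2.
  exact: x2.
apply/seteqP; split => x /=; last first.
  by move=> [k _]; case: asboolP => // kU Fx; exact: kU.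
move=> UFx; have [e e0 He] := nbhs_ambient_box (open_nbhs_nbhs (conj oU UFx)).
(* The factor 2 is there because the rational centre is itself up to [1/(n+1)] away from the
   point. *)
have [n n2] : exists n : nat, 2 * n.+1%:R^-1 < e.
  by exists (Num.truncn (2 / e)); rewrite ltr_pdivrMr// mulrC -ltr_pdivrMr// truncnS_gt.
have n0 : 0 < n.+1%:R^-1 :> R by rewrite invr_gt0.
have rat_near (a : R) : exists q : rat, `|a - ratr q| < n.+1%:R^-1.
  have /rat_in_itvoo[q] : a - n.+1%:R^-1 < a + n.+1%:R^-1 by rewrite ltrD2l gtrN.
  by rewrite in_itv/= => aq; exists q; rewrite distrC ltr_distl.
have [q1 hq1] := rat_near (F x).1.
have /choice[q2 hq2] : forall i, exists q : rat, `|(F x).2 0 i - ratr q| < n.+1%:R^-1.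
  by move=> i; exact: rat_near.
exists (q1, \row_i q2 i, n) => //.
have tri (a b c : R) : `|a - c| < n.+1%:R^-1 -> `|b - c| < n.+1%:R^-1 -> `|b - a| < e.
  move=> ac bc; apply: lt_trans n2; rewrite mulr_natl mulr2n.
  rewrite (_ : b - a = (b - c) - (a - c)); last by ring.
  by apply: le_lt_trans (ler_normB _ _) _; exact: ltrD.
case: asboolP => [_|]; first by split => //= i; rewrite mxE; exact: hq2.
case=> y [y1 y2]; apply: He; first exact: tri hq1 y1.
by move=> i; have := y2 i; rewrite mxE => y2i; exact: tri (hq2 i) y2i.
Qed.

Local Notation BE := (g_sigma_algebraType (@open E)).

Lemma measurable_fun_borel_ambient d0 (X : measurableType d0) (F : X -> BE) :
  measurable_fun setT (fun x => (F x : E).1 : R) ->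
  (forall i, measurable_fun setT (fun x => (F x : E).2 0 i : R)) ->
  measurable_fun setT F.
Proof.
move=> m1 m2; apply: (@measurability _ _ X BE setT F (@open E)) => //.
move=> _ [U oU <-]; rewrite setTI.
exact: measurable_preimage_open.
Qed.

Lemma open_measurable_ambient (U : set E) : open U -> measurable (U : set BE).
Proof. by move=> oU; exact: sub_sigma_algebra. Qed.

Lemma closed_measurable_ambient (U : set E) : closed U -> measurable (U : set BE).
Proof.
move=> cU; rewrite -[U]setCK; apply: measurableC.
by apply: open_measurable_ambient; exact: closed_openC.
Qed.

Lemma within_continuous_measurable_ambient (A : set E) (f : E -> R) :
  closed A -> {within A, continuous f} -> measurable_fun (A : set BE) f.
Proof.
move=> cA /continuousP cf; apply: (measurability _ (RGenOpens.measurableE R)).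
move=> _ [_ [a [b ->] <-]].
have oab : open (`]a, b[%classic : set R) by exact: interval_open.
have /open_subspaceP[V oV VA] := cf _ oab.
rewrite setIC -[X in measurable X]VA; apply: measurableI.
  exact: open_measurable_ambient.
exact: closed_measurable_ambient.
Qed.

Lemma continuous_measurable_ambient (f : E -> R) : continuous f ->
  measurable_fun setT (f : BE -> R).
Proof.
move=> cf; apply: (within_continuous_measurable_ambient closedT).
exact: continuous_subspaceT.
Qed.

End BorelAmbient.

Section ConeMeasure.
Context {R : realType}.
Variables (g : geometry) (d : nat).
Local Notation E := (@ambient R d).
Local Notation M := (@space_form R g d).
Local Notation kappa := (@curvature R g).
Local Notation T := (measurableTypeR R).
Local Notation BE := (g_sigma_algebraType (@open E)).
Local Notation lam := (lebesgue_tuple R).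

Definition to_ambient (t : d.+1.-tuple T) : E :=
  (tnth t ord0, \row_i tnth t (lift ord0 i)).

Lemma to_ambient_cons (x : T) (t : d.-tuple T) :
  to_ambient (cons_pair (x, t)) = (x, row_of_tuple t).
Proof.
by congr pair; apply/rowP => i; rewrite !mxE tnthS.
Qed.

Lemma measurable_to_ambient_fst : measurable_fun setT (fun t => (to_ambient t).1 : R).
Proof. exact: measurable_tnth. Qed.

Lemma measurable_to_ambient_snd i : measurable_fun setT (fun t => (to_ambient t).2 0 i : R).
Proof.
rewrite (_ : (fun t => _) = (fun t : d.+1.-tuple T => tnth t (lift ord0 i) : R)).
  exact: measurable_tnth.
by apply/funext => t; rewrite mxE.
Qed.

Lemma measurable_to_ambient : measurable_fun setT (to_ambient : d.+1.-tuple T -> BE).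
Proof.
apply: measurable_fun_borel_ambient; first exact: measurable_to_ambient_fst.
exact: measurable_to_ambient_snd.
Qed.

Let hgt t := height g (to_ambient t).

Let measurable_hgt : measurable_fun setT hgt.
Proof.
apply: (measurableT_comp (continuous_measurable_ambient (@continuous_height R g d))).
exact: measurable_to_ambient.
Qed.

Let proj t := normalize g (to_ambient t).

Let measurable_proj : measurable_fun setT (proj : d.+1.-tuple T -> BE).
Proof.
have ms : measurable_fun setT (fun t => (Num.sqrt (hgt t))^-1).
  apply: (measurableT_comp measurable_inv).
  exact: (measurableT_comp measurable_sqrt).
apply: measurable_fun_borel_ambient => [|i].
  by apply: (measurable_funM ms); exact: measurable_to_ambient_fst.
rewrite (_ : (fun t => _) = (fun t => (Num.sqrt (hgt t))^-1 * (to_ambient t).2 0 i)).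
  by apply: (measurable_funM ms); exact: measurable_to_ambient_snd.
by apply/funext => t; rewrite mxE.
Qed.

Definition upper (z : E) : bool := if g is Spherical then true else 0 < z.1.

Lemma upperP z : reflect (g <> Spherical -> 0 < z.1) (upper z).
Proof. by rewrite /upper; case: g; apply: (iffP idP) => //; apply. Qed.

(** The factor [c] of a point [c x] is the square root of its height, whence the bounds on
    [height]. *)
Definition cone : set (d.+1.-tuple T) :=
  [set t | [&& 0 < height g (to_ambient t), height g (to_ambient t) <= 1 &
               upper (to_ambient t)]].

Let measurable_cone : measurable cone.
Proof.
apply: measurable_set_bool; apply: measurable_and.
  exact: measurable_fun_ltr.
apply: measurable_and; first exact: measurable_fun_ler.
rewrite /upper; case: (g) => //; apply: measurable_fun_ltr => //;
 exact: measurable_to_ambient_fst.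
Qed.

(* Radial projection to the space of Lebesgue measure on the cone over it. *)
Definition cone_measure : {measure set BE -> \bar R} :=
  measure_function_pushforward__canonical__measure_function_Measure
    (mrestr (lam d.+1) measurable_cone) measurable_proj.
Local Notation mu := cone_measure.

Lemma cone_measureE (S : set E) :
  mu S = lam d.+1 ((fun t => normalize g (to_ambient t)) @^-1` S `&` cone).
Proof. by []. Qed.

Lemma measurable_cone_preimage (S : set BE) : measurable S ->
  measurable ((fun t => normalize g (to_ambient t)) @^-1` S `&` cone).
Proof.
move=> mS; apply: measurableI => //.
by rewrite -[X in measurable X]setTI; exact: measurable_proj.
Qed.

Lemma cone_proj t : cone t -> M (normalize g (to_ambient t)).
Proof. by move=> /and3P[t0 t1 /upperP t2]; exact: space_form_normalize. Qed.

Lemma cone_measure_setI (S : set E) : mu S = mu (S `&` M).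
Proof.
rewrite !cone_measureE; congr (lam _ _); apply/seteqP; split => t /= [tS ct].
  by split=> //; split=> //; exact: cone_proj.
by split=> //; case: tS.
Qed.

Definition tuple_of_ambient (x : E) : d.+1.-tuple T :=
  [tuple if unlift ord0 i is Some j then x.2 0 j else x.1 | i < d.+1].

Lemma tuple_of_ambient0 x : tnth (tuple_of_ambient x) ord0 = x.1.
Proof. by rewrite tnth_mktuple unlift_none. Qed.

Lemma tuple_of_ambientS x i : tnth (tuple_of_ambient x) (lift ord0 i) = x.2 0 i.
Proof. by rewrite tnth_mktuple liftK. Qed.

Lemma tuple_of_ambientK x : to_ambient (tuple_of_ambient x) = x.
Proof.
rewrite [RHS]surjective_pairing; congr pair; first exact: tuple_of_ambient0.
by apply/rowP => i; rewrite mxE tuple_of_ambientS.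
Qed.

Lemma cone_measure_open_gt0 (U : set E) x : open U -> M x -> U x -> (0 < mu U)%E.
Proof.
move=> oU Mx Ux; rewrite cone_measureE.
(* The point [x] has height 1 and lies on the boundary of the cone; [x / 2] is interior, and a small
   cube around it projects into [U]. *)
pose a : E := 2^-1 *: x.
have /space_formP[hx px] := Mx.
have ha : height g a = 2^-1 ^+ 2 by rewrite heightZ hx mulr1.
have ha0 : 0 < height g a by rewrite ha exprn_gt0// invr_gt0.
have na : normalize g a = x.
  rewrite /normalize ha sqrtr_sqr gtr0_norm ?invr_gt0// invrK scalerA divff ?scale1r//.
have ida : id z @[z --> a] --> a by exact: cvg_id.
have hc : height g z @[z --> a] --> height g a by exact: cvg_height.
have fc : z.1 @[z --> a] --> a.1 by exact: cvg_ambient_fst.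
have n0 : \forall z \near a, 0 < height g z by exact: cvgr_gt hc _ ha0.
have n1 : \forall z \near a, height g z < 1.
  by apply: cvgr_lt hc _ _; rewrite ha expr2; lra.
have nU : \forall z \near a, U (normalize g z).
  have := cvg_normalize ha0 ida; rewrite na; apply.
  exact: open_nbhs_nbhs.
have nup : \forall z \near a, upper z.
  have [gS|gS] := pselect (g = Spherical); first by apply: (@filterS _ (nbhs a) (nbhs_filter a) _ _ _ n0) => z _; rewrite /upper gS.
  have a1 : 0 < a.1 by rewrite /a/= /GRing.scale/= mulr_gt0 ?invr_gt0 ?px.
  by apply: (@filterS _ (nbhs a) (nbhs_filter a) _ _ _ (cvgr_gt _ fc _ a1)) => z z0; apply/upperP => _; exact: z0.
have near_a : \forall z \near a, [/\ U (normalize g z), 0 < height g z, height g z < 1 & upper z].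
  by near=> z; split; near: z.
have [e e0 He] := nbhs_ambient_box near_a.
have ee : (0 < ((e + e) ^+ d.+1)%:E)%E by rewrite lte_fin exprn_gt0// addr_gt0.
apply: (lt_le_trans ee).
rewrite -(lebesgue_tuple_cube (tuple_of_ambient a) e0).
apply: le_measure; rewrite ?inE.
- rewrite (_ : [set t | _] = \bigcap_(i in [set: 'I_d.+1])
    [set t : d.+1.-tuple T | `|tnth t i - tnth (tuple_of_ambient a) i| < e]).
    apply: fin_bigcap_measurable => // i _; apply: measurable_set_bool.
    by apply: measurable_dist_lt; exact: measurable_tnth.
  by apply/seteqP; split => t /= H i; [move=> _|]; exact: H.
- by apply: measurable_cone_preimage; exact: open_measurable_ambient.
- move=> t /= ta; have := He (to_ambient t) => -[].
  + by have := ta ord0; rewrite tuple_of_ambient0.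
  + by move=> i; rewrite [X in `|X - _|]mxE -tuple_of_ambientS.
  + by move=> Ut h0 h1 up; split => //; apply/and3P; split => //; exact: ltW.
Unshelve. all: by end_near. Qed.

Lemma cone_measure_bounded (S : set BE) (c : R) : measurable S ->
  (forall x, (S `&` M) x -> `|x.1| <= c /\ forall i, `|x.2 0 i| <= c) ->
  (mu S < +oo)%E.
Proof.
move=> mS Sc; rewrite cone_measureE.
have [->|/set0P[t0 [t0S ct0]]] := eqVneq ((fun t => normalize g (to_ambient t)) @^-1` S `&` cone) set0.
  by rewrite measure0.
have c0 : 0 <= c by have [+ _] := Sc _ (conj t0S (cone_proj ct0)); exact: le_trans.
pose o : d.+1.-tuple R := tuple_of_ambient 0.
(* The margin 1 makes the inequalities of the open cube strict and its side positive even for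
   [c = 0]. *)
have c10 : 0 < c + 1 by rewrite ltr_wpDl.
apply: (@le_lt_trans _ _ (((c + 1) + (c + 1)) ^+ d.+1)%:E); last exact: ltry.
rewrite -(lebesgue_tuple_cube o c10).
apply: le_measure; rewrite ?inE.
- exact: measurable_cone_preimage.
- rewrite (_ : [set t | _] = \bigcap_(i in [set: 'I_d.+1])
    [set t : d.+1.-tuple T | `|tnth t i - tnth o i| < c + 1]).
    apply: fin_bigcap_measurable => // i _; apply: measurable_set_bool.
    by apply: measurable_dist_lt; exact: measurable_tnth.
  by apply/seteqP; split => t /= H i; [move=> _|]; exact: H.
move=> t /= [tS ct] i.
have [b1 b2] := Sc _ (conj tS (cone_proj ct)).
have /and3P[h0 h1 _] := ct.
set s := Num.sqrt (height g (to_ambient t)).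
have s0 : 0 < s by rewrite sqrtr_gt0.
have s1 : s <= 1 by rewrite -sqrtr1 ler_sqrt.
have tE : to_ambient t = s *: normalize g (to_ambient t).
  by rewrite /normalize -/s scalerA divff ?scale1r// gt_eqF.
have key (a : R) : `|a| <= c -> `|s * a| < c + 1.
  move=> ac; rewrite normrM gtr0_norm//.
  by have := ler_pM (ltW s0) (normr_ge0 a) s1 ac; rewrite mul1r => ?; lra.
case: (unliftP ord0 i) => [j ->|->].
  rewrite tuple_of_ambientS mxE subr0.
  rewrite (_ : tnth t _ = (to_ambient t).2 0 j); last by rewrite mxE.
  by rewrite {1}tE /= mxE; exact: key.
rewrite tuple_of_ambient0 subr0 (_ : tnth t ord0 = (to_ambient t).1)//.
by rewrite {1}tE; exact: key.
Qed.

Lemma cone_measure_compact (S : set E) : compact S -> S `<=` M -> (mu S < +oo)%E.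
Proof.
move=> cS SM; have [c Sc] := dual_bounded_compact 0 cS SM.
apply: (@cone_measure_bounded _ c).
  by apply: closed_measurable_ambient; exact: compact_closed.
by move=> x [Sx Mx]; apply: (Sc x x) => //; rewrite sqdistxx.
Qed.

End ConeMeasure.

Section ReflectionInvariance.
Context {R : realType}.
Variables (g : geometry) (d : nat).
Local Notation E := (@ambient R d).
Local Notation M := (@space_form R g d).
Local Notation T := (measurableTypeR R).
Local Notation BE := (g_sigma_algebraType (@open E)).
Local Notation lam := (lebesgue_tuple R).
Local Notation mu := (@cone_measure R g d).
Variables (x y : E).
Hypotheses (Mx : M x) (My : M y) (xy : x <> y).
Local Notation sigma := (refl g x y).

Lemma continuous_refl : continuous sigma.
Proof.
move=> z; apply: cvgB; first exact: cvg_id.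
apply: cvgZ; last exact: cvg_cst.
apply: cvgM; last exact: cvg_cst.
apply: cvgB.
  by apply: cvgM; [exact: cvg_cst|apply: cvg_form; [exact: cvg_id|exact: cvg_cst]].
by apply: cvgM; [exact: cvg_cst|apply: cvg_ambient_fst; exact: cvg_id].
Qed.

Lemma measurable_refl : measurable_fun setT (sigma : BE -> BE).
Proof.
apply: (@measurability _ _ BE BE setT sigma (@open E)) => //.
move=> _ [U oU <-]; rewrite setTI; apply: open_measurable_ambient.
by apply: open_comp => // z _; exact: continuous_refl.
Qed.

Lemma normalize_refl z : normalize g (sigma z) = sigma (normalize g z).
Proof. by rewrite /normalize height_refl// reflZ. Qed.

Let w (i : 'I_d.+1) : R := tnth (tuple_of_ambient (x - y)) i.
Let c (i : 'I_d.+1) : R := if unlift ord0 i is Some j then 2 * (x - y).2 0 j / sqdist g x y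
  else (2 * curvature g * (x - y).1 - (form g x x - form g y y)) / sqdist g x y.

Let sum_c (t : d.+1.-tuple T) :
  \sum_i c i * tnth t i = side g x y (to_ambient t) / sqdist g x y.
Proof.
rewrite big_ord_recl /c unlift_none.
under eq_bigr do rewrite liftK.
rewrite /side /form /dot [(to_ambient t).1]/=.
under [\sum_(i < d) (to_ambient t).2 0 i * _]eq_bigr => i _ do rewrite [X in X * _]mxE.
under eq_bigr => i _.
  rewrite (_ : _ * _ = (2 / sqdist g x y) * (tnth t (lift ord0 i) * (x - y).2 0 i)); last by ring.
  over.
rewrite -mulr_sumr; set s := \sum_(i < d) _; ring.
Qed.

Let Sigma (t : d.+1.-tuple T) : d.+1.-tuple T :=
  [tuple tnth t i - (\sum_j c j * tnth t j) * w i | i < d.+1].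

Let to_ambient_Sigma t : to_ambient (Sigma t) = sigma (to_ambient t).
Proof.
rewrite /Sigma sum_c /refl /to_ambient; congr pair.
  by rewrite tnth_mktuple /w tuple_of_ambient0.
by apply/rowP => i; rewrite !mxE tnth_mktuple /w tuple_of_ambientS !mxE.
Qed.

(** The reflection is linear, commutes with [normalize] and preserves [height], so it maps the cone
    to itself; the sign condition is kept because the normalized point stays in the space. In
    coordinates it is [Sigma], and [side (x - y) = 2 * sqdist x y] gives the condition
    [\sum c w = 2]. *)
Lemma cone_measure_refl (S : set BE) : measurable S -> mu (sigma @^-1` S) = mu S.
Proof.
move=> mS; rewrite !cone_measureE.
set X := (X in _ = lam _ X).
have mX : measurable X by exact: measurable_cone_preimage.
rewrite (_ : _ `&` _ = Sigma @^-1` X); last first.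
  have upE t : height g (to_ambient t) > 0 -> upper g (sigma (to_ambient t)) = upper g (to_ambient t).
    suff H z : height g z > 0 -> upper g z -> upper g (sigma z).
      move=> h0; apply/idP/idP; last exact: H.
      by rewrite -{2}(reflK Mx My xy (to_ambient t)); apply: H; rewrite height_refl.
    move=> h0 /upperP up; apply/upperP => gS.
    have /(space_form_refl Mx My xy)/space_formP[_ /(_ gS)] := space_form_normalize h0 up.
    by rewrite -normalize_refl /normalize/= /GRing.scale/= pmulr_rgt0// invr_gt0 sqrtr_gt0 height_refl.
  apply/seteqP; split => t; rewrite /X /=.
    move=> [tS /and3P[h0 h1 up]]; split; first by rewrite to_ambient_Sigma normalize_refl.
    by apply/and3P; rewrite to_ambient_Sigma height_refl// upE.
  rewrite to_ambient_Sigma normalize_refl => -[tS /and3P[]].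
  by rewrite to_ambient_Sigma height_refl// => h0 h1; rewrite upE// => up; split=> //; apply/and3P.
have mSigma : measurable_fun setT Sigma.
  apply/measurable_fun_tnthP => i.
  rewrite (_ : _ \o _ = fun t : d.+1.-tuple T => tnth t i - (\sum_j c j * tnth t j) * w i).
    apply: measurable_funB; first exact: measurable_tnth.
    by apply: measurable_funM => //; exact: measurable_linear.
  by apply/funext => t /=; rewrite tnth_mktuple.
have mSX : measurable (Sigma @^-1` X) by rewrite -[X in measurable X]setTI; exact: mSigma.
have cw : \sum_i c i * w i = 2.
  rewrite sum_c tuple_of_ambientK side_diff// -mulrA divff ?mulr1// gt_eqF//.
  exact: sqdist_gt0.
have f0 t : (0 <= (\1_X t)%:E :> \bar R)%E by rewrite lee_fin.
have mf : measurable_fun setT (fun t : d.+1.-tuple T => (\1_X t)%:E : \bar R).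
  by apply/measurable_EFinP; exact: measurable_indic.
have e1 := integral_indic (lam d.+1) measurableT mX.
have e2 := integral_indic (lam d.+1) measurableT mSX.
have e3 := integral_lebesgue_tuple_reflection cw mf f0.
rewrite setIT in e1; rewrite setIT in e2.
rewrite -e1.
rewrite -e2.
rewrite -e3.
apply: eq_integral => t _.
rewrite !indicE.
congr ((_ _)%:R%:E).
Qed.

End ReflectionInvariance.

(** * Cone measure and Riemannian volume *)

Section MetricDeterminant.
Context {R : realType}.
Variables (g : geometry) (d : nat).
Local Notation E := (@ambient R d).
Local Notation kappa := (@curvature R g).

(** The matrix determinant lemma, read off from two block triangular factorizations of [N]. *)
Lemma det_add_rank1 (k : R) (u : 'rV[R]_d) : \det (1%:M + k *: (u^T *m u)) = 1 + k * dot u u.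
Proof.
pose N := block_mx (1%:M : 'M[R]_1) (- u) (k *: u^T) (1%:M : 'M[R]_d).
have e1 : N = block_mx 1%:M 0 (k *: u^T) 1%:M *m block_mx 1%:M (- u) 0 (1%:M + k *: (u^T *m u)).
  rewrite mulmx_block !(mul1mx, mul0mx, mulmx1, mulmx0, addr0, add0r) /N.
  congr block_mx; rewrite mulmxN -scalemxAl addrC -addrA; first by rewrite subrr addr0.
have e2 : N = block_mx (1 + k * dot u u)%:M (- u) 0 1%:M *m block_mx 1%:M 0 (k *: u^T) 1%:M.
  rewrite mulmx_block !(mul1mx, mul0mx, mulmx1, mulmx0, addr0, add0r) /N.
  congr block_mx; rewrite mulNmx -scalemxAr.
  apply/matrixP => i j; rewrite !ord1 !mxE eqxx mulr1n.
  rewrite (_ : \sum__ _ = dot u u) ?addrK//.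
  by apply: eq_bigr => l _; rewrite mxE.
transitivity (\det N).
  by rewrite e1 det_mulmx det_lblock det_ublock !det1 !mul1r.
by rewrite e2 det_mulmx det_lblock det_ublock !det1 !mulr1 det_scalar1.
Qed.

(** The metric tensor produces [kappa ^+ 3], with two factors from derivatives of the chart and one
    from the form; the three curvatures are the roots of [X^3 - X]. *)
Lemma curvature_cube : kappa ^+ 3 = kappa.
Proof. by rewrite /curvature; case: g; ring. Qed.

Lemma derive_chart (b : bool) (u : 'rV[R]_d) i : chart_domain g u ->
  'D_(delta_mx 0 i) (chart g b) u =
  ((-1) ^+ b * (- kappa * u 0 i / Num.sqrt (1 - kappa * dot u u)), delta_mx 0 i) :> E.
Proof.
rewrite /chart_domain/= => u0.
set s := Num.sqrt _; have s0 : 0 < s by rewrite sqrtr_gt0.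
pose e : 'rV[R]_d := delta_mx 0 i.
(* The first coordinate of the chart along the line [u + h e]; the directional derivative becomes
   one of a single variable. *)
pose phi (h : R) : R := (-1) ^+ b * Num.sqrt (1 - kappa * (dot u u + 2 * h * u 0 i + h ^+ 2)).
have ue : dot u e = u 0 i.
  rewrite /dot (bigD1 i)//= !mxE !eqxx mulr1 big1 ?addr0// => j ji.
  by rewrite mxE (negbTE ji) andbF mulr0.
have ee : dot e e = 1.
  rewrite /dot (bigD1 i)//= !mxE !eqxx mulr1 big1 ?addr0// => j ji.
  by rewrite mxE (negbTE ji) andbF mulr0.
have phiE h : (chart g b (h *: e + u)).1 = phi h.
  rewrite /chart/= /phi; congr (_ * Num.sqrt (1 - _ * _)).
  by rewrite !(dotDl, dotDr, dotZl, dotZr) (dotC e u) ue ee; ring.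
have dphi : is_derive (0 : R) 1 phi ((-1) ^+ b * (- kappa * u 0 i / s)).
  pose psi (h : R) : R := 1 - kappa * (dot u u + 2 * h * u 0 i + h ^+ 2).
  have psi0 : psi 0 = 1 - kappa * dot u u by rewrite /psi; ring.
  have dpsi : is_derive (0 : R) 1 psi (- kappa * (2 * u 0 i)).
    rewrite /psi; apply: is_derive_eq; rewrite /GRing.scale/=; ring.
  have dsq : is_derive (psi 0) 1 Num.sqrt (2 * s)^-1.
    by rewrite psi0; apply: is_derive1_sqrt.
  have dcomp := is_derive1_comp dsq dpsi.
  have -> : phi = (fun h => (-1) ^+ b * (Num.sqrt \o psi) h) by [].
  apply: is_derive_eq; rewrite /GRing.scale/=; field; by rewrite gt_eqF.
rewrite /derive; apply: cvg_lim => //.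
have hE : \forall h \near (0 : R)^', h^-1 *: ((chart g b \o shift u) (h *: e) - chart g b u) =
    (h^-1 *: ((phi \o shift 0) (h *: 1) - phi 0), e).
  near=> h.
  have -> : (phi \o shift 0) (h *: 1) = phi h by rewrite /= addr0 /GRing.scale/= mulr1.
  have c0 : (chart g b u).1 = phi 0 by rewrite -phiE scale0r add0r.
  rewrite [LHS]surjective_pairing; congr pair.
    rewrite -[LHS]/(h^-1 * ((chart g b (h *: e + u)).1 - (chart g b u).1)).
    by rewrite phiE c0.
  rewrite -[LHS]/(h^-1 *: ((h *: e + u) - u)) addrK scalerA mulVf ?scale1r//.
  by near: h; exact: nbhs_dnbhs_neq.
have {}hE : {near (0 : R)^', (fun h => (h^-1 *: ((phi \o shift 0) (h *: 1) - phi 0), e) : E) =1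
    (fun h => h^-1 *: ((chart g b \o shift u) (h *: e) - chart g b u))}.
  by apply: filterS hE => h ->.
apply: (cvg_trans (near_eq_cvg hE)).
have d1 : h^-1 *: ((phi \o shift 0) (h *: 1) - phi 0) @[h --> 0^'] -->
    (-1) ^+ b * (- kappa * u 0 i / s).
  by have [dv <-] := dphi; exact: dv.
have d2 : (fun _ : R => e) h @[h --> 0^'] --> e by exact: cvg_cst.
exact: (cvg_pair d1 d2).
Unshelve. all: by end_near. Qed.

(** The metric tensor is the identity plus a rank one matrix, with determinant
    [1 + kappa |u|^2 / (1 - kappa |u|^2)]. *)
Lemma sqrt_det_metric_tensor (b : bool) (u : 'rV[R]_d) : chart_domain g u ->
  Num.sqrt (\det (metric_tensor g b u)) = (Num.sqrt (1 - kappa * dot u u))^-1.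
Proof.
move=> cu; have u0 : 0 < 1 - kappa * dot u u by [].
set s2 := 1 - kappa * dot u u in u0 *.
rewrite (_ : metric_tensor g b u = 1%:M + (kappa / s2) *: (u^T *m u)).
  rewrite det_add_rank1 (_ : 1 + _ = s2^-1) ?sqrtrV ?ltW//.
  have e : kappa * dot u u = 1 - s2 by rewrite /s2; ring.
  by rewrite mulrAC e; field; rewrite gt_eqF.
apply/matrixP => i j; rewrite !mxE big_ord1 !mxE !derive_chart//.
rewrite /form/= (_ : dot (delta_mx 0 i) (delta_mx 0 j) = (i == j)%:R).
  rewrite -/s2; set c := Num.sqrt s2.
  have c2 : c ^+ 2 = s2 by rewrite sqr_sqrtr// ltW.
  have c0 : c != 0 by rewrite gt_eqF// sqrtr_gt0.
  rewrite -c2 -[in RHS]curvature_cube addrC; congr (_ + _).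
  have bb : (-1 : R) ^+ b * (-1) ^+ b = 1 by rewrite -expr2 sqrr_sign.
  transitivity (kappa ^+ 3 * ((-1) ^+ b * (-1) ^+ b) * (u 0 i * u 0 j) / c ^+ 2).
    by field.
  by rewrite bb; field.
rewrite /dot (bigD1 i)//= !mxE !eqxx/= mul1r big1 ?addr0 => [|l li]; first by [].
by rewrite mxE (negbTE li) andbF mul0r.
Qed.

End MetricDeterminant.

Section VolumeCone.
Context {R : realType}.
Variables (g : geometry) (d : nat).
Hypothesis d0 : (0 < d)%N.
Local Notation E := (@ambient R d).
Local Notation M := (@space_form R g d).
Local Notation kappa := (@curvature R g).
Local Notation T := (measurableTypeR R).
Local Notation BE := (g_sigma_algebraType (@open E)).
Local Notation leb := (@lebesgue_measure R).
Local Notation lam := (lebesgue_tuple R).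
Local Notation mu := (@cone_measure R g d).

Let sqn (t : d.-tuple T) : R := dot (row_of_tuple t) (row_of_tuple t).

Let measurable_sqn : measurable_fun setT sqn.
Proof.
apply: measurable_sum => i.
rewrite (_ : (fun t => _) = (fun t : d.-tuple T => tnth t i * tnth t i)).
  by apply: measurable_funM; exact: measurable_tnth.
by apply/funext => t; rewrite mxE.
Qed.

Let inset (b : bool) (A : set E) (t : d.-tuple T) : bool :=
  `[< (M `&` A) (chart g b (row_of_tuple t)) >].

Let measurable_inset b (A : set E) : closed A -> measurable_fun setT (inset b A).
Proof.
move=> cA; apply: (measurable_fun_bool true); rewrite setTI.
rewrite (_ : _ @^-1` _ = (fun t => chart g b (row_of_tuple t)) @^-1` (M `&` A)); last first.
  by apply/seteqP; split => t /= /asboolP.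
have mch : measurable_fun setT ((fun t => chart g b (row_of_tuple t)) : d.-tuple T -> BE).
  apply: measurable_fun_borel_ambient => [|i].
    apply: measurable_funM => //; apply: (measurableT_comp measurable_sqrt).
    by apply: measurable_funB => //; exact: measurable_funM.
  rewrite (_ : (fun t => _) = (fun t : d.-tuple T => tnth t i : R)).
    exact: measurable_tnth.
  by apply/funext => t; rewrite mxE.
rewrite -[X in measurable X]setTI; apply: (mch measurableT).
by apply: closed_measurable_ambient; apply: closedI => //; exact: closed_space_form.
Qed.

Let rowZ c (t : d.-tuple T) : row_of_tuple (scale_tuple c t) = c *: row_of_tuple t.
Proof. by apply/rowP => i; rewrite !mxE tnth_mktuple. Qed.

Let sqnZ c t : sqn (scale_tuple c t) = c ^+ 2 * sqn t.
Proof. by rewrite /sqn rowZ dotZl dotZr mulrA. Qed.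

Let dens (b : bool) (A : set E) (t : d.-tuple T) : \bar R :=
  if (0 < 1 - kappa * sqn t) && inset b A t
  then ((Num.sqrt (1 - kappa * sqn t))^-1)%:E else 0%E.

Let measurable_cond (b : bool) (A : set E) : closed A ->
  measurable_fun setT (fun t => (0 < 1 - kappa * sqn t) && inset b A t).
Proof.
move=> cA; apply: measurable_and; last exact: measurable_inset.
apply: measurable_fun_ltr => //; apply: measurable_funB => //.
exact: measurable_funM.
Qed.

Let measurable_dens b (A : set E) : closed A -> measurable_fun setT (dens b A).
Proof.
move=> cA; apply: measurable_fun_ifT => //; first exact: measurable_cond.
apply/measurable_EFinP; apply: (measurableT_comp measurable_inv).
apply: (measurableT_comp measurable_sqrt); apply: measurable_funB => //.
exact: measurable_funM.
Qed.

Let dens_ge0 b A t : (0 <= dens b A t)%E.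
Proof. by rewrite /dens; case: ifP => // _; rewrite lee_fin invr_ge0 sqrtr_ge0. Qed.

Let volumeE (A : set E) : closed A ->
  volume g A = (\sum_(b : bool) \int[lam d]_t dens b A t)%E.
Proof.
move=> cA; apply: eq_bigr => b _.
rewrite integral_mkcond; apply: eq_integral => t _; rewrite patchE /dens.
case: ifP => [|H].
  rewrite inE/= => -[ct At]; rewrite sqrt_det_metric_tensor//.
  by rewrite [0 < _]ct /inset asboolT.
case: ifP => // /andP[h1 /asboolP h2].
by move: H; rewrite mem_set.
Qed.

(* Density of the cone over [A] in the coordinates (height, last [d] coordinates);
   the first ambient coordinate is the square root of [p.1 - kappa |p.2|^2]. *)
Let K (b : bool) (A : set E) (p : T * d.-tuple T) : \bar R :=
  if [&& 0 < p.1, p.1 <= 1, 0 < p.1 - kappa * sqn p.2 &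
         inset b A (scale_tuple (Num.sqrt p.1)^-1 p.2)]
  then ((2 * Num.sqrt (p.1 - kappa * sqn p.2))^-1)%:E else 0%E.

Let K_ge0 b A p : (0 <= K b A p)%E.
Proof. by rewrite /K; case: ifP => // _; rewrite lee_fin invr_ge0 mulr_ge0// sqrtr_ge0. Qed.

Let measurable_K b (A : set E) : closed A -> measurable_fun setT (K b A).
Proof.
move=> cA; have m1 : measurable_fun [set: T * d.-tuple T] (fun p => p.1 : R) by exact: measurable_fst.
have m2 : measurable_fun [set: T * d.-tuple T] (fun p => p.1 - kappa * sqn p.2).
  apply: measurable_funB => //; apply: measurable_funM => //.
  by apply: (measurableT_comp measurable_sqn); exact: measurable_snd.
apply: measurable_fun_ifT => //.
  apply: measurable_and; first exact: measurable_fun_ltr.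
  apply: measurable_and; first exact: measurable_fun_ler.
  apply: measurable_and; first exact: measurable_fun_ltr.
  apply: (measurableT_comp (measurable_inset b cA)).
  apply/measurable_fun_tnthP => i.
  rewrite (_ : _ \o _ = fun p : T * d.-tuple T => (Num.sqrt p.1)^-1 * tnth p.2 i).
    apply: measurable_funM.
      by apply: (measurableT_comp measurable_inv); exact: (measurableT_comp measurable_sqrt).
    by apply: (measurableT_comp (measurable_tnth i)); exact: measurable_snd.
  by apply/funext => p /=; rewrite tnth_mktuple.
apply/measurable_EFinP; apply: (measurableT_comp measurable_inv).
by apply: measurable_funM => //; exact: (measurableT_comp measurable_sqrt).
Qed.

(** The product of [sqrt s ^ d], from scaling the last [d] coordinates of the slice at height [s] to
    height 1, and of the factor [(2 * sqrt s)^-1] that relates [K] to [dens] after this scaling. *)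
Let rad (s : R) : \bar R :=
  if (0 < s) && (s <= 1) then (Num.sqrt s ^+ d.-1 / 2)%:E else 0%E.

Let rad_ge0 s : (0 <= rad s)%E.
Proof. by rewrite /rad; case: ifP => // _; rewrite lee_fin divr_ge0// exprn_ge0// sqrtr_ge0. Qed.

Let measurable_rad : measurable_fun [set: R] rad.
Proof.
apply: measurable_fun_ifT => //.
  by apply: measurable_and; [exact: measurable_fun_ltr|exact: measurable_fun_ler].
apply/measurable_EFinP; apply: measurable_funM => //.
by apply: measurable_funX; exact: measurable_sqrt.
Qed.

Let integral_K_slice b (A : set E) (s : R) : closed A ->
  (\int[lam d]_t K b A (s, t) = rad s * \int[lam d]_t dens b A t)%E.
Proof.
move=> cA; rewrite /rad; case: ifPn => [/andP[s0 s1]|s01]; last first.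
  rewrite mul0e; apply: integral0_eq => t _; rewrite /K/=.
  by move: s01; case: (0 < s) => //= /negbTE ->.
have r0 : 0 < Num.sqrt s by rewrite sqrtr_gt0.
have mKs : measurable_fun setT (fun t => K b A (s, t)).
  by apply: (measurableT_comp (measurable_K b cA)); exact: measurable_fun_pair.
rewrite -(integral_lebesgue_tuple_scale r0 mKs)//.
have KE t : K b A (s, scale_tuple (Num.sqrt s) t) = ((2 * Num.sqrt s)^-1%:E * dens b A t)%E.
  rewrite /K/= s0 s1/= sqnZ sqr_sqrtr ?ltW//.
  have -> : scale_tuple (Num.sqrt s)^-1 (scale_tuple (Num.sqrt s) t) = t.
    apply: eq_from_tnth => i; rewrite !tnth_mktuple mulrA mulVf ?mul1r// gt_eqF//.
  have -> : s - kappa * (s * sqn t) = s * (1 - kappa * sqn t) by ring.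
  rewrite pmulr_rgt0// /dens; case: ifP => [/andP[c0 _]|]; last by rewrite mule0.
  by rewrite sqrtrM ?ltW// -EFinM mulrA [in LHS]invfM.
under eq_integral do rewrite KE.
rewrite ge0_integralZl//; last exact: measurable_dens.
rewrite muleA -EFinM; congr (_%:E * _)%E.
by rewrite -[in LHS](prednK d0) exprS; field; rewrite gt_eqF.
Qed.

(** The values [y = x^2] for which [(x, t)], with the sign of [x] given by [b], lies on the cone
    over [A]; the height is then [y + kappa * sqn t]. *)
Let S (b : bool) (A : set E) (t : d.-tuple T) : set R :=
  [set y | [&& 0 < y + kappa * sqn t, y + kappa * sqn t <= 1 &
    inset b A (scale_tuple (Num.sqrt (y + kappa * sqn t))^-1 t)]].

Let measurable_S b (A : set E) t : closed A -> measurable (S b A t : set T).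
Proof.
move=> cA; have m2 : measurable_fun [set: R] (fun y : R => y + kappa * sqn t).
  exact: measurable_funD.
apply: measurable_set_bool.
apply: measurable_and; first exact: measurable_fun_ltr.
apply: measurable_and; first exact: measurable_fun_ler.
apply: (measurableT_comp (measurable_inset b cA)).
apply/measurable_fun_tnthP => i.
rewrite (_ : _ \o _ = fun y : T => (Num.sqrt (y + kappa * sqn t))^-1 * tnth t i).
  apply: measurable_funM => //.
  by apply: (measurableT_comp measurable_inv); exact: (measurableT_comp measurable_sqrt).
by apply/funext => p /=; rewrite tnth_mktuple.
Qed.

Let leb_S b (A : set E) t : closed A ->
  (leb [set x | (0 < x) && `[< S b A t (x ^+ 2) >]]%R = \int[leb]_s K b A (s, t))%E.
Proof.
move=> cA; rewrite lebesgue_measure_preimage_sqr; last exact: measurable_S.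
have mKt : measurable_fun [set: R] (fun s => K b A (s, t)).
  apply: (measurableT_comp (measurable_K b cA)).
  by apply: measurable_fun_pair.
have := @integral_lebesgue_affine R 1 (kappa * sqn t) (fun s => K b A (s, t)) ltr01 mKt (fun _ => K_ge0 _ _ _).
rewrite mul1e => <-; apply: eq_integral => y _.
rewrite /K/= mul1r addrK; case: ltP => y0 /=; last by rewrite andbF/= !andbF.
congr (if _ then _ else _).
by apply/asboolP/idP => //.
Qed.

Let X (A : set E) : set (d.+1.-tuple T) :=
  (fun t => normalize g (to_ambient t)) @^-1` A `&` @cone R g d.

Let X_cons (A : set E) (t : d.-tuple T) (b : bool) (x : R) : 0 < (-1) ^+ b * x ->
  X A (cons_pair (x, t)) <-> S b A t (x ^+ 2).
Proof.
move=> bx0; rewrite /X /S /cone /= to_ambient_cons.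
have -> : height g ((x, row_of_tuple t) : E) = x ^+ 2 + kappa * sqn t by [].
set q := x ^+ 2 + _.
have [q0|q0] := ltP 0 q; last by split => // -[].
have chE : chart g b (row_of_tuple (scale_tuple (Num.sqrt q)^-1 t)) =
    normalize g ((x, row_of_tuple t) : E).
  rewrite /chart/= rowZ /normalize -[height g _]/q; congr pair.
  rewrite dotZl dotZr -/(sqn t).
  have cc : (Num.sqrt q)^-1 ^+ 2 = q^-1 by rewrite exprVn sqr_sqrtr ?ltW.
  rewrite (_ : 1 - _ = ((Num.sqrt q)^-1 * x) ^+ 2); last first.
    rewrite [in LHS](mulrA _^-1) -expr2 exprMn cc.
    have -> : x ^+ 2 = q - kappa * sqn t by rewrite /q; ring.
    by field; rewrite gt_eqF.
  rewrite sqrtr_sqr normrM gtr0_norm ?invr_gt0 ?sqrtr_gt0//.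
  rewrite mulrCA; congr (_ * _).
  case: b bx0 => /=; rewrite ?expr1 ?expr0 ?mulN1r ?mul1r => x0.
    by rewrite ltr0_norm ?opprK// -oppr_gt0.
  by rewrite gtr0_norm.
rewrite /inset chE /=; split.
  move=> [Az /andP[q1 /upperP up]]; rewrite q1/=; apply/asboolP; split => //.
  exact: space_form_normalize.
move=> /andP[q1 /asboolP[/space_formP[_ Mz] Az]]; split => //; rewrite q1/=.
apply/upperP => gS; have := Mz gS; rewrite /normalize/= /GRing.scale/=.
by rewrite pmulr_rgt0// invr_gt0 sqrtr_gt0.
Qed.

Let leb_X (A : set E) (t : d.-tuple T) : closed A ->
  leb [set x | X A (cons_pair (x, t))] = (\sum_(b : bool) \int[leb]_s K b A (s, t))%E.
Proof.
move=> cA.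
have mX : measurable (X A) by apply: measurable_cone_preimage; exact: closed_measurable_ambient.
pose Xt : set T := [set x | X A (cons_pair (x, t))].
have mXt : measurable Xt.
  have := @measurable_cons_pairr R d t measurableT _ mX; by rewrite setTI.
pose P := Xt `&` `]0, +oo[%classic; pose N := Xt `&` `]-oo, 0[%classic.
have mP : measurable P by apply: measurableI.
have mN : measurable N by apply: measurableI.
(* The two signs of [x] belong to the two charts; the points with [x = 0], missed by both,
   contribute a null set. *)
have -> : [set x | X A (cons_pair (x, t))] = (P `|` N) `|` (Xt `&` [set 0]).
  apply/seteqP; split => x; last by move=> [[[]|[]]|[]].
  move=> Xx; have [x0|x0|x0] := ltgtP x 0.
  - by left; right; split => //; rewrite /= in_itv.
  - by left; left; split => //; rewrite /= in_itv/= x0.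
  - by right.
rewrite measureU0; last 3 first.
- exact: measurableU.
- exact: measurableI.
- apply: (@subset_measure0 _ _ _ leb _ [set 0]) => //; first exact: measurableI.
  by apply: lebesgue_measure_set1.
rewrite measureU//; last first.
  apply/seteqP; split => // x [[_ /=]]; rewrite in_itv/= andbT => x0 [_ /=].
  by rewrite in_itv/=; lra.
rewrite big_bool/= addeC -!leb_S//; congr (_ + _)%E.
  rewrite -lebesgue_measureN// /pushforward; congr (leb _).
  apply/seteqP; split => x /=.
    move=> [Xx]; rewrite /= in_itv/= oppr_lt0 => x0; rewrite x0/=; apply/asboolP.
    by rewrite -sqrrN; apply/X_cons => //; rewrite expr1 mulN1r opprK.
  move=> /andP[x0 /asboolP]; rewrite -sqrrN => Sx; split.
    by apply/(@X_cons A t true); rewrite ?expr1 ?mulN1r ?opprK.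
  by rewrite /= in_itv/= oppr_lt0.
congr (leb _); apply/seteqP; split => x /=.
  move=> [Xx]; rewrite /= in_itv/= andbT => x0; rewrite x0/=; apply/asboolP.
  by apply/X_cons => //; rewrite expr0 mul1r.
move=> /andP[x0 /asboolP] Sx; split; last by rewrite /= in_itv/= x0.
by apply/(@X_cons A t false); rewrite ?expr0 ?mul1r.
Qed.

Let k := (\int[leb]_s rad s)%E.

Let k_lty : (k < +oo)%E.
Proof.
apply: (@le_lt_trans _ _ (\int[leb]_(s in `]0%R, 1%R]) 1)%E).
  rewrite [leRHS]integral_mkcond; apply: ge0_le_integral => //.
    by apply/(measurable_restrictT _ (measurable_itv _)).
  move=> s _; rewrite patchE /rad; case: ifP => [/andP[s0 s1]|_]; last by case: ifP.
  rewrite mem_set/= ?in_itv/= ?s0// lee_fin ler_pdivrMr// mul1r.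
  apply: (@le_trans _ _ 1); last by rewrite ler1n.
  by rewrite exprn_ile1// ?sqrtr_ge0// -sqrtr1 ler_sqrt.
rewrite integral_cst// -[X in (1 * X)%E]/(leb `]0%R, 1%R]%classic) mul1e.
by rewrite lebesgue_measure_itv/= lte_fin ltr01 oppr0 adde0 ltry.
Qed.

Let k_gt0 : (0 < k)%E.
Proof.
(* A lower bound for [rad] on []1/4, 1]], where [sqrt s >= 1/2]. *)
pose c : R := (2^-1) ^+ d.-1 / 2.
have c0 : 0 < c by rewrite divr_gt0// exprn_gt0// invr_gt0.
apply: (@lt_le_trans _ _ (\int[leb]_(s in `](2^-1 ^+ 2)%R, 1%R]) c%:E)%E).
  rewrite integral_cst// -[X in (_ * X)%E]/(leb `](2^-1 ^+ 2)%R, 1%R]%classic).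
  rewrite lebesgue_measure_itv/= lte_fin ifT; last first.
    by rewrite expr2; lra.
  by rewrite -EFinB -EFinM lte_fin mulr_gt0// expr2; lra.
rewrite integral_mkcond; apply: ge0_le_integral => //.
- by move=> s _; rewrite patchE; case: ifP => // _; rewrite lee_fin ltW.
- by apply/(measurable_restrictT _ (measurable_itv _)).
move=> s _; rewrite patchE; case: ifP => [|_]; last exact: rad_ge0.
rewrite inE/= in_itv/= => /andP[s0 s1].
have s0' : 0 < s by apply: lt_trans s0; rewrite exprn_gt0// invr_gt0.
rewrite /rad s0' s1/= lee_fin ler_pM2r ?invr_gt0//.
apply: lerXn2r; rewrite ?nnegrE ?sqrtr_ge0 ?invr_ge0//.
have i0 : 0 < 2^-1 :> R by rewrite invr_gt0.
by rewrite -[leLHS](gtr0_norm i0) -sqrtr_sqr ler_sqrt ltW.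
Qed.

(** In the coordinates (height, last [d] coordinates), the slice of the cone at height [s] is a
    scaled copy of the set and contributes [rad s] times its volume. The constant is the integral of
    [rad], that is [1/(d+1)]. *)
Lemma cone_measure_volume : exists2 c : R, 0 < c &
  forall A : set E, closed A -> mu A = (c%:E * volume g A)%E.
Proof.
have kfin : k \is a fin_num by rewrite ge0_fin_numE// integral_ge0.
exists (fine k); first by rewrite fine_gt0// k_gt0.
move=> A cA; rewrite fineK// volumeE//.
have mX : measurable (X A) by apply: measurable_cone_preimage; exact: closed_measurable_ambient.
have mI : measurable_fun setT (fun t : d.+1.-tuple T => (\1_(X A) t)%:E : \bar R).
  by apply/measurable_EFinP; exact: measurable_indic.
rewrite cone_measureE -/(X A).
have e1 := integral_indic (lam d.+1) measurableT mX.
rewrite setIT in e1; rewrite -e1 integral_lebesgue_tupleS_swap//.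
transitivity (\int[lam d]_t \sum_(b : bool) \int[leb]_s K b A (s, t))%E.
  apply: eq_integral => t _; rewrite -leb_X//.
  have mXt : measurable ((fun x : T => cons_pair (x, t)) @^-1` X A).
    by have := @measurable_cons_pairr R d t measurableT _ mX; rewrite setTI.
  have e2 := integral_indic leb measurableT mXt.
  by rewrite setIT in e2; rewrite -e2; apply: eq_integral => x _; rewrite !indicE.
have mG b : measurable_fun setT (fun t => \int[leb]_s K b A (s, t))%E.
  by apply: (@measurable_fun_fubini_tonelli_G _ _ _ _ _ leb (K b A)) => //; exact: measurable_K.
have mF b : measurable_fun setT (fun s => \int[lam d]_t K b A (s, t))%E.
  by apply: (@measurable_fun_fubini_tonelli_F _ _ _ _ _ (lam d) (K b A)) => //; exact: measurable_K.
rewrite ge0_integral_sum//; last by move=> b t _; exact: integral_ge0.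
rewrite ge0_sume_distrr; last by move=> b _; exact: integral_ge0.
apply: eq_bigr => b _.
rewrite -(@fubini_tonelli _ _ _ _ _ leb (lam d) (K b A))//; last exact: measurable_K.
under eq_integral do rewrite integral_K_slice//.
by rewrite ge0_integralZr//; exact: integral_ge0.
Qed.

End VolumeCone.

(** * Polarization *)

Section Polarization.
Context {R : realType}.
Variables (g : geometry) (d : nat).
Local Notation E := (@ambient R d).
Local Notation M := (@space_form R g d).
Local Notation BE := (g_sigma_algebraType (@open E)).
Local Notation D := (@sqdist R g d).
Variable mu : {measure set BE -> \bar R}.
Hypothesis mu_refl : forall x y, M x -> M y -> x <> y ->
  forall S : set BE, measurable S -> mu (refl g x y @^-1` S) = mu S.

Section TwoPoint.
Variables (x y : E).
Hypotheses (Mx : M x) (My : M y) (xy : x <> y).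
Local Notation sigma := (refl g x y).
Local Notation h := (side g x y).
Local Notation W := (sqdist g x y).

(** On the space, [0 <= h z] singles out the points no farther from [x] than from [y]. In each pair
    [z], [sigma z] with just one point in [S], that point is placed on the side of [x]. *)
Definition polar_set (S : set E) : set E :=
  [set z | if 0 <= h z then S z \/ S (sigma z) else S z /\ S (sigma z)].

Definition polar (f : E -> R) (z : E) : R :=
  if 0 <= h z then Num.max (f z) (f (sigma z)) else Num.min (f z) (f (sigma z)).

Lemma continuous_side : continuous h.
Proof.
move=> z; apply: cvgB.
  by apply: cvgM; [exact: cvg_cst|apply: cvg_form; [exact: cvg_id|exact: cvg_cst]].
by apply: cvgM; [exact: cvg_cst|apply: cvg_ambient_fst; exact: cvg_id].
Qed.

Lemma measurable_side : measurable_fun setT (h : BE -> R).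
Proof. by apply: continuous_measurable_ambient; exact: continuous_side. Qed.

Let W0 : 0 < W. Proof. exact: sqdist_gt0. Qed.

Let sK : involutive sigma. Proof. by move=> z; exact: reflK. Qed.

Let Ms z : M (sigma z) <-> M z.
Proof.
split; last exact: space_form_refl.
by move=> /(space_form_refl Mx My xy); rewrite sK.
Qed.

Let refl0 z : h z = 0 -> sigma z = z.
Proof. by rewrite /refl => ->; rewrite mul0r scale0r subr0. Qed.

Lemma refl_le z z' : M z -> M z' -> 0 <= h z * h z' -> D z z' <= D z (sigma z').
Proof. by move=> Mz Mz' hh; rewrite sqdist_refl_r// lerDl divr_ge0// ltW. Qed.

Let Dss z z' : M z -> M z' -> D (sigma z) (sigma z') = D z z'.
Proof. exact: sqdist_refl. Qed.

Let Dsl z z' : M z -> M z' -> D (sigma z) z' = D z (sigma z').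
Proof. by move=> Mz Mz'; rewrite -[in LHS](sK z') Dss//; exact/Ms. Qed.

Lemma measurable_preimage_refl (S : set BE) : measurable S -> measurable (sigma @^-1` S : set BE).
Proof. by move=> mS; rewrite -[X in measurable X]setTI; exact: (measurable_refl g x y). Qed.

(** [A1] is the symmetric part of [S], [A2] the unpaired part on the side of [x], [A3] the unpaired
    part on the other side. Polarization keeps the first two and reflects the third, which preserves
    its measure. *)
Lemma measure_polar_set (S : set BE) : measurable S ->
  measurable (polar_set S : set BE) /\ mu (polar_set S) = mu S.
Proof.
move=> mS; have mS' := measurable_preimage_refl mS.
have mH : measurable ([set z | 0 <= h z] : set BE).
  by apply: measurable_set_bool; apply: measurable_fun_ler => //; exact: measurable_side.
pose A1 := S `&` sigma @^-1` S.
pose A2 := (S `\` sigma @^-1` S) `&` [set z | 0 <= h z].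
pose A3 := (S `\` sigma @^-1` S) `\` [set z | 0 <= h z].
have m1 : measurable (A1 : set BE) by exact: measurableI.
have m2 : measurable (A2 : set BE) by apply: measurableI => //; exact: measurableD.
have m3 : measurable (A3 : set BE) by apply: measurableD => //; exact: measurableD.
have m3' := measurable_preimage_refl m3.
have e1 : S = (A1 `|` A2) `|` A3.
  apply/seteqP; split => z; rewrite /A1 /A2 /A3 /=.
    by move=> Sz; case: (pselect (S (sigma z))) => Ssz; case: (pselect (0 <= h z)) => hz; tauto.
  by tauto.
have e2 : polar_set S = (A1 `|` A2) `|` sigma @^-1` A3.
  apply/seteqP; split => z; rewrite /polar_set /A1 /A2 /A3 /=.
    rewrite sK side_refl// oppr_ge0.
    case: ifPn => hz; last by move=> [? ?]; left; left.
    (* Points of the mirror are fixed, so they belong to the symmetric part. *)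
    have [h0|h0] := eqVneq (h z) 0.
      by rewrite refl0// h0 lexx => Sz; left; left; tauto.
    have hz' : ~ (h z <= 0) by move=> h1; move/eqP: h0; apply; apply/le_anti; rewrite h1 hz.
    have tt : true by [].
    by case: (pselect (S (sigma z))) => Ssz; case: (pselect (S z)) => Sz; tauto.
  rewrite sK side_refl// oppr_ge0.
  move=> [[[? ?]|[[? ?] ->]]|[[? ?] /negP]]; [by case: ifP; tauto|by left|].
  by rewrite -ltNge => /ltW ->; right.
have m12 : measurable (A1 `|` A2 : set BE) by exact: measurableU.
split; first by rewrite e2; apply: measurableU.
have d1 : [disjoint A1 `|` A2 & sigma @^-1` A3].
  by apply/disj_setPS => z [[]]; rewrite /A1 /A2 /A3 /= sK; tauto.
have d2 : [disjoint A1 `|` A2 & A3].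
  by apply/disj_setPS => z [[]]; rewrite /A1 /A2 /A3 /=; tauto.
move/eqP in d1; move/eqP in d2.
rewrite e2 [in RHS]e1 measureU// [RHS]measureU//.
by congr (_ + _)%E; exact: mu_refl.
Qed.

Lemma polar_gt (f : E -> R) t : [set z | t < polar f z] = polar_set [set z | t < f z].
Proof.
apply/seteqP; split => z; rewrite /polar_set /polar /=; case: ifP => _;
  rewrite ?lt_max ?lt_min.
- by move=> /orP.
- by move=> /andP.
- by move=> /orP.
- by move=> /andP.
Qed.

Lemma polar_ge (f : E -> R) t : [set z | t <= polar f z] = polar_set [set z | t <= f z].
Proof.
apply/seteqP; split => z; rewrite /polar_set /polar /=; case: ifP => _;
  rewrite ?le_max ?le_min.
- by move=> /orP.
- by move=> /andP.
- by move=> /orP.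
- by move=> /andP.
Qed.

(** For [u] in the polarized set and [z] in the polarized dual, the bound is known for [(u, z)] or
    for both points reflected, except when both lie on the side of [x]. There the known pair may
    have one point reflected, and by [refl_le] the pair [(u, z)] is no farther apart. *)
Lemma polar_dual_of rho (S : set E) : S `<=` M ->
  polar_set (dual_of g rho S) `<=` dual_of g rho (polar_set S).
Proof.
move=> SM z pz.
have Mz : M z by move: pz; rewrite /polar_set/=; case: ifP => _; [move=> [[]//|[/Ms]//]|move=> [[]]].
split => // u pu.
have Mu : M u.
  by move: pu; rewrite /polar_set/=; case: ifP => _; [move=> [/SM//|/SM/Ms//]|move=> [/SM]].
have duv v : dual_of g rho S v -> forall u', S u' -> D u' v <= rho by case.
have le_hh : 0 <= h u -> 0 <= h z -> D u z <= D u (sigma z).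
  by move=> hu hz; apply: refl_le => //; exact: mulr_ge0.
move: pu pz; rewrite /polar_set /=; case: ifPn => hu; case: ifPn => hz.
- have le := le_hh hu hz.
  move=> [Su|Su] [/duv dz|/duv dz].
  + exact: dz.
  + exact: le_trans le (dz _ Su).
  + by apply: le_trans le _; rewrite -Dsl//; exact: dz.
  + by rewrite -Dss//; exact: dz.
- move=> [Su|Su] [/duv dz /duv dz']; first exact: dz.
  by rewrite -Dss//; exact: dz'.
- move=> [Su Su'] [/duv dz|/duv dz]; first exact: dz.
  by rewrite -Dss//; exact: dz.
- by move=> [Su Su'] [/duv dz _]; exact: dz.
Qed.

(* The modulus is measured by [D] rather than by the norm because [D] is what the
   reflections preserve. *)
Lemma polar_modulus (f : E -> R) e del :
  (forall z z', M z -> M z' -> D z z' < del -> `|f z - f z'| <= e) ->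
  forall z z', M z -> M z' -> D z z' < del -> `|polar f z - polar f z'| <= e.
Proof.
move=> H z z' Mz Mz' zz'.
have Msz := (Ms z).2 Mz; have Msz' := (Ms z').2 Mz'.
have := H z z' Mz Mz' zz'.
have : `|f (sigma z) - f (sigma z')| <= e by apply: H; rewrite ?Dss.
(* For points on opposite sides, reflecting one of them does not increase the distance, so the
   crossed differences obey the same modulus. *)
have cross : h z * h z' <= 0 -> `|f z - f (sigma z')| <= e /\ `|f (sigma z) - f z'| <= e.
  move=> hh; have zz : D z (sigma z') <= D z z'.
    by rewrite sqdist_refl_r// gerDl pmulr_lle0// invr_gt0.
  by split; apply: H => //; rewrite ?Dsl//; exact: le_lt_trans zz zz'.
set a := f z in cross *; set b := f (sigma z) in cross *.
set a' := f z' in cross *; set b' := f (sigma z') in cross *.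
rewrite /polar -/a -/b -/a' -/b' !ler_norml => /andP[q1 q2] /andP[q3 q4].
case: ifPn => hz; case: ifPn => hz'.
- by rewrite /Num.max; case: ltP => ?; case: ltP => ?; apply/andP; split; lra.
- have [|] := cross _; first by rewrite mulr_ge0_le0// ltW// ltNge.
  rewrite !ler_norml => /andP[q5 q6] /andP[q7 q8].
  by rewrite /Num.max /Num.min; case: ltP => ?; case: ltP => ?; apply/andP; split; lra.
- have [|] := cross _; first by rewrite mulr_le0_ge0// ltW// ltNge.
  rewrite !ler_norml => /andP[q5 q6] /andP[q7 q8].
  by rewrite /Num.max /Num.min; case: ltP => ?; case: ltP => ?; apply/andP; split; lra.
- by rewrite /Num.min; case: ltP => ?; case: ltP => ?; apply/andP; split; lra.
Qed.

End TwoPoint.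

End Polarization.

(** Here [a], [b] are the values at a point and its mirror image, [u], [v] the squared distances to
    [p], and [k] the side of the point. Polarization keeps or exchanges the two values, and an
    exchange gains [|a - b| * |v - u|]. *)
Lemma rearrangement_gain (R : realType) (a b u v k : R) :
  (0 < k -> u <= v) -> (k < 0 -> v <= u) -> (k = 0 -> b = a) ->
  a * u + b * v -
    ((if 0 <= k then Num.max a b else Num.min a b) * u +
     (if k <= 0 then Num.max b a else Num.min b a) * v) =
  `|a - (if 0 <= k then Num.max a b else Num.min a b)| * `|v - u|.
Proof.
move=> H1 H2 H3; have [k0|k0|k0] := ltgtP k 0.
- have uv := H2 k0; rewrite (ler0_norm (_ : v - u <= 0)) ?subr_le0//.
  have [ab|ab] := leP a b; first by rewrite (subrr a) normr0; ring.
  by rewrite gtr0_norm ?subr_gt0//; ring.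
- have uv := H1 k0; rewrite (ger0_norm (_ : 0 <= v - u)) ?subr_ge0//.
  have [ab|ab] := leP a b; last by rewrite (subrr a) normr0; ring.
  by rewrite ler0_norm ?subr_le0//; ring.
- by rewrite (H3 k0) maxxx (subrr a) normr0; ring.
Qed.

Section Competitors.
Context {R : realType}.
Variables (g : geometry) (d : nat).
Local Notation E := (@ambient R d).
Local Notation M := (@space_form R g d).
Local Notation BE := (g_sigma_algebraType (@open E)).
Local Notation D := (@sqdist R g d).
Variable mu : {measure set BE -> \bar R}.
Hypothesis mu_refl : forall x y, M x -> M y -> x <> y ->
  forall S : set BE, measurable S -> mu (refl g x y @^-1` S) = mu S.
Hypothesis mu_open : forall (U : set E) x, open U -> M x -> U x -> (0 < mu U)%E.
Hypothesis mu_compact : forall S : set BE, compact (S : set E) -> S `<=` M -> (mu S < +oo)%E.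
Hypothesis mu_M : forall S : set BE, mu S = mu (S `&` M).
Variables (p : E) (T : R) (del : R -> R) (rho : R) (a c : \bar R).
Hypotheses (Mp : M p) (del_gt0 : forall e, 0 < e -> 0 < del e).

(** Each field survives polarization towards [p] and uniform limits. The ball carrying the supports
    is centred at [p] because such polarizations bring mass closer to [p]; the modulus is a weak
    inequality so that it passes to limits. *)
Record competitor (f : E -> R) : Prop := Competitor {
  competitor_range : forall z, 0 <= f z <= 1;
  competitor_modulus : forall e, 0 < e -> forall z z', M z -> M z' ->
    D z z' < del e -> `|f z - f z'| <= e;
  competitor_supp : forall z, 0 < f z -> M z /\ D p z <= T;
  competitor_level : (a <= mu [set z | 1 <= f z]%R)%E;
  competitor_dual : (c <= mu (dual_of g rho [set z | 0 < f z]%R))%E }.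

Lemma modulus_within_continuous (f : E -> R) :
  (forall e, 0 < e -> forall z z', M z -> M z' -> D z z' < del e -> `|f z - f z'| <= e) ->
  {within M, continuous f}.
Proof.
move=> fmod; apply/subspace_continuousP => z Mz; apply/cvgrPdist_le => e e0.
have nz := sqdist_ball_nbhs Mz (del_gt0 e0).
by rewrite /within/=; near_simpl; apply: filterS nz => z' zz' Mz'; exact: fmod e0 _ _ Mz Mz' zz'.
Qed.

Lemma measurable_competitor f : competitor f -> measurable_fun setT (f : BE -> R).
Proof.
move=> [f01 fmod fsupp _ _].
have mM : measurable (M : set BE) by apply: closed_measurable_ambient; exact: closed_space_form.
rewrite (_ : f = f \_ (M : set BE)).
  apply/(measurable_restrictT _ mM).
  apply: within_continuous_measurable_ambient; first exact: closed_space_form.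
  exact: modulus_within_continuous.
apply/funext => z; rewrite patchE; case: ifPn => // /negP zM.
apply/eqP; rewrite eq_le; have /andP[-> _] := f01 z; rewrite andbT leNgt.
by apply/negP => /fsupp[Mz _]; apply: zM; rewrite inE.
Qed.

Let measurable_level f t : competitor f -> measurable ([set z | t <= f z] : set BE).
Proof.
move=> /measurable_competitor mf; apply: measurable_set_bool.
exact: measurable_fun_ler.
Qed.

Lemma competitor_out f z : competitor f -> ~ M z -> f z = 0.
Proof.
move=> [f01 _ fs _ _] zM; apply/eqP; rewrite eq_le; have /andP[-> _] := f01 z.
by rewrite andbT leNgt; apply/negP => /fs[].
Qed.

Let supp_M f : competitor f -> [set z | 0 < f z] `<=` M.
Proof. by move=> [_ _ fs _ _] z /fs[]. Qed.

Lemma competitor_polar x y f : M x -> M y -> x <> y -> 0 <= side g x y p ->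
  competitor f -> competitor (polar g x y f).
Proof.
move=> Mx My xy hp cf; have [f01 fmod fsupp flev fdual] := cf.
split.
- move=> z; rewrite /polar; have /andP[? ?] := f01 z; have /andP[? ?] := f01 (refl g x y z).
  by case: ifP => _; rewrite /Num.max /Num.min; case: ltP => _; apply/andP.
- by move=> e e0; apply: (polar_modulus Mx My xy); exact: fmod.
- move=> z; rewrite /polar; case: ifPn => hz.
    rewrite lt_max => /orP[/fsupp//|/fsupp[Mr DT]].
    have Mz : M z by rewrite -(reflK Mx My xy z); exact: space_form_refl.
    split=> //; apply: le_trans DT; apply: refl_le => //; exact: mulr_ge0.
  by rewrite lt_min => /andP[/fsupp].
- rewrite polar_ge.
  by have [_ ->] := measure_polar_set mu_refl Mx My xy (measurable_level 1 cf).
- rewrite polar_gt; apply: (le_trans fdual).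
  have md : measurable (dual_of g rho [set z | 0 < f z] : set BE).
    by apply: closed_measurable_ambient; exact: closed_dual_of.
  have [mp <-] := measure_polar_set mu_refl Mx My xy md.
  apply: le_measure; rewrite ?inE//.
    by apply: closed_measurable_ambient; exact: closed_dual_of.
  by apply: polar_dual_of => //; exact: supp_M.
Qed.

Definition moment (f : E -> R) : \bar R := (\int[mu]_z (f z * D p z)%:E)%E.

Lemma moment_integrand_ge0 f : competitor f -> forall z, 0 <= f z * D p z.
Proof.
move=> [f01 _ fs _ _] z; have /andP[f0 _] := f01 z.
move: f0; rewrite le_eqVlt => /orP[/eqP <-|f0]; first by rewrite mul0r.
by apply: mulr_ge0; [exact: ltW|have [Mz _] := fs z f0; exact: sqdist_ge0].
Qed.

Let measurable_D : measurable_fun setT (D p : BE -> R).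
Proof. by apply: continuous_measurable_ambient; exact: continuous_sqdist. Qed.

Lemma measurable_moment_integrand f : competitor f ->
  measurable_fun setT (fun z : BE => (f z * D p z)%:E).
Proof.
by move=> /measurable_competitor mf; apply/measurable_EFinP; exact: measurable_funM.
Qed.

Let Om : set BE := [set z | M z /\ D p z <= T].

Let measurable_Om : measurable Om.
Proof.
by apply: closed_measurable_ambient; apply: compact_closed => //; exact: compact_sqdist_le.
Qed.

Let mu_Om : (mu Om < +oo)%E.
Proof. by apply: mu_compact; [exact: compact_sqdist_le|move=> z []]. Qed.

Lemma moment_ge0 f : competitor f -> (0 <= moment f)%E.
Proof. by move=> cf; apply: integral_ge0 => z _; rewrite lee_fin; exact: moment_integrand_ge0. Qed.

Lemma moment_lty f : competitor f -> (moment f < +oo)%E.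
Proof.
move=> cf; have [f01 _ fs _ _] := cf.
apply: (@le_lt_trans _ _ (\int[mu]_(z in Om) `|T|%:E)%E).
  rewrite [leRHS]integral_mkcond; apply: ge0_le_integral => //.
  - by move=> z _; rewrite lee_fin; exact: moment_integrand_ge0.
  - exact: measurable_moment_integrand.
  - by apply/(measurable_restrictT _ measurable_Om).
  move=> z _; rewrite patchE; case: ifPn => [|/negP zO].
    rewrite inE => -[Mz Dz]; rewrite lee_fin; have /andP[f0 f1] := f01 z.
    by apply: le_trans (ler_pM f0 (sqdist_ge0 Mp Mz) f1 Dz) _; rewrite mul1r ler_norm.
  rewrite lee_fin (_ : f z = 0) ?mul0r//.
  apply/eqP; rewrite eq_le; have /andP[-> _] := f01 z; rewrite andbT leNgt.
  by apply/negP => /fs[Mz Dz]; apply: zO; rewrite inE.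
rewrite integral_cst//; apply: lte_mul_pinfty => //.
Qed.

(** By invariance of [mu], twice the moment is the integral of the sum over [z] and [sigma z]. The
    loss [H] of this sum is nonnegative by [rearrangement_gain] and at least [eta] on a
    neighbourhood of [x] in the space. *)
Lemma moment_polar_lt x y f : M x -> M y -> D p x < D p y -> f x < f y ->
  competitor f -> (moment (polar g x y f) < moment f)%E.
Proof.
move=> Mx My pxy fxy cf; have [f01 fmod fs _ _] := cf.
have xy : x <> y by move=> e; move: pxy; rewrite e ltxx.
pose s := refl g x y; pose h := side g x y.
have hp : 0 < h p by rewrite /h sideE// subr_gt0.
have cpf : competitor (polar g x y f) by apply: competitor_polar => //; exact: ltW.
have W0 := sqdist_gt0 Mx My xy.
have Dps z : M z -> D p (s z) = D p z + h p * h z / D x y by move=> Mz; exact: sqdist_refl_r.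
pose Fe u (z : BE) : \bar R := (u z * D p z)%:E.
have doubled u : competitor u -> (\int[mu]_z (Fe u z + Fe u (s z)) = moment u + moment u)%E.
  move=> cu; have mFu := measurable_moment_integrand cu.
  have F0 z : (0 <= Fe u z)%E by rewrite lee_fin; exact: moment_integrand_ge0.
  have mFs : measurable_fun setT (fun z : BE => Fe u (s z)).
    by apply: (measurableT_comp mFu); exact: measurable_refl.
  rewrite (ge0_integralD mu measurableT (fun z _ => F0 z) mFu (fun z _ => F0 (s z)) mFs).
  congr (_ + _)%E.
  apply: (ge0_integral_invariant (measurable_refl g x y)) => //.
  by move=> A mA; exact: mu_refl.
have key : (moment (polar g x y f) + moment (polar g x y f) < moment f + moment f)%E.
  pose H z := (f z * D p z + f (s z) * D p (s z)) -
    (polar g x y f z * D p z + polar g x y f (s z) * D p (s z)).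
  have HE z : H z = if `[< M z >] then
      `|f z - polar g x y f z| * `|D p (s z) - D p z| else 0.
    case: asboolP => Mz; last first.
      have Msz : ~ M (s z).
        by move=> /(space_form_refl Mx My xy); rewrite reflK.
      rewrite /H /polar reflK// (competitor_out cf Mz) (competitor_out cf Msz).
      by rewrite maxxx minxx !if_same; ring.
    have szz : s (s z) = z by exact: reflK.
    have hs : h (s z) = - h z by exact: side_refl.
    rewrite /H /polar -/s -/h szz hs Dps// oppr_ge0.
    have hp_pos : 0 < h p / D x y by rewrite divr_gt0.
    apply: rearrangement_gain.
    + by move=> hz; rewrite lerDl mulrAC mulr_ge0 ?ltW.
    + by move=> hz; rewrite gerDl mulrAC pmulr_rle0 ?ltW.
    + by move=> hz; rewrite /s /refl -/h hz mul0r scale0r subr0.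
  have H0 z : 0 <= H z by rewrite HE; case: ifP => // _; exact: mulr_ge0.
  have ms : measurable_fun setT (s : BE -> BE) by exact: measurable_refl.
  have mHH : measurable_fun setT (H : BE -> R).
    have m1 := measurable_competitor cf; have m2 := measurable_competitor cpf.
    have m1s := measurableT_comp m1 ms; have m2s := measurableT_comp m2 ms.
    have mDs := measurableT_comp measurable_D ms.
    by apply: measurable_funB; apply: measurable_funD; apply: measurable_funM.
  have IH : (0 < \int[mu]_z (H z)%:E)%E.
    (* Replacing [x] and [y] by [z] and [s z] costs at most [e] each and leaves a gap of at least
       [e]. *)
    pose e := (f y - f x) / 3; have e0 : 0 < e by rewrite divr_gt0// subr_gt0.
    have hx : 0 < h x by rewrite /h sideE// sqdistxx subr0.
    (* The gap [e] of the values times a lower bound for [D p (s z) - D p z = h p * h z / D x y],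
       with [h z] above half of [h x]. *)
    pose eta := e * (h p * (h x / 2) / D x y).
    have eta0 : 0 < eta by rewrite mulr_gt0// divr_gt0// mulr_gt0// divr_gt0.
    pose U := [set z | D x z < del e] `&` [set z | h x / 2 < h z].
    have oU : open U.
      apply: openI.
        by apply: (open_comp (fun z _ => @continuous_sqdist R g d x z) (@open_lt _ (del e))).
      by apply: (open_comp (fun z _ => @continuous_side R g d x y z) (@open_gt _ (h x / 2))).
    have mU : measurable (U : set BE) by exact: open_measurable_ambient.
    have mM : measurable (M : set BE) by apply: closed_measurable_ambient; exact: closed_space_form.
    have mUM : measurable (U `&` M : set BE) by exact: measurableI.
    have Ux : U x.
      split; first by rewrite /= sqdistxx del_gt0.
      by rewrite /= ltr_pdivrMr// ltr_pMr// ltr1n.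
    have muU : (0 < mu (U `&` M))%E by rewrite -mu_M; exact: mu_open oU Mx Ux.
    apply: (@lt_le_trans _ _ (\int[mu]_(z in U `&` M) eta%:E)%E).
      by rewrite integral_cst// mule_gt0.
    rewrite integral_mkcond; apply: ge0_le_integral => //.
    - by move=> z _; rewrite patchE; case: ifP => // _; rewrite lee_fin ltW.
    - by apply/(measurable_restrictT _ mUM).
    - exact/measurable_EFinP.
    move=> z _; rewrite patchE; case: ifPn => [|_]; last by rewrite lee_fin.
    rewrite inE => -[[/= Dxz hz] Mz]; rewrite lee_fin HE asboolT//.
    have hz0 : 0 < h z by apply: lt_trans hz; rewrite divr_gt0.
    have f1 := fmod e e0 x z Mx Mz Dxz.
    have f2 : `|f y - f (s z)| <= e.
      rewrite -(refl_l Mx My xy); apply: fmod => //; try exact: space_form_refl.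
      by rewrite sqdist_refl.
    have f3 : e <= f (s z) - f z.
      have fe : f y - f x = 3 * e by rewrite /e; field.
      by move: f1 f2; rewrite !ler_norml => /andP[? ?] /andP[? ?]; lra.
    rewrite /polar -/h (ltW hz0) -/s max_r; last by lra.
    rewrite distrC ger0_norm; last by lra.
    rewrite Dps// addrAC subrr add0r gtr0_norm; last by rewrite divr_gt0// mulr_gt0.
    rewrite /eta; apply: ler_pM => //; first exact: ltW.
      by rewrite divr_ge0 ?mulr_ge0 ?divr_ge0// ltW.
    by rewrite ler_pM2r ?invr_gt0// ler_pM2l// ltW.
  rewrite -(doubled _ cf).
  have -> : (\int[mu]_z (Fe f z + Fe f (s z)) =
     \int[mu]_z ((Fe (polar g x y f) z + Fe (polar g x y f) (s z)) + (H z)%:E))%E.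
    apply: eq_integral => z _; rewrite /Fe /H -!EFinD; congr EFin; ring.
  have mP := measurable_moment_integrand cpf.
  have mPs := measurableT_comp mP ms.
  have F0 z : (0 <= Fe (polar g x y f) z + Fe (polar g x y f) (s z))%E.
    by apply: adde_ge0; rewrite lee_fin; exact: moment_integrand_ge0.
  have H0' z : (0 <= (H z)%:E)%E by rewrite lee_fin.
  have mF := emeasurable_funD mP mPs.
  have mHE : measurable_fun setT (fun z : BE => (H z)%:E) by exact/measurable_EFinP.
  rewrite (ge0_integralD mu measurableT (fun z _ => F0 z) mF (fun z _ => H0' z) mHE).
  rewrite (doubled _ cpf) lteDl// fin_numD.
  by rewrite ge0_fin_numE ?moment_ge0// moment_lty.
have fin1 : moment f \is a fin_num by rewrite ge0_fin_numE ?moment_ge0// moment_lty.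
have fin2 : moment (polar g x y f) \is a fin_num by rewrite ge0_fin_numE ?moment_ge0// moment_lty.
by move: key; rewrite -(fineK fin1) -(fineK fin2) -!EFinD !lte_fin; lra.
Qed.

End Competitors.

(** * Minimising the moment *)

Section Minimizer.
Context {R : realType}.
Variables (g : geometry) (d : nat).
Local Notation E := (@ambient R d).
Local Notation M := (@space_form R g d).
Local Notation BE := (g_sigma_algebraType (@open E)).
Local Notation D := (@sqdist R g d).
Variable mu : {measure set BE -> \bar R}.
Hypothesis mu_refl : forall x y, M x -> M y -> x <> y ->
  forall S : set BE, measurable S -> mu (refl g x y @^-1` S) = mu S.
Hypothesis mu_open : forall (U : set E) x, open U -> M x -> U x -> (0 < mu U)%E.
Hypothesis mu_compact : forall S : set BE, compact (S : set E) -> S `<=` M -> (mu S < +oo)%E.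
Hypothesis mu_M : forall S : set BE, mu S = mu (S `&` M).
Variables (p : E) (T : R) (del : R -> R) (rho : R) (a c : \bar R).
Hypotheses (Mp : M p) (del_gt0 : forall e, 0 < e -> 0 < del e) (a_gt0 : (0 < a)%E).
Local Notation competitor := (competitor g mu p T del rho a c).
Local Notation moment := (moment g mu p).
Local Notation Om := [set z : E | M z /\ D p z <= T].

(* Along an ultrafilter the limit exists pointwise, and the common modulus makes the
   convergence uniform on the compact set that carries all supports. *)
Lemma competitor_limit (f_ : nat -> E -> R) : (forall n, competitor (f_ n)) ->
  exists2 f, competitor f & forall (e : R) N, 0 < e -> exists2 n, (N <= n)%N &
    forall z, `|f_ n z - f z| <= e.
Proof.
move=> cf; have cOm : compact Om by exact: compact_sqdist_le.
have [U [UU NU]] := ultraFilterLemma eventually_filter.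
have PU : ProperFilter U by exact: ultra_proper.
have /choice[f hf] : forall z, exists l : R, `[0, 1]%classic l /\ f_ ^~ z @ U --> l.
  move=> z; have := @segment_compact R 0 1; rewrite compact_ultra => /(_ (f_ ^~ z @ U)).
  case; first exact: ultra_fmap.
    have : U [set n | `[0, 1]%classic (f_ n z)].
      by apply: filterE => n; rewrite /= in_itv/=; have [+ _ _ _ _] := cf n; exact.
    by [].
  by move=> l [l01 ul]; exists l.
have f01 z : 0 <= f z <= 1 by have [+ _] := hf z; rewrite /= in_itv.
have cvf z : f_ ^~ z @ U --> f z by have [] := hf z.
have fmod e : 0 < e -> forall z z', M z -> M z' -> D z z' < del e -> `|f z - f z'| <= e.
  move=> e0 z z' Mz Mz' zz'.
  have cvd : (fun n => `|f_ n z - f_ n z'|) @ U --> `|f z - f z'|.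
    by apply: cvg_norm; exact: cvgB.
  apply: (@closed_cvg _ _ U _ _ [set t | t <= e] (closed_le (y := e)) _ _ cvd).
  apply: filterE => n /=; have [_ + _ _ _] := cf n; exact.
have fsupp z : 0 < f z -> M z /\ D p z <= T.
  move=> fz; have nz : \forall n \near U, 0 < f_ n z by exact: cvgr_gt (cvf z) _ fz.
  have [n fn] := filter_ex nz.
  by have [_ _ + _ _] := cf n; apply.
have out z : ~ Om z -> f z = 0 /\ forall n, f_ n z = 0.
  have zero (u : E -> R) : (forall t, 0 <= u t <= 1) -> (forall t, 0 < u t -> M t /\ D p t <= T) ->
      ~ Om z -> u z = 0.
    move=> u01 us zO; apply/eqP; rewrite eq_le; have /andP[-> _] := u01 z; rewrite andbT leNgt.
    by apply/negP => /us[Mz Dz]; apply: zO.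
  move=> zO; split; first exact: zero.
  by move=> n; have [u01 _ us _ _] := cf n; exact: zero.
have unif e N : 0 < e -> exists2 n, (N <= n)%N & forall z, `|f_ n z - f z| <= e.
  move=> e0; have e3 : 0 < e / 3 by rewrite divr_gt0.
  have /compact_near_coveringP near := cOm.
  have H : forall x : E, Om x -> \forall x' \near x & i \near U, M x' -> `|f_ i x' - f x'| <= e.
    move=> x [Mx _].
    (* Three errors of [e / 3]: the moduli of [f_ n] and of [f], and the convergence at [x]. *)
    exists ([set x' | D x x' < del (e / 3)], [set n | `|f x - f_ n x| <= e / 3]).
      split; first exact: sqdist_ball_nbhs (del_gt0 e3).
      exact: cvgr_dist_le (cvf x) _ e3.
    move=> [x' n] [/= Dx fn] Mx'.
    have [_ /(_ _ e3 x x' Mx Mx' Dx) h1 _ _ _] := cf n.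
    have h2 := fmod _ e3 x x' Mx Mx' Dx.
    move: h1 h2 fn; rewrite !ler_norml => /andP[? ?] /andP[? ?] /andP[? ?].
    by apply/andP; split; lra.
  have nU : U [set n | Om `<=` [set z | M z -> `|f_ n z - f z| <= e]].
    exact: (near nat U (fun n z => M z -> `|f_ n z - f z| <= e) _ H).
  have nN : U [set n | (N <= n)%N] by apply: NU; exact: nbhs_infty_ge.
  have nUN : U ([set n | Om `<=` [set z | M z -> `|f_ n z - f z| <= e]] `&` [set n | (N <= n)%N]).
    exact: filterI nU nN.
  have [n [nO Nn]] := filter_ex nUN.
  exists n => // z; have [zO|zO] := pselect (Om z); first by apply: nO => //; case: zO.
  by have [-> ->] := out z zO; rewrite subrr normr0 ltW.
exists f => //.
have mM : measurable (M : set BE) by apply: closed_measurable_ambient; exact: closed_space_form.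
have mf : measurable_fun setT (f : BE -> R).
  rewrite (_ : f = f \_ (M : set BE)).
    apply/(measurable_restrictT _ mM).
    apply: within_continuous_measurable_ambient; first exact: closed_space_form.
    exact: modulus_within_continuous fmod.
  apply/funext => z; rewrite patchE; case: ifPn => // /negP zM.
  have zO : ~ Om z by move=> [Mz _]; apply: zM; rewrite inE.
  by have [-> _] := out z zO.
have mOm : measurable (Om : set BE).
  by apply: closed_measurable_ambient; exact: compact_closed.
have inv_gt0 n : 0 < n.+2%:R^-1 :> R by rewrite invr_gt0.
have inv_lt1 n : n.+2%:R^-1 < 1 :> R by rewrite invf_lt1// ltr1n.
have inv_le n m : (n <= m)%N -> m.+2%:R^-1 <= n.+2%:R^-1 :> R.
  by move=> nm; rewrite lef_pV2 ?posrE// ler_nat !ltnS.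
have arch (e : R) : 0 < e -> exists n : nat, n.+2%:R^-1 < e.
  move=> e0; exists (Num.truncn e^-1).
  rewrite -[ltRHS]invrK ltf_pV2 ?posrE ?invr_gt0//.
  by apply: lt_trans (truncnS_gt _) _; rewrite ltr_nat.
have flev : (a <= mu [set z | 1 <= f z]%R)%E.
  (* With [n.+2] the level is positive already for [n = 0], so [F 0] lies in the common support and
     has finite measure. *)
  pose F n : set BE := [set z | 1 - n.+2%:R^-1 <= f z].
  have mF n : measurable (F n).
    by apply: measurable_set_bool; exact: measurable_fun_ler.
  have FE : [set z | 1 <= f z]%R = \bigcap_n F n.
    apply/seteqP; split => z /=.
      by move=> fz n _; rewrite /F/=; apply: le_trans fz; rewrite gerBl ltW.
    move=> Fz; rewrite leNgt; apply/negP => fz.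
    have [n nf] := arch (1 - f z) (ltac:(by rewrite subr_gt0)).
    have Fn : 1 - n.+2%:R^-1 <= f z := Fz n I.
    by move: Fn; rewrite leNgt ltrBrDr -ltrBrDl nf.
  have F0 : (mu (F 0%N) < +oo)%E.
    apply: (@le_lt_trans _ _ (mu Om)); last by apply: mu_compact => // z [].
    apply: le_measure; rewrite ?inE// => z; rewrite /F/= => fz.
    by apply: fsupp; apply: lt_le_trans fz; rewrite subr_gt0.
  rewrite FE; apply: measure_bigcap_ge => // [n m nm z|n].
    by rewrite /F/=; apply: le_trans; rewrite lerD2l lerN2 inv_le.
  have [k _ uk] := unif _ 0%N (inv_gt0 n).
  have [_ _ _ lev _] := cf k; apply: (le_trans lev).
  have mfk := measurable_competitor del_gt0 (cf k).
  apply: le_measure; rewrite ?inE//; first by apply: measurable_set_bool; exact: measurable_fun_ler.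
  move=> z /= fz; rewrite /F/=; have := uk z; rewrite ler_norml => /andP[_ h].
  by rewrite lerBlDr; apply: (le_trans fz); rewrite -lerBlDl.
split => //.
  (* Such a point exists because [a > 0]; it confines the dual sets below to a compact ball around
     it. *)
  have [x0 fx0] : exists x0, 1 <= f x0.
    apply: contrapT => nx; move: flev; rewrite (_ : [set z | _] = set0).
      by rewrite measure0 leNgt a_gt0.
    by apply/seteqP; split => // z fz; apply: nx; exists z.
  (* With [n.+2] the level is below 1 already for [n = 0], so that [x0] is among the points defining
     [F 0]. *)
  pose F n : set BE := dual_of g rho [set z | n.+2%:R^-1 < f z]%R.
  have mF n : measurable (F n).
    by apply: closed_measurable_ambient; exact: closed_dual_of.
  have FE : dual_of g rho [set z | 0 < f z]%R = \bigcap_n F n.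
    apply/seteqP; split => z.
      by move=> [Mz fz] n _; split => // u /= fu; apply: fz; exact: lt_trans fu.
    move=> Fz; split; first by have [] := Fz 0%N I.
    by move=> u /= /arch[n nf]; have [_] := Fz n I; apply.
  have F0 : (mu (F 0%N) < +oo)%E.
    have Mx0 : M x0 by have [] := fsupp x0; first exact: lt_le_trans fx0.
    have cK : compact [set z | M z /\ D x0 z <= rho] by exact: compact_sqdist_le.
    apply: (@le_lt_trans _ _ (mu [set z | M z /\ D x0 z <= rho])); last by apply: mu_compact => // z [].
    apply: le_measure; rewrite ?inE//.
      by apply: closed_measurable_ambient; exact: compact_closed.
    move=> z [Mz /(_ x0) Fz]; split => //; apply: Fz => /=.
    by apply: lt_le_trans fx0.
  rewrite FE; apply: measure_bigcap_ge => // [n m nm z [Mz Fz]|n].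
    by split => // u /= fu; apply: Fz => /=; exact: le_lt_trans (inv_le _ _ nm) fu.
  have [k _ uk] := unif _ 0%N (inv_gt0 n).
  have [_ _ _ _ dua] := cf k; apply: (le_trans dua).
  apply: le_measure; rewrite ?inE//.
    by apply: closed_measurable_ambient; exact: closed_dual_of.
  move=> z [Mz Fz]; split => // u /= fu; apply: Fz => /=.
  have := uk u; rewrite distrC ler_norml => /andP[_ h].
  by rewrite -(ltrDl n.+2%:R^-1); apply: (lt_le_trans fu); rewrite -lerBlDr.
Qed.

(** The limit of a minimising sequence is a minimiser: convergence is uniform, and the weight [D p]
    is bounded on the common support, which has finite measure. *)
Lemma competitor_radial f0 : competitor f0 ->
  exists2 f, competitor f & forall x y, M x -> M y -> D p x < D p y -> f y <= f x.
Proof.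
move=> cf0; pose S := [set moment f | f in [set f | competitor f]].
have mom_fin f : competitor f -> moment f \is a fin_num.
  move=> cf; rewrite ge0_fin_numE; last exact: (moment_ge0 Mp cf).
  exact: (moment_lty mu_compact Mp del_gt0 cf).
have S0 : (0 <= ereal_inf S)%E.
  by apply/ereal_infP => _ [f cf <-]; exact: (moment_ge0 Mp cf).
have Sfin : ereal_inf S \is a fin_num.
  rewrite ge0_fin_numE//; apply: (@le_lt_trans _ _ (moment f0)); last exact: (moment_lty mu_compact Mp del_gt0 cf0).
  by apply: ereal_inf_lbound; exists f0.
have /choice[f_ hf] : forall n : nat, exists f, competitor f /\ (moment f < ereal_inf S + n.+1%:R^-1%:E)%E.
  move=> n; have [_ [f cf <-] lef] := lb_ereal_inf_adherent (ltac:(by rewrite invr_gt0) : 0 < n.+1%:R^-1) Sfin.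
  by exists f.
have [f cf unif] := competitor_limit (fun n => (hf n).1).
have [f01 _ fs _ _] := cf.
have fmin : (moment f <= ereal_inf S)%E.
  apply/lee_addgt0Pr => e e0.
  (* A uniform change by [e / 2 / k] alters the moment by at most [e / 2]; the summand 1 keeps [k]
     positive. The other [e / 2] absorbs the excess of [f_ n] over the infimum. *)
  pose m := fine (mu Om); pose k := `|T| * m + 1.
  have mOm : measurable (Om : set BE).
    by apply: closed_measurable_ambient; apply: compact_closed => //; exact: compact_sqdist_le.
  have muO : mu Om = m%:E.
    by rewrite fineK// ge0_fin_numE//; apply: mu_compact => [|z []//]; exact: compact_sqdist_le.
  have m0 : 0 <= m by rewrite -lee_fin -muO.
  have k0 : 0 < k by rewrite ltr_wpDl// mulr_ge0.
  have e' : 0 < e / 2 / k by rewrite divr_gt0// divr_gt0.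
  have [n0 n0e] : exists n0 : nat, n0.+1%:R^-1 < e / 2.
    exists (Num.truncn (e / 2)^-1).
    by rewrite -[ltRHS]invrK ltf_pV2 ?posrE ?invr_gt0 ?divr_gt0// truncnS_gt.
  have [n nn0 un] := unif _ n0 e'.
  have [cn ln] := hf n.
  have step : (moment f <= moment (f_ n) + (e / 2 / k * `|T| * m)%:E)%E.
    have -> : ((e / 2 / k * `|T| * m)%:E = \int[mu]_(z in Om) (e / 2 / k * `|T|)%:E)%E.
      by rewrite integral_cst// muO.
    rewrite [in leRHS]integral_mkcond /moment -ge0_integralD//; first last.
    - by apply/(measurable_restrictT _ mOm).
    - by move=> z _; rewrite patchE; case: ifP => // _; rewrite lee_fin mulr_ge0// ltW.
    - exact: (measurable_moment_integrand del_gt0 cn).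
    - by move=> z _; rewrite lee_fin; exact: (moment_integrand_ge0 Mp cn).
    apply: ge0_le_integral => //.
    - by move=> z _; rewrite lee_fin; exact: (moment_integrand_ge0 Mp cf).
    - exact: (measurable_moment_integrand del_gt0 cf).
    - apply: emeasurable_funD; first exact: (measurable_moment_integrand del_gt0 cn).
      by apply/(measurable_restrictT _ mOm).
    move=> z _; rewrite patchE; case: ifPn => [|/negP zO].
      rewrite inE => -[Mz Dz]; rewrite -EFinD lee_fin.
      have D0 := sqdist_ge0 Mp Mz.
      have := un z; rewrite distrC ler_norml => /andP[_]; rewrite lerBlDl => fz.
      apply: (le_trans (ler_wpM2r D0 fz)); rewrite mulrDl lerD2l.
      by apply: ler_wpM2l; [exact: ltW|exact: le_trans Dz (ler_norm _)].
    rewrite (_ : f z = 0) ?mul0r ?adde0 ?lee_fin; first exact: (moment_integrand_ge0 Mp cn).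
    apply/eqP; rewrite eq_le; have /andP[-> _] := f01 z; rewrite andbT leNgt.
    by apply/negP => /fs[Mz Dz]; apply: zO; rewrite inE.
  apply: (le_trans step); move: ln.
  rewrite -(fineK (mom_fin _ cn)) -(fineK Sfin) -!EFinD lte_fin lee_fin => ln.
  have nle : n.+1%:R^-1 <= n0.+1%:R^-1 :> R by rewrite lef_pV2 ?posrE// ler_nat ltnS.
  have kle : e / 2 / k * `|T| * m <= e / 2.
    by rewrite -mulrA -[leRHS](divfK (lt0r_neq0 k0)) ler_pM2l// lerDl.
  move: ln nle n0e kle; set u := n.+1%:R^-1; set v := n0.+1%:R^-1; set w := _ * m.
  by lra.
exists f => // x y Mx My pxy; rewrite leNgt; apply/negP => fxy.
have := moment_polar_lt mu_refl mu_open mu_compact mu_M Mp del_gt0 Mx My pxy fxy cf.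
apply/negP; rewrite -leNgt; apply: (le_trans fmin).
apply: ereal_inf_lbound; exists (polar g x y f) => //.
apply: competitor_polar => //; last by rewrite sideE// subr_ge0 ltW.
by move=> e; move: pxy; rewrite e ltxx.
Qed.

End Minimizer.

(** * From dual sets to competitors *)

Section Modulus.
Context {R : realType}.
Variables (g : geometry) (d : nat).
Local Notation E := (@ambient R d).
Local Notation M := (@space_form R g d).
Local Notation D := (@sqdist R g d).

(** The pairs of the compact set [Y] on which [f] differs by at least [e] have their [sqdist] in a
    compact set of reals that misses 0, so it misses a ball of some radius [r] around 0. *)
Lemma compact_support_modulus (f : E -> R) (K : set E) : continuous f -> compact K ->
  K `<=` M -> (forall z, M z -> f z <> 0 -> K z) ->
  exists del : R -> R, (forall e, 0 < e -> 0 < del e) /\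
    forall e, 0 < e -> forall z z', M z -> M z' -> D z z' < del e -> `|f z - f z'| <= e.
Proof.
move=> cf cK KM fK.
suff H e : exists del : R, 0 < e -> 0 < del /\
    forall z z', M z -> M z' -> D z z' < del -> `|f z - f z'| <= e.
  have [del hdel] := choice H.
  by exists del; split => e e0; have [] := hdel e e0.
have [e0|e0] := ltP 0 e; last by exists 0.
have [c Hc] := dual_bounded_compact 1 cK KM.
(* [Y] contains every point of the space with [sqdist] at most 1 from [K]; the minimum of 1 and [r]
   below therefore keeps the pair inside [Y] and out of [Z]. *)
pose Y := M `&` [set x : E | `|x.1| <= c /\ forall i, `|x.2 0 i| <= c].
have cY : compact Y.
  apply: (subclosed_compact _ (@compact_box R d c)); last by move=> z [].
  apply: closedI; first exact: closed_space_form.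
  by apply: compact_closed => //; exact: compact_box.
pose Z := (Y `*` Y) `&` [set q : E * E | e <= `|f q.1 - f q.2|].
have cZ : compact Z.
  apply: (subclosed_compact _ (compact_setX cY cY)); last by move=> z [].
  apply: closedI; first by apply: compact_closed => //; exact: compact_setX.
  apply: (@preimage_closed _ _ (fun q : E * E => `|f q.1 - f q.2|) [set t | e <= t]); last exact: closed_ge.
  move=> q _; apply: cvg_norm; apply: cvgB.
    by apply: (cvg_comp _ _ (_ : fst @ q --> q.1)); [exact: cvg_fst|exact: cf].
  by apply: (cvg_comp _ _ (_ : snd @ q --> q.2)); [exact: cvg_snd|exact: cf].
have cDZ : closed [set D q.1 q.2 | q in Z].
  apply: compact_closed => //; apply: continuous_compact => //.
  apply: continuous_subspaceT => q.
  by apply: cvg_sqdist; [exact: cvg_fst|exact: cvg_snd].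
have Z0 : ~ [set D q.1 q.2 | q in Z] 0.
  move=> [[x y] [[[Mx _] [My _]] /= exy]] /(sqdist_eq0 Mx My) /= xy.
  by move: exy; rewrite xy subrr normr0 leNgt e0.
have : open (~` [set D q.1 q.2 | q in Z]) by exact: closed_openC.
rewrite openE => /(_ _ Z0) /nbhs_ballP[r /= r0 rZ].
exists (Num.min 1 r) => _; split; first by rewrite lt_min ltr01.
have half z z' : M z -> M z' -> D z z' < Num.min 1 r -> f z <> 0 -> `|f z - f z'| <= e.
  rewrite lt_min => Mz Mz' /andP[zz1 zzr] fz; rewrite leNgt; apply/negP => ef.
  have Kz := fK z Mz fz.
  have Yz : Y z by split => //; apply: (Hc z) => //; rewrite sqdistxx ler01.
  have Yz' : Y z' by split => //; apply: (Hc z) => //; exact: ltW.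
  have : ball 0 r (D z z').
    by rewrite /ball/= sub0r normrN ger0_norm// sqdist_ge0.
  by move=> /rZ; apply; exists (z, z') => //; split => //=; exact: ltW.
move=> z z' Mz Mz' zz'; have [fz|/eqP fz] := eqVneq (f z) 0; last exact: half.
have [fz'|/eqP fz'] := eqVneq (f z') 0; first by rewrite fz fz' subrr normr0 ltW.
by rewrite distrC; apply: half => //; rewrite sqdistC.
Qed.

(** By compactness of [C], the values [D y z'] are close to [D y z] uniformly in [y] as [z'] tends
    to [z], so their suprema are close too. *)
Lemma cvg_sup_compact (C : set E) : compact C -> C !=set0 ->
  continuous (fun z => sup [set D y z | y in C]) /\
  forall z, ubound [set D y z | y in C] (sup [set D y z | y in C]).
Proof.
move=> cC C0; pose h z := sup [set D y z | y in C].
have ne z : [set D y z | y in C] !=set0 by have [y Cy] := C0; exists (D y z); exists y.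
have ub z : ubound [set D y z | y in C] (h z).
  have [|b Cb bmax] := @compact_EVT_max _ _ (fun y => D y z) C C0 cC.
    apply: continuous_subspaceT => y.
    by apply: cvg_sqdist; [exact: cvg_id|exact: cvg_cst].
  apply: ub_le_sup; exists (D b z) => _ [y Cy <-]; apply: bmax; exact/mem_set.
split => // z; apply/cvgrPdist_le => e e0.
have /compact_near_coveringP near := cC.
have H : forall y, C y -> \forall y' \near y & z' \near z, `|D y' z - D y' z'| <= e.
  move=> y Cy.
  have c1 : (fun q : E * E => D q.1 z - D q.1 q.2) @ nbhs (y, z) --> D y z - D y z.
    apply: cvgB; apply: cvg_sqdist.
    - exact: (@cvg_fst _ _ _ (nbhs z)).
    - exact: cvg_cst.
    - exact: (@cvg_fst _ _ _ (nbhs z)).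
    - exact: (@cvg_snd _ _ (nbhs y)).
  have c2 : \forall q \near nbhs (y, z), `|D y z - D y z - (D q.1 z - D q.1 q.2)| <= e.
    exact: cvgr_dist_le c1 _ e0.
  by apply: filterS c2 => -[y' z'] /=; rewrite (subrr (D y z)) sub0r normrN.
have nz := near _ (nbhs z) (fun z' y => `|D y z - D y z'| <= e) _ H.
near=> z'.
have Cz' : C `<=` [set y | `|D y z - D y z'| <= e] by near: z'; exact: nz.
rewrite ler_norml; apply/andP; split.
  rewrite lerBrDr addrC lerBlDr; apply: ge_sup => // _ [y Cy <-].
  have := Cz' y Cy; rewrite /= ler_norml => /andP[+ _]; rewrite lerBrDr addrC lerBlDr => /le_trans; apply.
  by rewrite lerD2r; apply: ub; exists y.
rewrite lerBlDr; apply: ge_sup => // _ [y Cy <-].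
have := Cz' y Cy; rewrite /= ler_norml => /andP[_]; rewrite lerBlDr => /le_trans; apply.
by rewrite lerD2l; apply: ub; exists y.
Unshelve. all: by end_near. Qed.

End Modulus.

Section DualMeasure.
Context {R : realType}.
Variables (g : geometry) (d : nat).
Local Notation E := (@ambient R d).
Local Notation M := (@space_form R g d).
Local Notation BE := (g_sigma_algebraType (@open E)).
Local Notation D := (@sqdist R g d).
Variable mu : {measure set BE -> \bar R}.
Hypothesis mu_refl : forall x y, M x -> M y -> x <> y ->
  forall S : set BE, measurable S -> mu (refl g x y @^-1` S) = mu S.
Hypothesis mu_open : forall (U : set E) x, open U -> M x -> U x -> (0 < mu U)%E.
Hypothesis mu_compact : forall S : set BE, compact (S : set E) -> S `<=` M -> (mu S < +oo)%E.
Hypothesis mu_M : forall S : set BE, mu S = mu (S `&` M).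

(** Let [h z] be the largest [sqdist] from [z] to the dual [C] of [A]. Then [A] lies in [h <= rho],
    and [C] lies in the [rho']-dual of [h < rho']. The ramp [F] from 1 at [h = rho] to 0 at
    [h = rho'] gives the competitor. *)
Lemma exists_competitor (A : set E) (rho rho' : R) (p : E) : compact A -> A `<=` M -> A !=set0 ->
  dual_of g rho A !=set0 -> rho < rho' -> M p ->
  exists T del f, (forall e, 0 < e -> 0 < del e) /\
    competitor g mu p T del rho' (mu A) (mu (dual_of g rho A)) f.
Proof.
move=> cA AM [a0 Aa0] C0 rr Mp.
pose C := dual_of g rho A; pose h z := sup [set D y z | y in C].
have CM : C `<=` M by move=> z [].
have cC : compact C.
  apply: (subclosed_compact _ (compact_sqdist_le (T := rho) (AM _ Aa0))); first exact: closed_dual_of.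
  by move=> z [Mz /(_ a0 Aa0)].
have [ch hub] : continuous h /\ forall z, ubound [set D y z | y in C] (h z).
  exact: cvg_sup_compact.
have hA z : A z -> h z <= rho.
  move=> Az; apply: ge_sup; first by have [y Cy] := C0; exists (D y z); exists y.
  by move=> _ [y [_ /(_ z Az)] + <-]; rewrite sqdistC.
have rr0 : 0 < rho' - rho by rewrite subr_gt0.
pose F z := Num.max 0 (Num.min 1 ((rho' - h z) / (rho' - rho))).
have cF : continuous F.
  move=> z; apply: (@continuous_max _ _ (fun=> 0) _ z); first exact: cvg_cst.
  apply: (@continuous_min _ _ (fun=> 1) _ z); first exact: cvg_cst.
  apply: cvgM; last exact: cvg_cst.
  by apply: cvgB; [exact: cvg_cst|exact: ch].
have F01 z : 0 <= F z <= 1 by rewrite /F le_max lexx/= ge_max ler01/= ge_min lexx.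
have F0h z : 0 < F z -> h z < rho'.
  by rewrite /F lt_max ltxx/= lt_min ltr01/= pmulr_lgt0 ?invr_gt0// subr_gt0.
have FA z : A z -> F z = 1.
  move=> Az; rewrite /F min_l ?max_r// ler_pdivlMr// mul1r lerB//; exact: hA.
pose K := M `&` [set z | h z <= rho'].
have cK : compact K.
  have [y0 Cy0] := C0.
  apply: (subclosed_compact _ (compact_sqdist_le (T := rho') (CM _ Cy0))).
    apply: closedI; first exact: closed_space_form.
    by apply: (@preimage_closed _ _ h [set t | t <= rho']); [move=> z _; exact: ch|exact: closed_le].
  by move=> z [Mz hz]; split => //; apply: le_trans hz; apply: hub; exists y0.
have KM : K `<=` M by move=> z [].
have FK z : M z -> F z <> 0 -> K z.
  move=> Mz Fz; split => //=; apply/ltW/F0h; rewrite lt0r; apply/andP; split; first exact/eqP.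
  by have /andP[] := F01 z.
have [del [del0 Fdel]] := compact_support_modulus cF cK KM FK.
have [T HT] : exists T, forall z, K z -> D p z <= T.
  have [|K0] := pselect (K !=set0); last by exists 0 => z Kz; exfalso; apply: K0; exists z.
  move=> /compact_EVT_max /(_ cK) -/(_ _ (D p))[|b _ bmax].
    by apply: continuous_subspaceT => z; exact: continuous_sqdist.
  by exists (D p b) => z Kz; apply: bmax; exact/mem_set.
(* Off [M] the ramp may be positive and is cut to 0; the modulus, which concerns points of [M] only,
   is unaffected. *)
exists T, del, (fun z => if `[< M z >] then F z else 0); split => //.
have out z : ~ M z -> (if `[< M z >] then F z else 0) = 0 by move=> Mz; rewrite asboolF.
have pos z : 0 < (if `[< M z >] then F z else 0) -> M z /\ 0 < F z.
  by case: asboolP => //; rewrite ltxx.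
have mA : measurable (A : set BE).
  by apply: closed_measurable_ambient; exact: compact_closed.
have mM : measurable (M : set BE) by apply: closed_measurable_ambient; exact: closed_space_form.
split.
- by move=> z; case: ifP => // _; rewrite lexx ler01.
- by move=> e e0 z z' Mz Mz' zz'; rewrite !asboolT//; exact: Fdel zz'.
- move=> z /pos[Mz Fz]; split => //; apply: HT; apply: FK => // F0.
  by move: Fz; rewrite F0 ltxx.
- apply: le_measure; rewrite ?inE//.
    rewrite (_ : [set z | _] = M `&` F @^-1` [set t | 1 <= t]).
      apply: closed_measurable_ambient; apply: closedI; first exact: closed_space_form.
      by apply: preimage_closed; [move=> z _; exact: cF|exact: closed_ge].
    apply/seteqP; split => z /=; first by case: asboolP => // _; rewrite ler10.
    by move=> [Mz Fz]; rewrite asboolT.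
  by move=> z Az /=; rewrite asboolT ?FA//; exact: AM.
- apply: le_measure; rewrite ?inE; try by apply: closed_measurable_ambient; exact: closed_dual_of.
  move=> y Cy; split; first exact: CM.
  move=> u /= /pos[Mu /F0h hu]; rewrite sqdistC; apply: le_trans (ltW hu).
  by apply: hub; exists y.
Qed.

(** If the radial minimiser had [f x < 1] at some [x] inside the open ball, the set [1 <= f] would
    lie in the closed ball and miss a neighbourhood [N] of [x], hence have measure below that of the
    ball, which is [mu A]. *)
Lemma dual_of_open_ball_ge (A : set E) (rho rho' s : R) (p : E) : compact A -> A `<=` M ->
  (0 < mu A)%E -> dual_of g rho A !=set0 -> rho < rho' -> M p ->
  mu A = mu [set z | M z /\ (D p z <= s)%R] ->
  (mu (dual_of g rho A) <= mu (dual_of g rho' [set z | M z /\ (D p z < s)%R]))%E.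
Proof.
move=> cA AM A0 C0 rr Mp As.
have Ane : A !=set0.
  by apply/set0P/eqP => Ae; move: A0; rewrite Ae measure0 ltxx.
have [T [del [f0 [del0 cf0]]]] := exists_competitor cA AM Ane C0 rr Mp.
have [f cf fmono] := competitor_radial mu_refl mu_open mu_compact mu_M Mp del0 A0 cf0.
have [f01 fmod fs flev fdual] := cf.
have mf := measurable_competitor del0 cf.
suff fge1 x : M x -> D p x < s -> 1 <= f x.
  apply: (le_trans fdual); apply: le_measure; rewrite ?inE;
    try by apply: closed_measurable_ambient; exact: closed_dual_of.
  move=> z [Mz fz]; split => // u [Mu Du]; apply: fz => /=.
  by apply: lt_le_trans (fge1 u Mu Du).
move=> Mx xs; rewrite leNgt; apply/negP => fx.
pose B : set BE := [set z | M z /\ (D p z <= s)%R].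
have cB : compact (B : set E) by exact: compact_sqdist_le.
have mB : measurable B by apply: closed_measurable_ambient; exact: compact_closed.
have BM : B `<=` M by move=> z [].
have B0 : (mu B < +oo)%E by exact: mu_compact.
pose e := (1 - f x) / 2; have e0 : 0 < e by rewrite divr_gt0// subr_gt0.
pose N : set BE := [set z | D x z < del e] `&` [set z | D p z < s].
have oN : open (N : set E).
  apply: openI.
    by apply: (open_comp (fun z _ => @continuous_sqdist R g d x z) (@open_lt _ (del e))).
  by apply: (open_comp (fun z _ => @continuous_sqdist R g d p z) (@open_lt _ s)).
have mN : measurable N by exact: open_measurable_ambient.
have Nx : N x by split; rewrite /= ?sqdistxx ?del0.
have muN : (0 < mu (B `&` N))%E.
  rewrite (_ : B `&` N = N `&` M); first by rewrite -mu_M; exact: mu_open oN Mx Nx.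
  apply/seteqP; split => z; first by move=> [[Mz _] Nz].
  by move=> [[Nz Nz'] Mz]; split => //; split => //; exact: ltW.
have sub : [set z | 1 <= f z] `<=` B `\` N.
  move=> z /= fz; have [Mz _] := fs z (lt_le_trans ltr01 fz).
  have Dzx : D p z <= D p x.
    by rewrite leNgt; apply/negP => /(fmono x z Mx Mz) zx; move: fx; rewrite ltNge (le_trans fz zx).
  split; first by split => //; exact: le_trans Dzx (ltW xs).
  move=> [Dxz _]; have := fmod e e0 x z Mx Mz Dxz; rewrite ler_norml => /andP[+ _].
  by rewrite /e; lra.
have : (mu A <= mu (B `\` N))%E.
  apply: (le_trans flev); apply: le_measure; rewrite ?inE//; last exact: measurableD.
  by apply: measurable_set_bool; exact: measurable_fun_ler.
have -> : mu (B `\` N) = (mu B - mu (B `&` N))%E by exact: measureD.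
rewrite As -/B.
have IB : (mu (B `&` N) <= mu B)%E.
  by apply: le_measure; rewrite ?inE//; exact: measurableI.
have fB : mu B \is a fin_num by rewrite ge0_fin_numE.
have fI : mu (B `&` N) \is a fin_num by rewrite ge0_fin_numE//; exact: le_lt_trans IB B0.
move: muN fB fI; case: (mu (B `&` N)) => [u| |]//; case: (mu B) => [v| |]//.
by rewrite lte_fin -EFinB lee_fin => u0 _ _; rewrite lerBrDr gerDl leNgt u0.
Qed.

(** Two passages to the limit: the thresholds [rho + 1/(n+1)] decrease to [rho], and a point within
    [rho] of all of the open ball is within [rho] of its boundary points. *)
Lemma dual_of_ball_ge (A : set E) (rho s : R) (p : E) : compact A -> A `<=` M ->
  (0 < mu A)%E -> M p -> 0 < s -> (g = Spherical -> s <> 4) ->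
  mu A = mu [set z | M z /\ (D p z <= s)%R] ->
  (mu (dual_of g rho A) <= mu (dual_of g rho [set z | M z /\ (D p z <= s)%R]))%E.
Proof.
move=> cA AM A0 Mp s0 s4 As.
have [C0|C0] := pselect (dual_of g rho A !=set0); last first.
  rewrite (_ : dual_of g rho A = set0) ?measure0//.
  by apply/seteqP; split => // z Cz; apply: C0; exists z.
pose Q n : set BE := dual_of g (rho + n.+1%:R^-1) [set z | M z /\ D p z < s].
have mQ n : measurable (Q n) by apply: closed_measurable_ambient; exact: closed_dual_of.
have Q0 : (mu (Q 0%N) < +oo)%E.
  have cK := compact_sqdist_le (T := rho + 1%:R^-1) Mp.
  apply: (@le_lt_trans _ _ (mu [set y | M y /\ (D p y <= rho + 1%:R^-1)%R])).
    apply: le_measure; rewrite ?inE//.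
      by apply: closed_measurable_ambient; exact: compact_closed.
    by move=> z [Mz Qz]; split => //; apply: Qz; split; rewrite ?sqdistxx.
  by apply: mu_compact => // z [].
have : (mu (dual_of g rho A) <= mu (\bigcap_n Q n))%E.
  apply: measure_bigcap_ge => // [n m nm z [Mz Qz]|n].
    split => // u Bu; apply: (le_trans (Qz u Bu)).
    by rewrite lerD2l lef_pV2 ?posrE// ler_nat ltnS.
  by apply: dual_of_open_ball_ge => //; rewrite ltrDl invr_gt0.
move=> /le_trans; apply; apply: le_measure; rewrite ?inE.
- exact: bigcapT_measurable.
- by apply: closed_measurable_ambient; exact: closed_dual_of.
move=> z Qz; have [Mz _] := Qz 0%N I; split => // u [Mu].
have open_case v : M v -> D p v < s -> D v z <= rho.
  move=> Mv Dv; apply/ler_addgt0Pr => e e0.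
  have [_ /(_ v (conj Mv Dv)) Qv] := Qz (Num.truncn e^-1) I.
  apply: (le_trans Qv); rewrite lerD2l -[leRHS]invrK lef_pV2 ?posrE ?invr_gt0//.
  exact/ltW/truncnS_gt.
(* If a boundary point [u] had [rho < D u z], so would all nearby points, and by [sqdist_dense] some
   of these lie in the open ball. *)
rewrite le_eqVlt => /orP[/eqP us|]; last exact: open_case.
rewrite leNgt; apply/negP => uz.
have nu : nbhs u [set v | rho < D v z].
  have cz : (fun v => D v z) @ u --> D u z by apply: cvg_sqdist; [exact: cvg_id|exact: cvg_cst].
  exact: (cvgr_gt _ cz).
have pu : p <> u by move=> pu; move: s0; rewrite -us pu sqdistxx ltxx.
have u4 : g = Spherical -> D p u <> 4 by rewrite us.
have [v [Mv vz vs]] := sqdist_dense Mp Mu pu u4 nu.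
by have := open_case v Mv; rewrite -us => /(_ vs); rewrite leNgt vz.
Qed.

End DualMeasure.

Theorem theorem1 (R : realType) (d : nat) (hd : (1 < d)%N) (g : geometry)
    (r : R) (hr : admissible_radius g r)
    (A : set (@ambient R d)) (hAM : A `<=` space_form g d)
    (hAc : compact A) (hA0 : (0 < volume g A)%E)
    (B : set (@ambient R d))
    (hB : exists (p : @ambient R d) (rho : R),
        [/\ space_form g d p, 0 < rho & B = cball g p rho])
    (hAB : volume g A = volume g B) :
  (volume g (dual_set g A r) <= volume g (dual_set g B r))%E.
Proof.
have r0 : 0 < r by move: hr; rewrite /admissible_radius; case: (g) => // /andP[].
have [c c0 cV] := @cone_measure_volume R g d (ltnW hd).
have [rho [rho0 _ rhoE]] := dist_le_sqdist g d r0.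
have [p [s0 [Mp s00 BE]]] := hB; have [s [s_gt0 s4 sE]] := dist_le_sqdist g d s00.
have {}BE : B = [set z | space_form g d z /\ sqdist g p z <= s].
  by rewrite BE; apply/seteqP; split => z [Mz]; [rewrite sE//|split => //; rewrite sE].
have dualE X : X `<=` space_form g d -> dual_set g X r = dual_of g rho X.
  move=> XM; apply/seteqP; split => z [Mz Xz]; split => // u Xu.
    by have [_] := Xz u Xu; rewrite rhoE//; exact: XM.
  by split => //; rewrite rhoE//; [exact: Xz|exact: XM].
have BM : B `<=` space_form g d by rewrite BE => z [].
have cA : closed A by exact: compact_closed.
have cB : closed B by apply: compact_closed => //; rewrite BE; exact: compact_sqdist_le.
have cEp : (0 < c%:E)%E by rewrite lte_fin.
(* All four sets involved are closed, so their volumes become cone measures after multiplication by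
   [c]. *)
rewrite !dualE// -(@lee_pmul2l _ c%:E)//.
rewrite -!cV; try exact: closed_dual_of.
rewrite BE; apply: dual_of_ball_ge (s4) _ => //.
- by move=> x y Mx My xy S mS; exact: cone_measure_refl.
- by move=> U x; exact: cone_measure_open_gt0.
- by move=> S; exact: cone_measure_compact.
- by move=> S; exact: cone_measure_setI.
- by rewrite cV// mule_gt0.
- by rewrite -BE !cV// hAB.
Qed.
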